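(* Let $X$ be a computable Polish space, $\nu$ a computable Borel probability measure on $X$, and $(\mathscr F_n)$ an almost-full effective filtration equipped uniformly with Kurtz disintegrations $\rho^{(n)}$. Then: (1) for every $x\in\mathsf{SR}^\nu$, every computable $p\ge1$ and every $L_p(\nu)$ Schnorr test $f$, the point $x$ weakly computes a rate of convergence for $\mathbb E_\nu[f\mid\mathscr F_n](x)\to f(x)$; (2) for every $x\in\mathsf{SR}^\nu$ of computably dominated degree, every computable $p\ge1$ and every $L_p(\nu)$ Schnorr test $f$, there is a computable rate of convergence for $\mathbb E_\nu[f\mid\mathscr F_n](x)\to f(x)$.
   Context: A computable Polish space is a Polish space $X$ with a distinguished dense sequence $x_0,x_1,\dots$ and a compatible complete metric $d$ with $d(x_i,x_j)$ uniformly computable. An open set is c.e. open if it equals $\bigcup_i B(x_{n(i)},r_i)$ for computable $n(\cdot)$ and a computable sequence of positive rationals $r_i$. A function $f:X\to(-\infty,\infty]$ is lower semi-computable (lsc) if the sets $f^{-1}(q,\infty]$, $q\in\mathbb Q$, are uniformly c.e. open. A Borel probability measure $\nu$ is computable if $\nu(U)$ is left-c.e. uniformly in the c.e. open $U$. For computable $p\ge1$, an $L_p(\nu)$ Schnorr test is an lsc $f:X\to[0,\infty]$ with $\|f\|_p$ a computable real. $\mathsf{KR}^\nu$ is the set of points in every c.e. open set of $\nu$-measure 1; $\mathsf{SR}^\nu$ the set of $x$ with $f(x)<\infty$ for every $L_1(\nu)$ Schnorr test $f$. A $\nu$-computable basis is a computable sequence of c.e. open sets such that every c.e. open set is effectively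 a union of its members, finite unions of members have uniformly computable $\nu$-measure, and each member is uniformly paired with an effectively closed superset of equal $\nu$-measure. An almost-full effective filtration is an increasing sequence $(\mathscr F_n)$ of $\sigma$-algebras, $\mathscr F_n$ generated by a sequence $\{A_{n,m}\}_m$, uniformly computable in $n,m$, of members of the algebra generated by a $\nu$-computable basis, with a uniform procedure computing from a c.e. open $U$ a sequence $A_{n_i,m_i}$ with $U\cap\mathsf{KR}^\nu=\bigcup_iA_{n_i,m_i}\cap\mathsf{KR}^\nu$. For countably generated $\mathscr F$, $[x]_{\mathscr F}$ is the set of points in exactly the same members of $\mathscr F$ as $x$. A Borel measurable $\rho:X\to\mathcal M^+(X)$ (finite nonnegative Borel measures) is a Kurtz disintegration of $\mathscr F$ with respect to $\nu$ if: (a) for every Borel $f$ with $\int|f|d\nu<\infty$, $x\mapsto\int f\,d\rho_x$ is a version of the conditional expectation of $f$ given $\mathscr F$; (b) for $x\in\mathsf{KR}^\nu$, $\rho_x(X)=1$ and $\rho_x([x]_{\mathscr F}\cap\mathsf{KR}^\nu)=1$; (c) $x\mapsto\rho_x(U)$ is lsc uniformly in c.e. open $U$. The filtration is equipped uniformly with such $\rho^{(n)}$ for $\mathscr F_n$, and $\mathbb E_\nu[f\mid\mathscr F_n](x)=\int f\,d\rho^{(n)}_x$. A rate of convergence for real numbers $y_n\to y$ is a function $m:\mathbb Q^{>0}\to\mathbb N$ with $|y_n-y|<\epsilon$ for all rational $\epsilon>0$ and all $n\ge m(\epsilon)$. A point $x$ weakly computes an object with a property if for every function $i\mapsto n(i)$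 with $d(x_{n(i)},x)\le2^{-i}$ for all $i$, some object with that property is Turing reducible to $i\mapsto n(i)$. A Turing degree is computably dominated if every function $\mathbb N\to\mathbb N$ computable from it is eventually dominated by a computable function; $x$ is of computably dominated degree if some $i\mapsto n(i)$ with $d(x_{n(i)},x)\le2^{-i}$ for all $i$ has computably dominated Turing degree. *)

(* Defs.v *)
From HB Require Import structures.
From Stdlib Require Cantor.
From mathcomp Require Import all_boot all_order all_algebra.
From mathcomp Require Import all_classical all_reals all_analysis measurable_realfun.

Set Implicit Arguments.
Unset Strict Implicit.
Unset Printing Implicit Defensive.

Import Order.TTheory GRing.Theory Num.Theory.

(** * Computability relative to an oracle *)

Definition npair (a b : nat) : nat := Cantor.to_nat (a, b).
Arguments npair (a b)%_N.
Definition nfst (n : nat) : nat := (Cantor.of_nat n).1.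
Definition nsnd (n : nat) : nat := (Cantor.of_nat n).2.

(* Unary mu-recursive programs with an oracle; several arguments are passed
   through [npair]. *)
Inductive prog : Type :=
| PZero | PSucc | PFst | PSnd | POracle
| PPair of prog & prog
| PComp of prog & prog
| PRec of prog & prog
| PMin of prog.

(* [run o p a b]: with oracle [o], program [p] halts on input [a] with output
   [b].  In the [PRec] case [v] is the sequence of values of the recursion on
   [nsnd a] with parameter [nfst a]. *)
Fixpoint run (o : nat -> nat) (p : prog) (a b : nat) : Prop :=
  match p with
  | PZero => b = 0%N
  | PSucc => b = a.+1
  | PFst => b = nfst a
  | PSnd => b = nsnd a
  | POracle => b = o a
  | PPair q r => exists u v, [/\ run o q a u, run o r a v & b = npair u v]
  | PComp q r => exists2 u, run o r a u & run o q u b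
  | PRec q r => exists v : nat -> nat,
      [/\ run o q (nfst a) (v 0%N),
          forall i, (i < nsnd a)%N ->
            run o r (npair (nfst a) (npair i (v i))) (v i.+1)
        & b = v (nsnd a)]
  | PMin q => run o q (npair a b) 0%N /\
      forall i, (i < b)%N -> exists v, run o q (npair a i) v.+1
  end.

Definition turing_le (f g : nat -> nat) : Prop :=
  exists p, forall a, run g p a (f a).

Definition no_oracle : nat -> nat := fun=> 0%N.

Definition computes (p : prog) (f : nat -> nat) : Prop :=
  forall a, run no_oracle p a (f a).

Definition computable (f : nat -> nat) : Prop := exists p, computes p f.

Fixpoint prog_code (p : prog) : nat :=
  match p with
  | PZero => npair 0 0
  | PSucc => npair 1 0
  | PFst => npair 2 0
  | PSnd => npair 3 0
  | POracle => npair 4 0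
  | PPair q r => npair 5 (npair (prog_code q) (prog_code r))
  | PComp q r => npair 6 (npair (prog_code q) (prog_code r))
  | PRec q r => npair 7 (npair (prog_code q) (prog_code r))
  | PMin q => npair 8 (prog_code q)
  end.

Definition computably_dominated (g : nat -> nat) : Prop :=
  forall h, turing_le h g ->
    exists2 b, computable b & exists N, forall n, (N <= n)%N -> (h n <= b n)%N.

Local Open Scope classical_set_scope.
Local Open Scope ring_scope.

(** * Names of rationals, reals and sequences *)

(* Surjective (not injective) numberings of the rationals and of the positive
   rationals. *)
Definition ratn (k : nat) : rat :=
  ((nfst (nfst k))%:R - (nsnd (nfst k))%:R) / (nsnd k).+1%:R.
Definition posratn (k : nat) : rat := (nfst k).+1%:R / (nsnd k).+1%:R.

Definition slice (g : nat -> nat) (k : nat) : nat -> nat :=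
  fun i => g (npair k i).

(* For a naming relation [name g y], read "[g] is a name of [y]": the members
   of [y] are uniformly computable when they are named by the slices of a
   single computable function. *)
Definition computable_elt T (name : (nat -> nat) -> T -> Prop) (y : T) : Prop :=
  exists2 g, computable g & name g y.
Definition computable_seq T (name : (nat -> nat) -> T -> Prop)
    (y : nat -> T) : Prop :=
  exists2 g, computable g & forall k, name (slice g k) (y k).

Definition real_name (R : realType) (g : nat -> nat) (y : R) : Prop :=
  forall i, `|ratr (ratn (g i)) - y| <= 2 ^- i.

Definition computable_real (R : realType) (y : R) : Prop :=
  computable_elt (@real_name R) y.

Definition left_ce_name (R : realType) (g : nat -> nat) (y : \bar R) : Prop :=
  y = ereal_sup (range (fun i => (ratr (ratn (g i)) : R)%:E)).

(* The union of the [B k] such that [k.+1] is a value of [g]; the value [0]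
   lists nothing, so that finite and empty lists are allowed. *)
Definition listed T (B : nat -> set T) (g : nat -> nat) : set T :=
  \bigcup_i (if g i is k.+1 then B k else set0).

(** * Computable Polish spaces *)

#[short(type="completeMetricType")]
HB.structure Definition CompleteMetric (R : numDomainType) :=
  { T of Complete T & Metric R T }.

Notation borel X := (g_sigma_algebraType (@open X)).

Section ComputablePolish.
Variables (R : realType) (X : completeMetricType R) (s : nat -> X).

Definition computable_polish : Prop :=
  dense (range s) /\
  computable_seq (@real_name R)
    (fun k => mdist (s (nfst k)) (s (nsnd k))).

Definition basic_ball (k : nat) : set X :=
  ball (s (nfst k)) (ratr (posratn (nsnd k))).

Definition open_name (g : nat -> nat) (U : set X) : Prop :=
  U = listed basic_ball g.

Definition ce_open (U : set X) : Prop := computable_elt open_name U.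

(* A uniform procedure which, from (the code of) any program enumerating a
   c.e. open set [U], computes a name of [Phi U]. *)
Definition uniform_in_ce_open T (name : (nat -> nat) -> T -> Prop)
    (Phi : set X -> T) : Prop :=
  exists h : prog, forall (p : prog) (g : nat -> nat), computes p g ->
    exists r : nat -> nat,
      (forall i, run no_oracle h (npair (prog_code p) i) (r i)) /\
      name r (Phi (listed basic_ball g)).

Definition lsc_name (g : nat -> nat) (f : X -> \bar R) : Prop :=
  (forall x, (-oo < f x)%E) /\
  forall k, open_name (slice g k) [set x | ((ratr (ratn k))%:E < f x)%E].

Definition lsc (f : X -> \bar R) : Prop := computable_elt lsc_name f.

(* [s nm(0), s nm(1), ...] converges fast to [x]. *)
Definition point_name (nm : nat -> nat) (x : X) : Prop :=
  forall i, mdist (s (nm i)) x <= 2 ^- i.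

(* The objects are functions on the positive rationals. *)
Definition weakly_computes (x : X) (P : (rat -> nat) -> Prop) : Prop :=
  forall nm, point_name nm x ->
    exists2 m, P m & turing_le (m \o posratn) nm.

Definition computably_dominated_degree (x : X) : Prop :=
  exists2 nm, point_name nm x & computably_dominated nm.

Variable nu : probability (borel X) R.

Definition computable_measure : Prop :=
  uniform_in_ce_open (@left_ce_name R) (nu : set X -> \bar R).

Definition schnorr_test (p : R) (f : X -> \bar R) : Prop :=
  [/\ lsc f, forall x, (0 <= f x)%E
    & exists2 c : R, computable_real c & ('N[nu]_(p%:E)[f] = c%:E)%E].

Definition KR : set X :=
  [set x | forall U, ce_open U -> nu U = 1%E -> U x].

Definition SR : set X :=
  [set x | forall f, schnorr_test 1 f -> (f x < +oo)%E].

(** * Almost-full effective filtrations *)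

Definition computable_basis (B : nat -> set X) : Prop :=
  [/\ computable_seq open_name B,
      uniform_in_ce_open (fun r U => U = listed B r) id,
      computable_seq (@real_name R)
        (fun k => fine (nu (\big[setU/set0]_(j <- CodeSeq.decode k) B j)))
    & exists C : nat -> set X,
        [/\ computable_seq open_name (fun j => ~` C j),
            forall j, B j `<=` C j
          & forall j, nu (C j) = nu (B j)] ].

(* Terms for the members of the algebra of sets generated by [B]. *)
Inductive alg_term : Type :=
| AAtom of nat
| ACompl of alg_term
| AUnion of alg_term & alg_term.

Fixpoint alg_set (B : nat -> set X) (e : alg_term) : set X :=
  match e with
  | AAtom j => B j
  | ACompl e1 => ~` alg_set B e1
  | AUnion e1 e2 => alg_set B e1 `|` alg_set B e2
  end.

Fixpoint alg_code (e : alg_term) : nat :=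
  match e with
  | AAtom j => npair 0 j
  | ACompl e1 => npair 1 (alg_code e1)
  | AUnion e1 e2 => npair 2 (npair (alg_code e1) (alg_code e2))
  end.

Definition effective_filtration (F : nat -> set (set X)) : Prop :=
  (forall n, F n `<=` F n.+1) /\
  exists (B : nat -> set X) (t : nat -> nat -> alg_term),
    let A n m := alg_set B (t n m) in
    [/\ computable_basis B,
        computable (fun k => alg_code (t (nfst k) (nsnd k))),
        forall n, F n = <<s range (A n) >>
      & uniform_in_ce_open
          (fun r U => U `&` KR =
             listed (fun k => A (nfst k) (nsnd k)) r `&` KR) id].

(** * Kurtz disintegrations *)

Definition atom_class (F : set (set X)) (x : X) : set X :=
  [set y | forall S, F S -> (S x <-> S y)].

(* Versions are taken up to almost sure equality: [g] itself need not be
   [F]-measurable. *)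
Definition cond_exp_version (F : set (set X)) (f g : X -> \bar R) : Prop :=
  exists g0 : borel X -> \bar R,
    [/\ forall E : set (\bar R), measurable E -> F (g0 @^-1` E),
        nu.-integrable setT g0,
        forall S, F S -> (\int[nu]_(x in S) g0 x = \int[nu]_(x in S) f x)%E
      & {ae nu, forall x, g x = g0 x}].

(* The Borel structure on the finite measures is the one generated by the
   evaluations at Borel sets. *)
Definition kurtz_disintegration (F : set (set X))
    (rho : X -> {finite_measure set (borel X) -> \bar R}) : Prop :=
  [/\ forall E : set (borel X), measurable E ->
        measurable_fun [set: borel X] (fun x => rho x E),
      forall f : borel X -> \bar R, nu.-integrable setT f ->
        cond_exp_version F f (fun x => \int[rho x]_y f y)%E,
      forall x, KR x -> rho x setT = 1%E /\ rho x (atom_class F x `&` KR) = 1%E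
    & uniform_in_ce_open lsc_name (fun U x => rho x U)].

Definition uniform_kurtz_disintegrations (F : nat -> set (set X))
    (rho : nat -> X -> {finite_measure set (borel X) -> \bar R}) : Prop :=
  (forall n, kurtz_disintegration (F n) (rho n)) /\
  uniform_in_ce_open
    (fun r (phi : nat -> X -> \bar R) => forall n, lsc_name (slice r n) (phi n))
    (fun U n x => rho n x U).

End ComputablePolish.

(** * Rates of convergence *)

(* [y_] and [y] are required to be real; only the values of [m] at positive
   rationals matter. *)
Definition convergence_rate (R : realType) (y_ : nat -> \bar R) (y : \bar R)
    (m : rat -> nat) : Prop :=
  [/\ forall n, y_ n \is a fin_num, y \is a fin_num
    & forall eps : rat, 0 < eps -> forall n, (m eps <= n)%N ->
        (`|y_ n - y| < (ratr eps)%:E)%E].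

(* Main.v *)
(* On Kurtz random points, a lower semi-computable f >= 0 is the supremum of
   steps q_i 1_{D_i} with D_i a set of the filtration.  Let phi_t be the maximum
   of the first t steps.  It is measurable for F_n as soon as n >= N(t), with N
   computable, and from then on E[phi_t | F_n] = phi_t at every Kurtz random
   point, since the disintegration is carried by the atom of that point.

   Since ||f||_p is computable, one can search for t_i such that phi_(t_i) is
   exponentially close to f in L_p, hence in L_1.  By the maximal inequality,
   M_i = max_n E[phi_(t_(i+1)) - phi_(t_i) | F_n] is small outside a set of small
   measure; only n <= N(t_(i+1)) matter.  On Kurtz random points both M_i and
   -M_i are lower semi-computable, so the integral of min(1, 2^i M_i) is
   computable and sum_i min(1, 2^i M_i) is an L_1 Schnorr test.  At a Schnorr
   random point, therefore, M_i < 2^-i for all large i, and telescoping gives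
   |E[f | F_n] - f| <= 2 * 2^-k for all large k and all n >= N(t_k).  The rate so
   obtained is computable outright, which yields both parts of the theorem. *)
From Stdlib Require Cantor.
Require Import Defs.
From mathcomp Require Import all_boot all_order all_algebra.
From mathcomp Require Import all_classical all_reals all_analysis measurable_realfun.
From mathcomp Require Import zify ring lra.

Set Implicit Arguments.
Unset Strict Implicit.
Unset Printing Implicit Defensive.

Import Order.TTheory GRing.Theory Num.Theory.

(** * Computability *)

(** All effectivity is relative to the set [K] of Kurtz random points. Members of the algebra need
    not be open, but on [K] they are uniformly effectively clopen, so a step on such a set is
    computable there and not merely lower semi-computable. Both [nu] and each [rho n x] with [x] in
    [K] are carried by [K], so integrals over [K] lose nothing. A step function is moreover bounded
    and [rho n x] has mass 1 on [K], which bounds its conditional expectation effectively from above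
    as well as from below; for [f] itself only lower bounds are available. A supremum over all [n]
    would again be only lower semi-computable: the finite range of [n] is what keeps the integrals
    of the test computable.

    The norm gives access only to integrals of p-th powers; an elementary inequality turns a gap of
    size [2^-dl] between these into an L_1 gap of order [2^-3i]. The maximal inequality is then used
    with threshold [2^-2i] and weight [2^i], so that both of its terms are of order [2^-i]. The
    index from which the bounds hold depends on the point, but it is a single natural number and can
    be built into the rate. *)

Lemma nfstK a b : nfst (npair a b) = a.
Proof. by rewrite /nfst /npair Cantor.cancel_of_to. Qed.

Lemma nsndK a b : nsnd (npair a b) = b.
Proof. by rewrite /nsnd /npair Cantor.cancel_of_to. Qed.

Lemma npairK n : npair (nfst n) (nsnd n) = n.
Proof. by rewrite /nfst /nsnd /npair -surjective_pairing Cantor.cancel_to_of. Qed.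

Lemma npair_inj a b c d : npair a b = npair c d -> a = c /\ b = d.
Proof. by move=> /Cantor.to_nat_inj[]. Qed.

Lemma leq_npairl a b : (a <= npair a b)%N.
Proof. by have := Cantor.to_nat_non_decreasing a b; rewrite /npair; lia. Qed.

Lemma leq_npairr a b : (b <= npair a b)%N.
Proof. by have := Cantor.to_nat_non_decreasing a b; rewrite /npair; lia. Qed.

Arguments npair : simpl never.
Arguments nfst : simpl never.
Arguments nsnd : simpl never.
#[global] Opaque npair nfst nsnd.

Section Computable.
Implicit Types F G B : nat -> nat.

Lemma eq_computable F G : F =1 G -> computable F -> computable G.
Proof. by move=> /funext ->. Qed.

Lemma computable_comp F G : computable F -> computable G ->
  computable (fun n => F (G n)).
Proof. by move=> [p hp] [q hq]; exists (PComp p q) => a; exists (G a). Qed.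

Lemma computable_pair F G : computable F -> computable G ->
  computable (fun n => npair (F n) (G n)).
Proof.
by move=> [p hp] [q hq]; exists (PPair p q) => a; exists (F a), (G a).
Qed.

Lemma computable_fst F : computable F -> computable (fun n => nfst (F n)).
Proof. by move=> hF; apply: (computable_comp _ hF); exists PFst. Qed.

Lemma computable_snd F : computable F -> computable (fun n => nsnd (F n)).
Proof. by move=> hF; apply: (computable_comp _ hF); exists PSnd. Qed.

Lemma computable_succ F : computable F -> computable (fun n => (F n).+1).
Proof. by move=> hF; apply: (computable_comp _ hF); exists PSucc. Qed.

Lemma computable_id : computable (fun n => n).
Proof.
exists (PPair PFst PSnd) => a; exists (nfst a), (nsnd a).
by split=> //; rewrite npairK.
Qed.

Lemma computable_const c : computable (fun=> c).
Proof.
by elim: c => [|c IH]; [exists PZero | exact: computable_succ].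
Qed.

Lemma computable_app2 (f : nat -> nat -> nat) F G :
  computable (fun m => f (nfst m) (nsnd m)) ->
  computable F -> computable G -> computable (fun n => f (F n) (G n)).
Proof.
move=> hf hF hG; have := computable_comp hf (computable_pair hF hG).
by apply: eq_computable => n; rewrite nfstK nsndK.
Qed.

Lemma computable_iteri B F (f : nat -> nat -> nat -> nat) :
  computable B -> computable F ->
  computable (fun m => f (nfst m) (nfst (nsnd m)) (nsnd (nsnd m))) ->
  computable (fun n => iteri (B n) (f n) (F n)).
Proof.
move=> hB [q hq] [r hr].
have h : computable (fun m => iteri (nsnd m) (f (nfst m)) (F (nfst m))).
  exists (PRec q r) => a.
  exists (fun i => iteri i (f (nfst a)) (F (nfst a))); split => // i _.
  by have := hr (npair (nfst a) (npair i (iteri i (f (nfst a)) (F (nfst a)))));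
    rewrite !(nfstK, nsndK).
exact: (computable_app2 (f := fun a b => iteri b (f a) (F a)) h computable_id hB).
Qed.

Lemma computable_add F G : computable F -> computable G ->
  computable (fun n => F n + G n)%N.
Proof.
move=> hF hG; have := computable_iteri (f := fun _ _ v => v.+1) hF hG.
have /[swap]/[apply] : computable (fun m => (nsnd (nsnd m)).+1).
  exact/computable_succ/computable_snd/computable_snd/computable_id.
by apply: eq_computable => n; elim: (F n) => //= m ->.
Qed.

Lemma computable_pred F : computable F -> computable (fun n => (F n).-1).
Proof.
move=> hF.
have := computable_iteri (f := fun _ i _ => i) hF (computable_const 0).
have /[swap]/[apply] : computable (fun m => nfst (nsnd m)).
  exact/computable_fst/computable_snd/computable_id.
by apply: eq_computable => n; case: (F n).
Qed.

Lemma computable_sub F G : computable F -> computable G ->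
  computable (fun n => F n - G n)%N.
Proof.
move=> hF hG; have := computable_iteri (f := fun _ _ v => v.-1) hG hF.
have /[swap]/[apply] : computable (fun m => (nsnd (nsnd m)).-1).
  exact/computable_pred/computable_snd/computable_snd/computable_id.
by apply: eq_computable => n; elim: (G n) => //= [|m ->]; rewrite ?subn0 ?subnS.
Qed.

Lemma computable_sum B (f : nat -> nat -> nat) : computable B ->
  computable (fun m => f (nfst m) (nsnd m)) ->
  computable (fun n => \sum_(i < B n) f n i)%N.
Proof.
move=> hB hf.
have := computable_iteri (f := fun n i v => (v + f n i)%N) hB (computable_const 0).
have /[swap]/[apply] :
    computable (fun m => (nsnd (nsnd m) + f (nfst m) (nfst (nsnd m)))%N).
  apply: computable_add; first exact/computable_snd/computable_snd/computable_id.
  apply: (computable_app2 hf); first exact/computable_fst/computable_id.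
  exact/computable_fst/computable_snd/computable_id.
apply: eq_computable => n; elim: (B n) => [|m IH] /=; first by rewrite big_ord0.
by rewrite big_ord_recr /= IH.
Qed.

Lemma computable_mul F G : computable F -> computable G ->
  computable (fun n => F n * G n)%N.
Proof.
move=> hF hG.
have := computable_sum (f := fun n _ => G n) hF.
have /[swap]/[apply] := computable_comp hG (computable_fst computable_id).
by apply: eq_computable => n; rewrite sum_nat_const card_ord.
Qed.

Lemma computable_expn F G : computable F -> computable G ->
  computable (fun n => F n ^ G n)%N.
Proof.
move=> hF hG.
have := computable_iteri (f := fun n _ v => (F n * v)%N) hG (computable_const 1).
have /[swap]/[apply] : computable (fun m => (F (nfst m) * nsnd (nsnd m))%N).
  apply: computable_mul.
    exact: (computable_comp hF (computable_fst computable_id)).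
  exact/computable_snd/computable_snd/computable_id.
by apply: eq_computable => n; elim: (G n) => //= m ->; rewrite expnS.
Qed.

Definition cdec (P : nat -> bool) : Prop := computable (fun n => nat_of_bool (P n)).

Lemma cdec_neg (P : nat -> bool) : cdec P -> cdec (fun n => ~~ P n).
Proof.
move=> hP; have := computable_sub (computable_const 1) hP.
by apply: eq_computable => n; case: (P n).
Qed.

Lemma cdec_and (P Q : nat -> bool) : cdec P -> cdec Q ->
  cdec (fun n => P n && Q n).
Proof.
move=> hP hQ; have := computable_mul hP hQ.
by apply: eq_computable => n; rewrite mulnb.
Qed.

Lemma cdec_or (P Q : nat -> bool) : cdec P -> cdec Q ->
  cdec (fun n => P n || Q n).
Proof.
move=> /cdec_neg hP /cdec_neg hQ; have := cdec_neg (cdec_and hP hQ).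
by apply: eq_computable => n; rewrite -negb_or negbK.
Qed.

Lemma cdec_leq F G : computable F -> computable G -> cdec (fun n => F n <= G n)%N.
Proof.
move=> hF hG.
have := computable_sub (computable_const 1) (computable_sub hF hG).
apply: eq_computable => n; rewrite /leq; by case: (F n - G n)%N.
Qed.

Lemma cdec_eq F G : computable F -> computable G -> cdec (fun n => F n == G n).
Proof.
move=> hF hG; have := cdec_and (cdec_leq hF hG) (cdec_leq hG hF).
by apply: eq_computable => n; rewrite eqn_leq.
Qed.

Lemma cdec_comp (P : nat -> bool) F : cdec P -> computable F ->
  cdec (fun n => P (F n)).
Proof. exact: computable_comp. Qed.

Lemma cdec_forall B (P : nat -> nat -> bool) : computable B ->
  cdec (fun m => P (nfst m) (nsnd m)) ->
  cdec (fun n => [forall i : 'I_(B n), P n i]).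
Proof.
move=> hB hP.
have := cdec_eq (computable_sum (f := fun n i => nat_of_bool (~~ P n i)) hB
  (cdec_neg hP)) (computable_const 0).
apply: eq_computable => n; congr nat_of_bool.
rewrite sum_nat_eq0; apply: eq_forallb => i.
by rewrite /=; case: (P n i).
Qed.

Lemma computable_if (P : nat -> bool) F G : cdec P -> computable F -> computable G ->
  computable (fun n => if P n then F n else G n).
Proof.
move=> hP hF hG.
have := computable_add (computable_mul hP hF) (computable_mul (cdec_neg hP) hG).
by apply: eq_computable => n; case: (P n); rewrite /= ?mul1n ?mul0n ?addn0.
Qed.

Lemma computable_ex_minn (P : nat -> nat -> bool) (H : forall n, exists m, P n m) :
  cdec (fun m => P (nfst m) (nsnd m)) -> computable (fun n => ex_minn (H n)).
Proof.
move=> /cdec_neg[p hp]; exists (PMin p) => a; case: ex_minnP => m Pm mmin.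
split; first by have := hp (npair a m); rewrite nfstK nsndK Pm.
move=> i im; exists 0; have := hp (npair a i); rewrite nfstK nsndK.
by case: (boolP (P a i)) => // /mmin; rewrite leqNgt im.
Qed.

End Computable.

(** [no_oracle] answers every query by 0, so putting [PZero] for [POracle] yields a program that
    behaves alike with any oracle. *)
Lemma run_no_oracle o p : exists q, forall a b, run o q a b <-> run no_oracle p a b.
Proof.
elim: p => [||||| p1 [q1 h1] p2 [q2 h2]| p1 [q1 h1] p2 [q2 h2]
  | p1 [q1 h1] p2 [q2 h2]| p1 [q1 h1]].
- by exists PZero.
- by exists PSucc.
- by exists PFst.
- by exists PSnd.
- by exists PZero.
- exists (PPair q1 q2) => a b /=.
  by split=> -[u [v [/h1 ? /h2 ? ?]]]; exists u, v.
- exists (PComp q1 q2) => a b /=.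
  by split=> -[u /h2 ? /h1 ?]; exists u.
- exists (PRec q1 q2) => a b /=.
  by split=> -[v [/h1 ? h ?]]; exists v; split=> // i /h /h2.
- exists (PMin q1) => a b /=; split=> -[/h1 ? h]; split=> // i /h[v /h1 ?];
  by exists v.
Qed.

Lemma computable_turing_le f o : computable f -> turing_le f o.
Proof.
move=> [p hp]; have [q hq] := run_no_oracle o p.
by exists q => a; apply/hq/hp.
Qed.

(** Every number codes an infinite sequence, the heads of its iterated tails. No length is stored:
    the bound always comes from the context. *)
Definition lookup (w j : nat) : nat := nfst (iter j nsnd w).

Lemma lookup_exists (b : nat) (f : nat -> nat) :
  exists w, forall j, (j < b)%N -> lookup w j = f j.
Proof.
elim: b f => [|b IH] f; first by exists 0.
have [w hw] := IH (f \o S).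
exists (npair (f 0) w) => -[|j] jb; rewrite /lookup ?iterSr /=; first by rewrite nfstK.
by rewrite nsndK -/(lookup w j) hw.
Qed.

Lemma computable_lookup F G : computable F -> computable G ->
  computable (fun n => lookup (F n) (G n)).
Proof.
move=> hF hG; apply: computable_fst.
have := computable_iteri (f := fun _ _ v => nsnd v) hG hF.
have /[swap]/[apply] : computable (fun m => nsnd (nsnd (nsnd m))).
  exact/computable_snd/computable_snd/computable_snd/computable_id.
by apply: eq_computable => n; elim: (G n) => //= m ->.
Qed.

(** * Closure properties of c.e. relations *)

Section CeRelations.
Implicit Types S : nat -> Prop.

Definition ce S : Prop := exists2 r : nat -> bool, cdec r &
  forall n, S n <-> exists i, r (npair n i).

Lemma eq_ce S S' : (forall n, S n <-> S' n) -> ce S -> ce S'.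
Proof.
by move=> h [r hr rS]; exists r => // n; split=> [/h /rS //|/rS /h].
Qed.

Lemma ce_dec (P : nat -> bool) : cdec P -> ce P.
Proof.
move=> hP; exists (fun m => P (nfst m)).
  exact: (cdec_comp hP (computable_fst computable_id)).
move=> n; split=> [Pn|[i]]; last by rewrite nfstK.
by exists 0; rewrite nfstK.
Qed.

Lemma ce_comp S F : ce S -> computable F -> ce (fun n => S (F n)).
Proof.
move=> [r hr rS] hF; exists (fun m => r (npair (F (nfst m)) (nsnd m))).
  apply: (cdec_comp hr); apply: computable_pair.
    exact: (computable_comp hF (computable_fst computable_id)).
  exact: (computable_snd computable_id).
move=> n; split=> [/rS[i ri]|[i]]; first by exists i; rewrite nfstK nsndK.
by rewrite nfstK nsndK => ri; apply/rS; exists i.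
Qed.

Lemma ce_app2 (S : nat -> nat -> Prop) F G : ce (fun m => S (nfst m) (nsnd m)) ->
  computable F -> computable G -> ce (fun n => S (F n) (G n)).
Proof.
move=> hS hF hG; have := ce_comp hS (computable_pair hF hG).
by apply: eq_ce => n; rewrite nfstK nsndK.
Qed.

Lemma ce_and S S' : ce S -> ce S' -> ce (fun n => S n /\ S' n).
Proof.
move=> [r hr rS] [r' hr' rS'].
exists (fun m => r (npair (nfst m) (nfst (nsnd m))) &&
                 r' (npair (nfst m) (nsnd (nsnd m)))).
  have h1 := computable_fst computable_id.
  have h2 := computable_snd computable_id.
  apply: cdec_and.
    by apply: (cdec_comp hr); apply: computable_pair => //; exact: computable_fst.
  by apply: (cdec_comp hr'); apply: computable_pair => //; exact: computable_snd.
move=> n; split=> [[/rS[i ri] /rS'[j rj]]|[m]].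
  by exists (npair i j); rewrite !(nfstK, nsndK) ri.
rewrite nfstK nsndK => /andP[ri rj].
by split; [apply/rS; exists (nfst m)|apply/rS'; exists (nsnd m)].
Qed.

Lemma ce_or S S' : ce S -> ce S' -> ce (fun n => S n \/ S' n).
Proof.
move=> [r hr rS] [r' hr' rS']; exists (fun m => r m || r' m); first exact: cdec_or.
move=> n; split=> [[/rS[i ri]|/rS'[i ri]]|[i /orP[ri|ri]]].
- by exists i; rewrite ri.
- by exists i; rewrite ri orbT.
- by left; apply/rS; exists i.
- by right; apply/rS'; exists i.
Qed.

Lemma ce_ex (S : nat -> nat -> Prop) : ce (fun m => S (nfst m) (nsnd m)) ->
  ce (fun n => exists m, S n m).
Proof.
move=> [r hr rS].
exists (fun m => r (npair (npair (nfst m) (nfst (nsnd m))) (nsnd (nsnd m)))).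
  have h1 := computable_fst computable_id.
  have h2 := computable_snd computable_id.
  apply: (cdec_comp hr); do 2?apply: computable_pair => //.
    exact: computable_fst.
  exact: computable_snd.
move=> n; split=> [[m Snm]|[m]].
  have [i ri] : exists i, r (npair (npair n m) i) by apply/rS; rewrite nfstK nsndK.
  by exists (npair m i); rewrite !(nfstK, nsndK).
rewrite nfstK nsndK => rm; exists (nfst m).
have /rS : exists i, r (npair (npair n (nfst m)) i) by exists (nsnd m).
by rewrite nfstK nsndK.
Qed.

(** Finitely many existential witnesses fit into one [lookup] table, so the bounded quantifier moves
    inside the existential one. *)
Lemma ce_forall_lt B (S : nat -> nat -> Prop) : computable B ->
  ce (fun m => S (nfst m) (nsnd m)) ->
  ce (fun n => forall m, (m < B n)%N -> S n m).
Proof.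
move=> hB [r hr rS].
exists (fun m => [forall i : 'I_(B (nfst m)),
    r (npair (npair (nfst m) i) (lookup (nsnd m) i))]).
  have h1 := computable_fst computable_id.
  have h2 := computable_snd computable_id.
  apply: (@cdec_forall _ (fun m i => r (npair (npair (nfst m) i) (lookup (nsnd m) i)))).
    exact: computable_comp.
  apply: (cdec_comp hr); apply: computable_pair.
    by apply: computable_pair => //; exact: computable_fst.
  by apply: computable_lookup => //; exact: computable_snd.
have rS2 n m : S n m <-> exists i, r (npair (npair n m) i).
  by rewrite -rS nfstK nsndK.
move=> n; split=> [h|[w]].
  have h' m : exists i, (m < B n)%N -> r (npair (npair n m) i).
    have [/h/rS2[i ri]|] := boolP (m < B n)%N; first by exists i.
    by exists 0.
  have [f hf] := choice h'; have [w hw] := lookup_exists (B n) f.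
  exists w; rewrite nfstK nsndK; apply/forallP => i.
  by rewrite hw //; apply: hf.
rewrite nfstK nsndK => /forallP h m mB; apply/rS2.
by exists (lookup w m); have := h (Ordinal mB).
Qed.

(** The search runs over pairs of a value and a witness for it, and stops at the least pair that
    passes the decidable test. *)
Lemma ce_select (S : nat -> nat -> Prop) : ce (fun m => S (nfst m) (nsnd m)) ->
  (forall n, exists m, S n m) -> exists2 g, computable g & forall n, S n (g n).
Proof.
move=> [r hr rS] tot.
have rS2 n m : S n m <-> exists i, r (npair (npair n m) i).
  by rewrite -rS nfstK nsndK.
pose P n m := r (npair (npair n (nfst m)) (nsnd m)).
have H n : exists m, P n m.
  have [m /rS2[i ri]] := tot n; by exists (npair m i); rewrite /P nfstK nsndK.
exists (fun n => nfst (ex_minn (H n))).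
  apply/computable_fst/computable_ex_minn; apply: (cdec_comp hr).
  have h1 := computable_fst computable_id.
  have h2 := computable_snd computable_id.
  do 2?apply: computable_pair => //; [exact: computable_fst|exact: computable_snd].
by move=> n; case: ex_minnP => m Pm _; apply/rS2; exists (nsnd m).
Qed.

(** The output format is that of [listed]: successors list elements and 0 lists nothing, so an empty
    section causes no trouble. *)
Lemma ce_enum (S : nat -> nat -> Prop) : ce (fun m => S (nfst m) (nsnd m)) ->
  exists2 g, computable g & forall n k, S n k <-> exists i, slice g n i = k.+1.
Proof.
move=> [r hr rS].
have rS2 n m : S n m <-> exists i, r (npair (npair n m) i).
  by rewrite -rS nfstK nsndK.
exists (fun m => if r (npair (npair (nfst m) (nfst (nsnd m))) (nsnd (nsnd m)))
                 then (nfst (nsnd m)).+1 else 0).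
  have h1 := computable_fst computable_id.
  have h2 := computable_snd computable_id.
  apply: computable_if; last exact: computable_const.
    apply: (cdec_comp hr); do 2?apply: computable_pair => //.
      exact: computable_fst.
    exact: computable_snd.
  exact/computable_succ/computable_fst.
move=> n k; rewrite rS2; split=> [[i ri]|[i]].
  by exists (npair k i); rewrite /slice !(nfstK, nsndK) ri.
by rewrite /slice !(nfstK, nsndK); case: ifP => // ri [<-]; exists (nsnd i).
Qed.

End CeRelations.

(** * Computable sequences of rationals *)

Definition crat (F : nat -> rat) : Prop :=
  exists2 g, computable g & forall n, F n = ratn (g n).

Local Open Scope ring_scope.

(** Inverse to the decoding in [ratn], whose numerator is a difference of naturals and whose
    denominator is shifted by one. Since this numbering is not injective, arithmetic acts on codes
    without reducing fractions. *)
Definition rcode (a b d : nat) : nat := npair (npair a b) d.-1.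
Definition rpos (k : nat) : nat := nfst (nfst k).
Definition rneg (k : nat) : nat := nsnd (nfst k).
Definition rden (k : nat) : nat := (nsnd k).+1.

Lemma ratn_rcode a b d : (0 < d)%N -> ratn (rcode a b d) = (a%:R - b%:R) / d%:R.
Proof. by move=> d0; rewrite /ratn /rcode !(nfstK, nsndK) prednK. Qed.

Lemma ratnE k : ratn k = ((rpos k)%:R - (rneg k)%:R) / (rden k)%:R.
Proof. by []. Qed.

Lemma rden_neq0 k : (rden k)%:R != 0 :> rat.
Proof. by rewrite pnatr_eq0. Qed.

Lemma ratn_surj q : exists k, ratn k = q.
Proof.
exists (rcode (if 0 <= numq q then `|numq q|%N else 0)
              (if 0 <= numq q then 0 else `|numq q|%N) `|denq q|%N).
rewrite ratn_rcode ?absz_gt0 ?denq_neq0//.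
have -> : (`|denq q|%N%:R : rat) = (denq q)%:~R.
  by rewrite -[in RHS](gez0_abs (ltW (denq_gt0 q))).
case: ifP => [h|/negbT]; rewrite ?subr0 ?sub0r.
  rewrite -[RHS]divq_num_den; congr (_ / _).
  by rewrite -[in RHS](gez0_abs h).
rewrite -ltNge => h; rewrite -[RHS]divq_num_den; congr (_ / _).
by rewrite -[in RHS](opprK (numq q)) -(ltz0_abs h) [in RHS]rmorphN.
Qed.

Lemma posratn_gt0 k : 0 < posratn k.
Proof. by rewrite /posratn divr_gt0. Qed.

Lemma posratn_surj q : 0 < q -> exists k, posratn k = q.
Proof.
move=> q0; exists (npair `|numq q|.-1 `|denq q|.-1)%N.
rewrite /posratn nfstK nsndK !prednK ?absz_gt0 ?denq_neq0 ?numq_eq0 ?gt_eqF//.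
rewrite -[RHS]divq_num_den.
rewrite -[in RHS](gez0_abs (ltW (denq_gt0 q))).
by rewrite -[in RHS](@gez0_abs (numq q)) // ltW // numq_gt0.
Qed.

Section CratClosure.
Implicit Types F G : nat -> rat.

Let radd k l := rcode (rpos k * rden l + rpos l * rden k)
  (rneg k * rden l + rneg l * rden k) (rden k * rden l).
Let rmul k l := rcode (rpos k * rpos l + rneg k * rneg l)
  (rpos k * rneg l + rneg k * rpos l) (rden k * rden l).

Let raddE k l : ratn (radd k l) = ratn k + ratn l.
Proof.
rewrite ratn_rcode // !ratnE !natrD !natrM.
by have := rden_neq0 k; have := rden_neq0 l => h1 h2; field; apply/andP.
Qed.

Let rmulE k l : ratn (rmul k l) = ratn k * ratn l.
Proof.
rewrite ratn_rcode // !ratnE !natrD !natrM.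
by have := rden_neq0 k; have := rden_neq0 l => h1 h2; field; apply/andP.
Qed.

Let computable_rpos f : computable f -> computable (fun n => rpos (f n)).
Proof. by move=> hf; exact/computable_fst/computable_fst. Qed.

Let computable_rneg f : computable f -> computable (fun n => rneg (f n)).
Proof. by move=> hf; exact/computable_snd/computable_fst. Qed.

Let computable_rden f : computable f -> computable (fun n => rden (f n)).
Proof. by move=> hf; exact/computable_succ/computable_snd. Qed.

Let computable_rcode f g h : computable f -> computable g -> computable h ->
  computable (fun n => rcode (f n) (g n) (h n)).
Proof.
by move=> hf hg hh; do 2?apply: computable_pair => //; exact: computable_pred.
Qed.

Ltac rc := repeat first [apply: computable_rcode | apply: computable_add
  | apply: computable_mul | apply: computable_rpos | apply: computable_rneg
  | apply: computable_rden | assumption].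

Let computable_radd f g : computable f -> computable g ->
  computable (fun n => radd (f n) (g n)).
Proof. by move=> hf hg; rc. Qed.

Let computable_rmul f g : computable f -> computable g ->
  computable (fun n => rmul (f n) (g n)).
Proof. by move=> hf hg; rc. Qed.

Lemma crat_ratn f : computable f -> crat (fun n => ratn (f n)).
Proof. by move=> hf; exists f. Qed.

Lemma eq_crat F G : F =1 G -> crat F -> crat G.
Proof. by move=> /funext ->. Qed.

Lemma crat_posratn f : computable f -> crat (fun n => posratn (f n)).
Proof.
move=> hf.
exists (fun n => rcode (nfst (f n)).+1 0 (nsnd (f n)).+1).
  apply: computable_rcode; last exact/computable_succ/computable_snd.
    exact/computable_succ/computable_fst.
  exact: computable_const.
by move=> n; rewrite ratn_rcode // subr0.
Qed.

Lemma crat_const q : crat (fun=> q).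
Proof.
by have [k <-] := ratn_surj q; apply: crat_ratn; exact: computable_const.
Qed.

Lemma crat_nat f : computable f -> crat (fun n => (f n)%:R).
Proof.
move=> hf; exists (fun n => rcode (f n) 0 1).
  by apply: computable_rcode => //; exact: computable_const.
by move=> n; rewrite ratn_rcode // subr0 divr1.
Qed.

Lemma crat_comp F f : crat F -> computable f -> crat (fun n => F (f n)).
Proof.
move=> [g hg Fg] hf; exists (fun n => g (f n)) => //; exact: computable_comp.
Qed.

Lemma crat_add F G : crat F -> crat G -> crat (fun n => F n + G n).
Proof.
move=> [f hf Ff] [g hg Gg]; exists (fun n => radd (f n) (g n)).
  exact: computable_radd.
by move=> n; rewrite raddE Ff Gg.
Qed.

Lemma crat_mul F G : crat F -> crat G -> crat (fun n => F n * G n).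
Proof.
move=> [f hf Ff] [g hg Gg]; exists (fun n => rmul (f n) (g n)).
  exact: computable_rmul.
by move=> n; rewrite rmulE Ff Gg.
Qed.

Lemma crat_opp F : crat F -> crat (fun n => - F n).
Proof.
move=> hF; apply: (@eq_crat (fun n => -1 * F n)) => [n|]; first by rewrite mulN1r.
exact: (crat_mul (crat_const _)).
Qed.

Lemma crat_invn f : computable f -> crat (fun n => (f n).+1%:R^-1).
Proof.
move=> hf; exists (fun n => rcode 1 0 (f n).+1).
  apply: computable_rcode; try exact: computable_const.
  exact: computable_succ.
by move=> n; rewrite ratn_rcode // subr0 mul1r.
Qed.

Lemma crat_exp F e : crat F -> computable e -> crat (fun n => F n ^+ e n).
Proof.
move=> [f hf Ff] he.
exists (fun n => iteri (e n) (fun _ v => rmul (f n) v) (rcode 1 0 1)).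
  apply: (computable_iteri (f := fun n _ v => rmul (f n) v)) => //.
    exact: computable_const.
  apply: computable_rmul.
    exact: (computable_comp hf (computable_fst computable_id)).
  exact/computable_snd/computable_snd/computable_id.
move=> n; rewrite Ff; elim: (e n) => [|m IH] /=.
  by rewrite ratn_rcode // subr0 divr1.
by rewrite rmulE exprS IH.
Qed.

Lemma crat_sum b (F : nat -> nat -> rat) : computable b ->
  crat (fun m => F (nfst m) (nsnd m)) ->
  crat (fun n => \sum_(i < b n) F n i).
Proof.
move=> hb [f hf Ff].
exists (fun n => iteri (b n) (fun i v => radd v (f (npair n i))) (rcode 0 0 1)).
  apply: (computable_iteri (f := fun n i v => radd v (f (npair n i)))) => //.
    exact: computable_const.
  apply: computable_radd; first exact/computable_snd/computable_snd/computable_id.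
  apply: (computable_comp hf); apply: computable_pair.
    exact/computable_fst/computable_id.
  exact/computable_fst/computable_snd/computable_id.
move=> n; elim: (b n) => [|m IH] /=.
  by rewrite big_ord0 ratn_rcode // subr0 mul0r.
by rewrite big_ord_recr /= raddE IH -Ff nfstK nsndK.
Qed.

Lemma cdec_ltq F G : crat F -> crat G -> cdec (fun n => F n < G n).
Proof.
move=> [f hf Ff] [g hg Gg].
have := cdec_leq
  (computable_succ (computable_add (computable_mul (computable_rpos hf) (computable_rden hg))
    (computable_mul (computable_rneg hg) (computable_rden hf))))
  (computable_add (computable_mul (computable_rpos hg) (computable_rden hf))
    (computable_mul (computable_rneg hf) (computable_rden hg))).
apply: eq_computable => n; congr nat_of_bool; rewrite Ff Gg !ratnE.
rewrite ltr_pdivrMr ?ltr0n// mulrAC ltr_pdivlMr ?ltr0n//.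
rewrite -(@ltr_nat rat) !natrD !natrM.
by apply/idP/idP => h; lra.
Qed.

Lemma cdec_leq_rat F G : crat F -> crat G -> cdec (fun n => F n <= G n).
Proof.
move=> hF hG; have := cdec_neg (cdec_ltq hG hF).
by apply: eq_computable => n; rewrite -leNgt.
Qed.

End CratClosure.

Local Open Scope classical_set_scope.

(** * Uniformly c.e. open sets *)

Lemma crat_exp2V f : computable f -> crat (fun n => 2 ^- f n).
Proof.
move=> hf; apply: (@eq_crat (fun n => 2^-1 ^+ f n)) => [n|].
  by rewrite exprVn.
exact: (crat_exp (crat_const _)).
Qed.

(** Directed by the head symbol of the goal. A hypothesis applies only when its function or
    predicate matches the goal as it stands; for this reason compound conditions are given a name,
    together with a proof that they are c.e., before this tactic is called. *)
Ltac computability_step := cbv beta; match goal with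
| |- computable (fun n => n) => exact computable_id
| |- computable (fun _ => ?c) => exact (computable_const c)
| |- computable (fun n => S (@?F n)) => refine (@computable_succ F _)
| |- computable (fun n => nfst (@?F n)) => refine (@computable_fst F _)
| |- computable (fun n => nsnd (@?F n)) => refine (@computable_snd F _)
| |- computable (fun n => npair (@?F n) (@?G n)) => refine (@computable_pair F G _ _)
| |- computable (fun n => addn (@?F n) (@?G n)) => refine (@computable_add F G _ _)
| |- computable (fun n => muln (@?F n) (@?G n)) => refine (@computable_mul F G _ _)
| |- computable (fun n => subn (@?F n) (@?G n)) => refine (@computable_sub F G _ _)
| |- computable (fun n => expn (@?F n) (@?G n)) => refine (@computable_expn F G _ _)
| |- computable (fun n => predn (@?F n)) => refine (@computable_pred F _)
| |- computable (fun n => lookup (@?F n) (@?G n)) => refine (@computable_lookup F G _ _)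
| h : computable ?f |- computable ?f => exact h
| h : computable ?f |- computable (fun n => ?f (@?F n)) =>
    refine (@computable_comp f F h _)
| h : computable (fun m => ?f (nfst m) (nsnd m)) |-
    computable (fun n => ?f (@?F n) (@?G n)) => refine (@computable_app2 f F G h _ _)
| |- cdec (fun n => ~~ (@?P n)) => refine (@cdec_neg P _)
| |- cdec (fun n => andb (@?P n) (@?Q n)) => refine (@cdec_and P Q _ _)
| |- cdec (fun n => orb (@?P n) (@?Q n)) => refine (@cdec_or P Q _ _)
| |- cdec (fun n => leq (@?F n) (@?G n)) => refine (@cdec_leq F G _ _)
| |- cdec (fun n => @Order.lt _ _ (@?F n) (@?G n)) => refine (@cdec_ltq F G _ _)
| |- cdec (fun n => @Order.le _ _ (@?F n) (@?G n)) => refine (@cdec_leq_rat F G _ _)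
| |- cdec (fun n => @eq_op _ (@?F n) (@?G n)) => refine (@cdec_eq F G _ _)
| h : cdec ?P |- cdec ?P => exact h
| h : cdec ?P |- cdec (fun n => ?P (@?F n)) => refine (@cdec_comp P F h _)
| |- crat (fun _ => ?c) => exact (crat_const c)
| |- crat (fun n => ratn (@?F n)) => refine (@crat_ratn F _)
| |- crat (fun n => posratn (@?F n)) => refine (@crat_posratn F _)
| |- crat (fun n => @GRing.natmul _ 1 (@?F n)) => refine (@crat_nat F _)
| |- crat (fun n => GRing.opp (@?F n)) => refine (@crat_opp F _)
| |- crat (fun n => GRing.add (@?F n) (@?G n)) => refine (@crat_add F G _ _)
| |- crat (fun n => GRing.mul (@?F n) (@?G n)) => refine (@crat_mul F G _ _)
| |- crat (fun n => 2 ^- (@?F n)) => refine (@crat_exp2V F _)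
| |- crat (fun n => (@?F n) ^+ (@?G n)) => refine (@crat_exp F G _ _)
| |- crat (fun n => (S (@?F n))%:R^-1) => refine (@crat_invn F _)
| h : crat ?f |- crat ?f => exact h
| h : crat ?f |- crat (fun n => ?f (@?F n)) => refine (@crat_comp f F h _)
| |- ce (fun n => and (@?P n) (@?Q n)) => refine (@ce_and P Q _ _)
| |- ce (fun n => or (@?P n) (@?Q n)) => refine (@ce_or P Q _ _)
| |- ce (fun n => exists m, @?P n m) => refine (@ce_ex P _)
| |- ce (fun n => forall m, is_true (m < @?B n)%N -> @?P n m) =>
    refine (@ce_forall_lt B P _ _)
| |- ce (fun n => is_true (@?P n)) => refine (@ce_dec P _)
| |- ce (fun n => @eq nat (@?F n) (@?G n)) =>
    refine (@eq_ce (fun n => F n == G n) _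
      (fun n => iff_sym (rwP (@eqP _ (F n) (G n)))) (@ce_dec (fun n => F n == G n) _))
| h : ce ?S |- ce ?S => exact h
| h : ce ?S |- ce (fun n => ?S (@?F n)) => refine (@ce_comp S F h _)
| h : ce (fun m => ?S (nfst m) (nsnd m)) |- ce (fun n => ?S (@?F n) (@?G n)) =>
    refine (@ce_app2 S F G h _ _)
| |- ce (fun _ => ?P) => idtac
end.

Ltac computability := repeat computability_step.

Lemma open_metric_ball (R : realType) (X : completeMetricType R) (x : X) (r : R) :
  open (ball x r).
Proof.
rewrite openE => y; rewrite ballEmdist /= => xy.
apply/nbhs_ballP; exists (r - mdist x y) => /=; first by rewrite subr_gt0.
move=> z; rewrite !ballEmdist /= => yz.
by have := metric_triangle x y z; lra.
Qed.

Lemma listedP T (B : nat -> set T) g x :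
  listed B g x <-> exists i k, g i = k.+1 /\ B k x.
Proof.
split=> [[i _]|[i [k [gi Bk]]]]; last by exists i => //; rewrite gi.
by case E: (g i) => [//|k] Bk; exists i, k.
Qed.

(** * Rational cuts of computable reals *)

Section RealNames.
Variable R : realType.

Lemma ratn_between (x y : R) : x < y -> exists k, x < ratr (ratn k) < y.
Proof.
move=> /rat_in_itvoo[q]; rewrite in_itv /= => h.
by have [k kq] := ratn_surj q; exists k; rewrite kq.
Qed.

Lemma ratr_exp2V k : ratr (2 ^- k) = 2 ^- k :> R.
Proof. by rewrite fmorphV rmorphXn rmorph_nat. Qed.

(** Approximation [i] is off by at most [2^-i], so an approximation plus its error below [Q n]
    certifies the inequality. Conversely a certificate appears once twice the error is smaller than
    the gap. *)
Lemma ce_seq_ltr (y : nat -> R) F (Q : nat -> rat) :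
  computable_seq (@real_name R) y -> computable F -> crat Q ->
  ce (fun n => y (F n) < ratr (Q n)).
Proof.
move=> [g hg gy] hF hQ.
apply: (@eq_ce (fun n => exists i, ratn (g (npair (F n) i)) + 2 ^- i < Q n)); last by computability.
move=> n; split=> [[i]|h].
  rewrite -(ltr_rat R) rmorphD /= ratr_exp2V => lti.
  have := gy (F n) i; rewrite /slice ler_distl => /andP[h2 _].
  by lra.
have [i hi] : exists i, 2 ^- i * 2 < ratr (Q n) - y (F n).
  have e0 : 0 < (ratr (Q n) - y (F n)) / 2 by lra.
  have [i _ hi] := near_infty_natSinv_expn_lt (PosNum e0).
  exists i; have := hi i (leqnn i); rewrite /= div1r; lra.
exists i; rewrite -(ltr_rat R) rmorphD /= ratr_exp2V.
have := gy (F n) i; rewrite /slice ler_distl => /andP[_ h1].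
by lra.
Qed.

Lemma ce_seq_gtr (y : nat -> R) F (Q : nat -> rat) :
  computable_seq (@real_name R) y -> computable F -> crat Q ->
  ce (fun n => ratr (Q n) < y (F n)).
Proof.
move=> [g hg gy] hF hQ.
have hy : computable_seq (@real_name R) (fun n => - y n).
  have : crat (fun n => - ratn (g n)) by computability.
  move=> [f hf fg]; exists f => // n i; rewrite /slice -fg rmorphN /= opprK.
  by rewrite addrC distrC; exact: gy.
apply: (@eq_ce (fun n => - y (F n) < ratr (- Q n))) => [n|].
  by rewrite rmorphN ltrN2.
by apply: (@ce_seq_ltr (fun n => - y n)) => //; computability.
Qed.

Lemma ce_real_ltr (y : R) (Q : nat -> rat) : computable_real y -> crat Q ->
  ce (fun n => y < ratr (Q n)).
Proof.
move=> [g hg gy]; apply: (@ce_seq_ltr (fun=> y) (fun=> 0%N)); last by computability.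
exists (fun n => g (nsnd n)); first by computability.
by move=> k i; rewrite /slice nsndK.
Qed.

Lemma ce_real_gtr (y : R) (Q : nat -> rat) : computable_real y -> crat Q ->
  ce (fun n => ratr (Q n) < y).
Proof.
move=> [g hg gy]; apply: (@ce_seq_gtr (fun=> y) (fun=> 0%N)); last by computability.
exists (fun n => g (nsnd n)); first by computability.
by move=> k i; rewrite /slice nsndK.
Qed.

(** One searches for rationals on both sides of [y] at distance less than [2^-i] and returns the
    left one. *)
Lemma computable_real_cut (y : R) :
  ce (fun n => ratr (ratn n) < y) -> ce (fun n => y < ratr (ratn n)) ->
  computable_real y.
Proof.
move=> h1 h2.
pose S i m := (ratr (ratn (nfst m)) < y) /\ (y < ratr (ratn (nsnd m)))
  /\ ratn (nsnd m) < ratn (nfst m) + 2 ^- i.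
have hS : ce (fun m => S (nfst m) (nsnd m)).
  rewrite /S; apply: ce_and; last apply: ce_and; last by computability.
    by apply: (ce_comp h1); computability.
  by apply: (ce_comp h2); computability.
have tot i : exists m, S i m.
  have e0 : 0 < 2 ^- i.+1 :> R by rewrite invr_gt0 exprn_gt0.
  have [|k1 /andP[a1 a2]] := @ratn_between (y - 2 ^- i.+1) y; first by lra.
  have [|k2 /andP[a3 a4]] := @ratn_between y (y + 2 ^- i.+1); first by lra.
  exists (npair k1 k2); rewrite /S nfstK nsndK; do 2?split=> //.
  rewrite -(ltr_rat R) rmorphD /= ratr_exp2V.
  by move: a1 a4; rewrite exprS invfM; lra.
have [g hg gS] := ce_select hS tot.
exists (fun i => nfst (g i)); first by computability.
move=> i; have [a [b]] := gS i.
rewrite -(ltr_rat R) rmorphD /= ratr_exp2V => c.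
rewrite ltW // ltr_distl; apply/andP; split; lra.
Qed.

End RealNames.

Section UniformProcedures.
Variables (R : realType) (X : completeMetricType R) (s : nat -> X).

Fixpoint const_prog (n : nat) : prog :=
  if n is m.+1 then PComp PSucc (const_prog m) else PZero.

Lemma run_const_prog o n a : run o (const_prog n) a n.
Proof. by elim: n => //= n IH; exists n. Qed.

(* The code of a program for [slice g n] depends computably on [n]. *)
Lemma uniform_in_ce_open_seq T (name : (nat -> nat) -> T -> Prop) Phi g :
  uniform_in_ce_open s name Phi -> computable g ->
  computable_seq name (fun n => Phi (listed (basic_ball s) (slice g n))).
Proof.
move=> [h hP] [p hp].
(* An instance of the s-m-n theorem: [n] is hardwired as a constant program, and [PPair PFst PSnd]
   is the identity. *)
pose pn n := PComp p (PPair (const_prog n) (PPair PFst PSnd)).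
have hpn n : computes (pn n) (slice g n).
  move=> a; exists (npair n a); last exact: hp.
  exists n, a; split => //; first exact: run_const_prog.
  by exists (nfst a), (nsnd a); rewrite npairK.
have codec : computable (fun n => prog_code (pn n)).
  rewrite /pn /=.
  suff hc : computable (fun n => prog_code (const_prog n)) by computability.
  (* The numbers follow [prog_code]: 6 for [PComp], the pair of 1 and 0 for [PSucc], the pair of 0
     and 0 for [PZero]. *)
  apply: (@eq_computable (fun n => iteri n
    (fun _ v => npair 6 (npair (npair 1 0) v)) (npair 0 0))).
    by elim=> //= n ->.
  by apply: (@computable_iteri _ _ (fun _ _ v => npair 6 (npair (npair 1 0) v))); computability.
have [r rP] := choice (fun n => hP _ _ (hpn n)).
exists (fun m => r (nfst m) (nsnd m)).
  have [q hq] := codec.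
  exists (PComp h (PPair (PComp q PFst) PSnd)) => a.
  exists (npair (prog_code (pn (nfst a))) (nsnd a)); last exact: (rP (nfst a)).1.
  exists (prog_code (pn (nfst a))), (nsnd a); split => //.
  by exists (nfst a) => //; exact: hq.
move=> n; have -> : slice (fun m => r (nfst m) (nsnd m)) n = r n.
  by apply/funext => i; rewrite /slice nfstK nsndK.
exact: (rP n).2.
Qed.

End UniformProcedures.

Section EffectivelyOpen.
Variables (R : realType) (X : completeMetricType R) (s : nat -> X).
Implicit Types (K : set X) (U V : nat -> X -> Prop).

Definition ball_rad (k : nat) : R := ratr (posratn (nsnd k)).

Lemma basic_ballE k x : basic_ball s k x = (mdist (s (nfst k)) x < ball_rad k).
Proof. by rewrite /basic_ball ballEmdist. Qed.

(* Uniformly c.e. open relative to [K].  Requiring every small enough ball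
   around a point to be listed makes finite intersections trivial. *)
Definition eopen K U : Prop :=
  exists2 S : nat -> nat -> Prop, ce (fun m => S (nfst m) (nsnd m)) &
  forall n, (forall k x, S n k -> basic_ball s k x -> K x -> U n x) /\
    (forall x, K x -> U n x -> exists2 d, 0 < d &
       forall k, basic_ball s k x -> ball_rad k < d -> S n k).

Lemma eq_eopen K U V : (forall n x, K x -> (U n x <-> V n x)) ->
  eopen K U -> eopen K V.
Proof.
move=> h [S hS SU]; exists S => // n; have [h1 h2] := SU n.
by split=> [k x Sk Bk Kx|x Kx /(h _ _ Kx)]; [apply/h => //; exact: h1 Sk Bk Kx|exact: h2].
Qed.

Lemma eopen_comp K U f : eopen K U -> computable f -> eopen K (fun n => U (f n)).
Proof. by move=> [S hS SU] hf; exists (fun n => S (f n)) => //; computability. Qed.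

Lemma eopen_app2 K (U : nat -> nat -> X -> Prop) f g :
  eopen K (fun m => U (nfst m) (nsnd m)) -> computable f -> computable g ->
  eopen K (fun n => U (f n) (g n)).
Proof.
move=> hU hf hg; have := eopen_comp hU (computable_pair hf hg).
by apply: eq_eopen => n x _; rewrite nfstK nsndK.
Qed.

Lemma eopen_and K U V : eopen K U -> eopen K V ->
  eopen K (fun n x => U n x /\ V n x).
Proof.
move=> [S hS SU] [S' hS' SV]; exists (fun n k => S n k /\ S' n k); first by computability.
move=> n; have [h1 h2] := SU n; have [h1' h2'] := SV n; split.
  by move=> k x [Snk S'nk] Bk Kx; split; [exact: h1 Bk _|exact: h1' Bk _].
move=> x Kx [/(h2 _ Kx)[d d0 hd] /(h2' _ Kx)[d' d'0 hd']].
exists (Num.min d d'); first by rewrite lt_min d0.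
by move=> k Bk; rewrite lt_min => /andP[? ?]; split; [exact: hd|exact: hd'].
Qed.

Lemma eopen_or K U V : eopen K U -> eopen K V ->
  eopen K (fun n x => U n x \/ V n x).
Proof.
move=> [S hS SU] [S' hS' SV]; exists (fun n k => S n k \/ S' n k); first by computability.
move=> n; have [h1 h2] := SU n; have [h1' h2'] := SV n; split.
  by move=> k x [Snk|S'nk] Bk Kx; [left; exact: h1 Bk _|right; exact: h1' Bk _].
move=> x Kx [/(h2 _ Kx)[d d0 hd]|/(h2' _ Kx)[d d0 hd]]; exists d => // k Bk kd.
  by left; exact: hd.
by right; exact: hd.
Qed.

Lemma eopen_ex K (U : nat -> nat -> X -> Prop) :
  eopen K (fun m => U (nfst m) (nsnd m)) -> eopen K (fun n x => exists m, U n m x).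
Proof.
move=> [S hS SU]; exists (fun n k => exists m, S (npair n m) k); first by computability.
move=> n; split.
  move=> k x [m Sm] Bk Kx; exists m.
  by have := (SU (npair n m)).1 _ _ Sm Bk Kx; rewrite nfstK nsndK.
move=> x Kx [m Um]; have := (SU (npair n m)).2 x Kx.
rewrite nfstK nsndK => /(_ Um)[d d0 hd]; exists d => // k Bk kd.
by exists m; exact: hd.
Qed.

Lemma eopen_forall_lt K (U : nat -> nat -> X -> Prop) b : computable b ->
  eopen K (fun m => U (nfst m) (nsnd m)) ->
  eopen K (fun n x => forall m, (m < b n)%N -> U n m x).
Proof.
move=> hb [S hS SU].
exists (fun n k => forall m, (m < b n)%N -> S (npair n m) k).
  by apply: (@ce_forall_lt _ (fun p m => S (npair (nfst p) m) (nsnd p))); computability.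
move=> n; split.
  move=> k x Sm Bk Kx m mb.
  by have := (SU (npair n m)).1 _ _ (Sm m mb) Bk Kx; rewrite nfstK nsndK.
move=> x Kx; elim: (b n) => [|c IH] Um; first by exists 1.
have [m mc|d d0 hd] := IH; first by apply: Um; exact: ltnW.
have := (SU (npair n c)).2 x Kx; rewrite nfstK nsndK.
move=> /(_ (Um c (ltnSn c)))[d' d'0 hd'].
exists (Num.min d d'); first by rewrite lt_min d0.
move=> k Bk; rewrite lt_min => /andP[kd kd'] m.
rewrite ltnS leq_eqVlt => /orP[/eqP ->|mc]; first exact: hd'.
exact: hd.
Qed.

Lemma eopen_ce K (P : nat -> Prop) : ce P -> eopen K (fun n _ => P n).
Proof.
move=> hP; exists (fun n _ => P n); first by computability.
by move=> n; split=> // x _ Pn; exists 1.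
Qed.

Hypothesis polish : computable_polish s.

Let dense_s : dense (range s) := polish.1.
Let comp_dist : computable_seq (@real_name R)
  (fun k => mdist (s (nfst k)) (s (nsnd k))) := polish.2.

Lemma ce_dist_lt F G (Q : nat -> rat) : computable F -> computable G -> crat Q ->
  ce (fun n => mdist (s (F n)) (s (G n)) < ratr (Q n)).
Proof.
move=> hF hG hQ.
have := ce_seq_ltr comp_dist (computable_pair hF hG) hQ.
by apply: eq_ce => n; rewrite nfstK nsndK.
Qed.

Lemma ce_dist_gt F G (Q : nat -> rat) : computable F -> computable G -> crat Q ->
  ce (fun n => ratr (Q n) < mdist (s (F n)) (s (G n))).
Proof.
move=> hF hG hQ.
have := ce_seq_gtr comp_dist (computable_pair hF hG) hQ.
by apply: eq_ce => n; rewrite nfstK nsndK.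
Qed.

(** Ball [k] is listed when distance of centres plus radius is below [Q n], a c.e. condition that
    forces inclusion. Half of the gap suffices as threshold because the radius is spent twice: on
    the distance from [x] to the centre, and in the condition itself. *)
Lemma eopen_dist_lt K F (Q : nat -> rat) : computable F -> crat Q ->
  eopen K (fun n x => mdist (s (F n)) x < ratr (Q n)).
Proof.
move=> hF hQ.
exists (fun n k => mdist (s (nfst k)) (s (F n)) < ratr (Q n - posratn (nsnd k))).
  by apply: ce_dist_lt; computability.
move=> n; split=> [k x|x Kx].
  rewrite basic_ballE rmorphB /= => h1 h2 _.
  have := metric_triangle (s (F n)) (s (nfst k)) x.
  by rewrite /ball_rad in h2; rewrite (metric_sym (s (F n)) (s (nfst k))); lra.
move=> h; exists ((ratr (Q n) - mdist (s (F n)) x) / 2); first by lra.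
move=> k; rewrite basic_ballE rmorphB /= -/(ball_rad k) => h1 h2.
have := metric_triangle (s (nfst k)) x (s (F n)).
by rewrite (metric_sym x (s (F n))); lra.
Qed.

Lemma eopen_dist_gt K F (Q : nat -> rat) : computable F -> crat Q ->
  eopen K (fun n x => ratr (Q n) < mdist (s (F n)) x).
Proof.
move=> hF hQ.
exists (fun n k => ratr (Q n + posratn (nsnd k)) < mdist (s (nfst k)) (s (F n))).
  by apply: ce_dist_gt; computability.
move=> n; split=> [k x|x Kx].
  rewrite basic_ballE rmorphD /= => h1 h2 _.
  have := metric_triangle (s (nfst k)) x (s (F n)).
  by rewrite /ball_rad in h2; rewrite (metric_sym x (s (F n))); lra.
move=> h; exists ((mdist (s (F n)) x - ratr (Q n)) / 2); first by lra.
move=> k; rewrite basic_ballE rmorphD /= -/(ball_rad k) => h1 h2.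
have := metric_triangle (s (F n)) (s (nfst k)) x.
by rewrite (metric_sym (s (F n)) (s (nfst k))); lra.
Qed.

Lemma eopen_listed K g : computable g ->
  eopen K (fun n => listed (basic_ball s) (slice g n)).
Proof.
move=> hg; apply: (@eq_eopen _ (fun n x => exists i k,
    g (npair n i) = k.+1 /\ mdist (s (nfst k)) x < ratr (posratn (nsnd k)))).
  move=> n x _; rewrite listedP; split=> -[i [k [e h]]]; exists i, k.
    by rewrite basic_ballE.
  by rewrite -basic_ballE.
apply: eopen_ex; apply: eopen_ex; apply: eopen_and.
  by apply: eopen_ce; computability.
by apply: eopen_dist_lt; computability.
Qed.

Lemma small_ball x (d : R) : 0 < d -> exists2 k, basic_ball s k x & ball_rad k < d.
Proof.
move=> d0.
have [c /andP[q0 qd]] := ratn_between d0; set q := ratn c in q0 qd.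
have q0' : 0 < q by rewrite -(ltr_rat R) rmorph0.
have [b hb] := posratn_surj q0'.
have [||y [/= By [a _ ay]]] := dense_s (O := ball x (ratr q : R)).
- by exists x; exact: ballxx.
- exact: open_metric_ball.
exists (npair a b); last by rewrite /ball_rad nsndK hb.
rewrite basic_ballE /ball_rad nfstK nsndK hb ay metric_sym.
by move: By; rewrite ballEmdist.
Qed.

(** Passes from the form where all small balls are listed to a plain enumeration; density supplies a
    small enough basic ball around each point. *)
Lemma eopen_names K U : eopen K U -> exists2 g, computable g &
  forall n x, K x -> (U n x <-> listed (basic_ball s) (slice g n) x).
Proof.
move=> [S hS SU]; have [g hg gS] := ce_enum hS.
exists g => // n x Kx; rewrite listedP; split=> [/((SU n).2 _ Kx)[d d0 hd]|].
  have [k Bk kd] := small_ball x d0.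
  have /gS[i gi] := hd k Bk kd.
  by exists i, k.
move=> [i [k [gi Bk]]]; apply: (SU n).1 Bk Kx; apply/gS; by exists i.
Qed.

Lemma eopen_ce_open U : eopen setT U -> forall n, ce_open s (U n).
Proof.
move=> hU n; have [g hg gU] := eopen_names hU.
exists (slice g n); first by rewrite /slice; computability.
by apply/seteqP; split=> x /gU; exact.
Qed.

Lemma computable_seq_eopen U K : computable_seq (open_name s) U -> eopen K U.
Proof.
move=> [g hg gU]; have -> : U = (fun n => listed (basic_ball s) (slice g n)).
  by apply/funext => n; exact: gU.
exact: eopen_listed.
Qed.

(** The bridge from the hypotheses, which speak of procedures acting on programs, to sequences of
    open sets; later arguments mention programs no more, except to show that [KR] is measurable. *)
Lemma uniform_eopen T (name : (nat -> nat) -> T -> Prop) Phi U :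
  uniform_in_ce_open s name Phi -> eopen setT U ->
  computable_seq name (fun n => Phi (U n)).
Proof.
move=> hPhi /eopen_names[g hg gU].
have := uniform_in_ce_open_seq hPhi hg.
congr (computable_seq name _); apply/funext => n; congr Phi.
by apply/seteqP; split=> x /gU; exact.
Qed.

Lemma open_basic_ball k : open (basic_ball s k).
Proof. exact: open_metric_ball. Qed.

Lemma open_listed g : open (listed (basic_ball s) g).
Proof.
apply: bigcup_open => i _; case: (g i) => [|k]; first exact: open0.
exact: open_basic_ball.
Qed.

(** Measures and kernels are effective on sets that are c.e. open in the whole space. This replaces
    a family that is open only relative to [K] by such sets, without change on [K]. *)
Lemma eopen_ext K U : eopen K U -> exists2 V, eopen setT V &
  (forall n, open (V n)) /\ forall n x, K x -> (U n x <-> V n x).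
Proof.
move=> /eopen_names[g hg gU]; exists (fun n => listed (basic_ball s) (slice g n)).
  exact: eopen_listed.
by split=> // n; exact: open_listed.
Qed.

End EffectivelyOpen.

(** * Effective lower semicontinuity *)

Section RationalCuts.
Variable R : realType.

Lemma ratn_lte (x y : \bar R) : (x < y)%E ->
  exists k, (x < (ratr (ratn k))%:E)%E /\ ((ratr (ratn k))%:E < y)%E.
Proof.
case: x y => [x| |] [y| |] //=.
- rewrite lte_fin => /ratn_between[k /andP[h1 h2]].
  by exists k; rewrite !lte_fin.
- move=> _; have [|k /andP[h1 h2]] := @ratn_between R x (x + 1); first by lra.
  by exists k; rewrite lte_fin ltry.
- move=> _; have [|k /andP[h1 h2]] := @ratn_between R (y - 1) y; first by lra.
  by exists k; rewrite lte_fin ltNyr.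
- by move=> _; exists 0; rewrite ltNyr ltry.
Qed.

(** Only the bound for [b] is made rational. The bound [q1] for [a] may stay real, since the
    induction on longer sums splits it further. *)
Lemma ratn_lt_add (a b : \bar R) (q : R) : (-oo < a)%E -> (-oo < b)%E ->
  (q%:E < a + b)%E ->
  exists q1 k, [/\ (q1%:E < a)%E, ((ratr (ratn k))%:E < b)%E & q < q1 + ratr (ratn k)].
Proof.
case: a => [a| |] // _; case: b => [b| |] // _.
- rewrite -EFinD lte_fin => h.
  have [|k /andP[h1 h2]] := @ratn_between R (q - a) b; first by lra.
  exists ((a + q - ratr (ratn k)) / 2), k; rewrite !lte_fin; split => //; lra.
- move=> _; have [|k /andP[h1 h2]] := @ratn_between R (q - a + 1) (q - a + 2); first by lra.
  by exists (a - 1), k; rewrite lte_fin ltry; split=> //; lra.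
- move=> _; have [|k /andP[h1 h2]] := @ratn_between R (b - 1) b; first by lra.
  by exists (q - ratr (ratn k) + 1), k; rewrite lte_fin ltry; split=> //; lra.
- move=> _; have [k /andP[h1 h2]] := ratn_between (@ltr01 R).
  by exists q, k; rewrite !ltry; split=> //; lra.
Qed.

(** A strict lower bound of a finite sum is witnessed by a table of rational strict lower bounds of
    its terms. Excluding [-oo] keeps the extended sum well behaved. *)
Lemma ratn_lt_sum b (a : nat -> \bar R) (q : R) :
  (forall j, (j < b)%N -> (-oo < a j)%E) ->
  (q%:E < \sum_(j < b) a j)%E <->
  exists w, q < ratr (\sum_(j < b) ratn (lookup w j)) /\
    forall j, (j < b)%N -> ((ratr (ratn (lookup w j)))%:E < a j)%E.
Proof.
move=> aNy; split=> [|[w [qw wa]]]; last first.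
  have : (q%:E < (ratr (\sum_(j < b) ratn (lookup w j)))%:E)%E by rewrite lte_fin.
  move=> /lt_le_trans; apply; rewrite rmorph_sum -sumEFin.
  by apply: lee_sum => j _; exact/ltW/wa.
suff: (q%:E < \sum_(j < b) a j)%E -> exists f : nat -> nat,
    q < ratr (\sum_(j < b) ratn (f j)) /\
    forall j, (j < b)%N -> ((ratr (ratn (f j)))%:E < a j)%E.
  move=> /[apply] -[f [qf fa]]; have [w wf] := lookup_exists b f.
  exists w; split=> [|j jb]; last by rewrite wf //; exact: fa.
  by rewrite (eq_bigr (fun j : 'I_b => ratn (f j))) // => j _; rewrite wf.
elim: b q aNy => [|b IH] q aNy.
  by rewrite !big_ord0 lte_fin => q0; exists id; rewrite big_ord0 rmorph0.
rewrite big_ord_recr /= => /ratn_lt_add[||q1 [k [h1 h2 h3]]].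
- elim/big_ind : _ => // [x y hx hy|j _]; last by apply: aNy; exact: leqW.
  by rewrite ltNye adde_eq_ninfty negb_or -!ltNye hx.
- exact: aNy.
have [|f [f1 f2]] := IH q1 _ h1; first by move=> j jb; apply: aNy; exact: leqW.
exists (fun j => if (j == b)%N then k else f j); split=> [|j].
  rewrite big_ord_recr /= eqxx rmorphD /=.
  rewrite (eq_bigr (fun j : 'I_b => ratn (f j))) => [|j _]; first by lra.
  by rewrite ltn_eqF.
by rewrite ltnS leq_eqVlt; case: eqP => [-> //|_ /= /f2].
Qed.

(** The maximum starts from 0, so it is nonnegative and makes sense for the empty range. *)
Fixpoint bmax (a : nat -> R) (t : nat) : R :=
  if t is i.+1 then Num.max (bmax a i) (a i) else 0.

Lemma bmaxS a t : bmax a t.+1 = Num.max (bmax a t) (a t).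
Proof. by []. Qed.

Lemma lt_bmax a t q : q < bmax a t <-> q < 0 \/ exists i, (i < t)%N /\ q < a i.
Proof.
elim: t => [|t IH].
  by split=> [|[|[i []]]] //; left.
rewrite bmaxS lt_max; split=> [/orP[/IH[|[i [it qi]]]|]|].
- by left.
- by right; exists i; split=> //; exact: leqW.
- by right; exists t.
move=> h; apply/orP; case: h => [q0|[i [it qi]]]; first by left; apply/IH; left.
move: it; rewrite ltnS leq_eqVlt => /orP[/eqP it|it]; first by right; rewrite -it.
by left; apply/IH; right; exists i.
Qed.

Lemma bmax_lt a t q : bmax a t < q <-> 0 < q /\ forall i, (i < t)%N -> a i < q.
Proof.
elim: t => [|t IH]; first by split=> [|[]].
rewrite bmaxS gt_max; split=> [/andP[/IH[q0 h] aq]|[q0 h]].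
  split=> // i; rewrite ltnS leq_eqVlt => /orP[/eqP ->//|]; exact: h.
by apply/andP; split; [apply/IH; split=> // i it; apply: h; exact: leqW|exact: h].
Qed.

Lemma bmax_ge0 a t : 0 <= bmax a t.
Proof.
elim: t => [|t IH]; first by [].
by rewrite bmaxS le_max IH.
Qed.

Lemma le_bmax a t i : (i < t)%N -> a i <= bmax a t.
Proof.
elim: t => // t IH; rewrite bmaxS ltnS le_max leq_eqVlt => /orP[/eqP ->|/IH ->//].
by rewrite lexx orbT.
Qed.

Lemma bmax_le a t q : 0 <= q -> (forall i, (i < t)%N -> a i <= q) -> bmax a t <= q.
Proof.
move=> q0; elim: t => [|t IH] h; first by [].
rewrite bmaxS ge_max h // andbT; apply: IH => i it; apply: h; exact: leqW.
Qed.

Lemma bmax_mono a t t' : (t <= t')%N -> bmax a t <= bmax a t'.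
Proof.
move=> tt'; apply: bmax_le => [|i it]; first exact: bmax_ge0.
by apply: le_bmax; exact: leq_trans tt'.
Qed.

End RationalCuts.

Section EffectiveSemicontinuity.
Variables (R : realType) (X : completeMetricType R) (s : nat -> X).
Implicit Types (K : set X) (G : nat -> X -> \bar R) (a : nat -> X -> R).
Local Notation eopen := (eopen s).

Definition elsc K G : Prop :=
  eopen K (fun m x => ((ratr (ratn (nsnd m)))%:E < G (nfst m) x)%E).

Definition relsc K a : Prop :=
  eopen K (fun m x => ratr (ratn (nsnd m)) < a (nfst m) x).

(** Lower and upper semi-computable at once, that is, uniformly computable on [K]. *)
Definition ecomp K a : Prop := relsc K a /\ relsc K (fun n x => - a n x).

Lemma elsc_lt K G f (Q : nat -> rat) : elsc K G -> computable f -> crat Q ->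
  eopen K (fun n x => ((ratr (Q n))%:E < G (f n) x)%E).
Proof.
move=> hG hf [g hg Qg]; have := eopen_comp hG (computable_pair hf hg).
by apply: eq_eopen => n x _; rewrite nfstK nsndK Qg.
Qed.

Lemma elsc_lt2 K (G : nat -> nat -> X -> \bar R) f h (Q : nat -> rat) :
  elsc K (fun m => G (nfst m) (nsnd m)) -> computable f -> computable h -> crat Q ->
  eopen K (fun n x => ((ratr (Q n))%:E < G (f n) (h n) x)%E).
Proof.
move=> hG hf hh hQ; have := elsc_lt hG (computable_pair hf hh) hQ.
by apply: eq_eopen => n x _; rewrite nfstK nsndK.
Qed.

Lemma relsc_lt K a f (Q : nat -> rat) : relsc K a -> computable f -> crat Q ->
  eopen K (fun n x => ratr (Q n) < a (f n) x).
Proof.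
move=> hG hf [g hg Qg]; have := eopen_comp hG (computable_pair hf hg).
by apply: eq_eopen => n x _; rewrite nfstK nsndK Qg.
Qed.

Lemma relsc_lt2 K (a : nat -> nat -> X -> R) f h (Q : nat -> rat) :
  relsc K (fun m => a (nfst m) (nsnd m)) -> computable f -> computable h -> crat Q ->
  eopen K (fun n x => ratr (Q n) < a (f n) (h n) x).
Proof.
move=> hG hf hh hQ; have := relsc_lt hG (computable_pair hf hh) hQ.
by apply: eq_eopen => n x _; rewrite nfstK nsndK.
Qed.

Lemma elscEFin K a : elsc K (fun n x => (a n x)%:E) <-> relsc K a.
Proof. by split; apply: eq_eopen => n x _; rewrite lte_fin. Qed.

Lemma eq_elsc K G G' : (forall n x, K x -> G n x = G' n x) -> elsc K G -> elsc K G'.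
Proof. by move=> h; apply: eq_eopen => n x Kx; rewrite h. Qed.

Lemma eq_relsc K a a' : (forall n x, K x -> a n x = a' n x) -> relsc K a -> relsc K a'.
Proof. by move=> h; apply: eq_eopen => n x Kx; rewrite h. Qed.

Lemma eq_ecomp K a a' : (forall n x, K x -> a n x = a' n x) -> ecomp K a -> ecomp K a'.
Proof.
by move=> h [h1 h2]; split; [exact: eq_relsc h1|apply: eq_relsc h2 => n x Kx; rewrite h].
Qed.

Lemma elsc_comp K G f : elsc K G -> computable f -> elsc K (fun n => G (f n)).
Proof.
by move=> hG hf; apply: (elsc_lt (f := fun m => f (nfst m)) hG); computability.
Qed.

Lemma relsc_comp K a f : relsc K a -> computable f -> relsc K (fun n => a (f n)).
Proof.
by move=> hG hf; apply: (relsc_lt (f := fun m => f (nfst m)) hG); computability.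
Qed.

Lemma ecomp_comp K a f : ecomp K a -> computable f -> ecomp K (fun n => a (f n)).
Proof.
by move=> [h1 h2] hf; split; [exact: relsc_comp|exact: (relsc_comp h2)].
Qed.

Lemma ecomp_app2 K (a : nat -> nat -> X -> R) f h :
  ecomp K (fun m => a (nfst m) (nsnd m)) -> computable f -> computable h ->
  ecomp K (fun n => a (f n) (h n)).
Proof.
move=> ha hf hh; have := ecomp_comp ha (computable_pair hf hh).
by apply: eq_ecomp => n x _; rewrite nfstK nsndK.
Qed.

End EffectiveSemicontinuity.

Ltac effective_open_step := cbv beta; match goal with
| |- eopen ?s ?K (fun n x => and (@?U n x) (@?V n x)) =>
    refine (@eopen_and _ _ s K U V _ _)
| |- eopen ?s ?K (fun n x => or (@?U n x) (@?V n x)) =>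
    refine (@eopen_or _ _ s K U V _ _)
| |- eopen ?s ?K (fun n x => exists m, @?U n m x) =>
    refine (@eopen_ex _ _ s K U _)
| |- eopen ?s ?K (fun n x => forall m, is_true (m < @?b n)%N -> @?U n m x) =>
    refine (@eopen_forall_lt _ _ s K U b _ _)
| h : elsc ?s ?K ?G |-
    eopen ?s ?K (fun n x => is_true ((ratr (@?Q n))%:E < ?G (@?f n) x)%E) =>
    refine (@elsc_lt _ _ s K G f Q h _ _)
| h : elsc ?s ?K (fun m => ?G (nfst m) (nsnd m)) |-
    eopen ?s ?K (fun n x => is_true ((ratr (@?Q n))%:E < ?G (@?f n) (@?g n) x)%E) =>
    refine (@elsc_lt2 _ _ s K G f g Q h _ _ _)
| h : relsc ?s ?K ?G |-
    eopen ?s ?K (fun n x => is_true (ratr (@?Q n) < ?G (@?f n) x)) =>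
    refine (@relsc_lt _ _ s K G f Q h _ _)
| h : relsc ?s ?K (fun m => ?G (nfst m) (nsnd m)) |-
    eopen ?s ?K (fun n x => is_true (ratr (@?Q n) < ?G (@?f n) (@?g n) x)) =>
    refine (@relsc_lt2 _ _ s K G f g Q h _ _ _)
| h : relsc ?s ?K (fun n x => - ?G n x) |-
    eopen ?s ?K (fun n x => is_true (ratr (@?Q n) < - ?G (@?f n) x)) =>
    refine (@relsc_lt _ _ s K (fun n x => - G n x) f Q h _ _)
| h : relsc ?s ?K (fun m x => - ?G (nfst m) (nsnd m) x) |-
    eopen ?s ?K (fun n x => is_true (ratr (@?Q n) < - ?G (@?f n) (@?g n) x)) =>
    refine (@relsc_lt2 _ _ s K (fun n m x => - G n m x) f g Q h _ _ _)
| h : eopen ?s ?K ?U |- eopen ?s ?K ?U => exact h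
| h : eopen ?s ?K ?U |- eopen ?s ?K (fun n => ?U (@?f n)) =>
    refine (@eopen_comp _ _ s K U f h _)
| h : eopen ?s ?K ?U |- eopen ?s ?K (fun n x => ?U (@?f n) x) =>
    refine (@eopen_comp _ _ s K U f h _)
| h : eopen ?s ?K (fun m => ?U (nfst m) (nsnd m)) |-
    eopen ?s ?K (fun n x => ?U (@?f n) (@?g n) x) =>
    refine (@eopen_app2 _ _ s K U f g h _ _)
| |- eopen ?s ?K (fun n x => @?P n) => refine (@eopen_ce _ _ s K P _)
end.

Ltac effective_open := repeat effective_open_step; computability.

Section EffectiveSemicontinuityClosure.
Variables (R : realType) (X : completeMetricType R) (s : nat -> X).
Implicit Types (K : set X) (G : nat -> X -> \bar R) (a : nat -> X -> R).
Local Notation eopen := (eopen s).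
Local Notation elsc := (elsc s).
Local Notation relsc := (relsc s).
Local Notation ecomp := (ecomp s).

Lemma elsc_sum K (G : nat -> nat -> X -> \bar R) b :
  (forall n j x, K x -> (-oo < G n j x)%E) ->
  elsc K (fun m => G (nfst m) (nsnd m)) -> computable b ->
  elsc K (fun n x => (\sum_(j < b n) G n j x)%E).
Proof.
move=> GNy hG hb; apply: (@eq_eopen _ _ _ _ (fun m x => exists w,
    ratn (nsnd m) < \sum_(j < b (nfst m)) ratn (lookup w j) /\
    forall j, (j < b (nfst m))%N -> ((ratr (ratn (lookup w j)))%:E < G (nfst m) j x)%E)).
  move=> m x Kx; rewrite (@ratn_lt_sum _ _ (fun j => G (nfst m) j x)).
    by split=> -[w [h1 h2]]; exists w; rewrite ltr_rat in h1 *.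
  by move=> j _; exact: GNy.
effective_open.
by apply: (@crat_sum _ (fun n j => ratn (lookup (nsnd n) j))); computability.
Qed.

Lemma relsc_add K a b : relsc K a -> relsc K b -> relsc K (fun n x => a n x + b n x).
Proof.
move=> ha hb; apply: (@eq_eopen _ _ _ _ (fun m x => exists k,
    ratr (ratn k) < a (nfst m) x /\ ratr (ratn (nsnd m) - ratn k) < b (nfst m) x)).
  move=> m x _; split=> [[k [h1]]|h]; first by rewrite rmorphB /=; lra.
  have [|k /andP[h1 h2]] := @ratn_between R (ratr (ratn (nsnd m)) - b (nfst m) x)
    (a (nfst m) x); first by lra.
  by exists k; split=> //; rewrite rmorphB /=; lra.
by effective_open.
Qed.

Lemma relsc_ratr K (Q : nat -> rat) : crat Q -> relsc K (fun n _ => ratr (Q n)).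
Proof.
move=> hQ; apply: (@eq_eopen _ _ _ _ (fun m _ => ratn (nsnd m) < Q (nfst m))).
  by move=> m x _; rewrite ltr_rat.
by effective_open.
Qed.

Lemma relsc_div K a (Q : nat -> rat) : crat Q -> (forall n, 0 < Q n) -> relsc K a ->
  relsc K (fun n x => a n x / ratr (Q n)).
Proof.
move=> hQ Q0 ha.
apply: (@eq_eopen _ _ _ _ (fun m x => ratr (ratn (nsnd m) * Q (nfst m)) < a (nfst m) x)).
  by move=> m x _; rewrite rmorphM /= ltr_pdivlMr // ltr0q.
by effective_open.
Qed.

Lemma relsc_min K a b : relsc K a -> relsc K b ->
  relsc K (fun n x => Num.min (a n x) (b n x)).
Proof.
move=> ha hb; apply: (@eq_eopen _ _ _ _ (fun m x => ratr (ratn (nsnd m)) < a (nfst m) x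
   /\ ratr (ratn (nsnd m)) < b (nfst m) x)).
  by move=> m x _; rewrite lt_min; split=> /andP.
by effective_open.
Qed.

Lemma relsc_max K a b : relsc K a -> relsc K b ->
  relsc K (fun n x => Num.max (a n x) (b n x)).
Proof.
move=> ha hb; apply: (@eq_eopen _ _ _ _ (fun m x => ratr (ratn (nsnd m)) < a (nfst m) x
   \/ ratr (ratn (nsnd m)) < b (nfst m) x)).
  by move=> m x _; rewrite lt_max; split=> /orP.
by effective_open.
Qed.

Lemma ecomp_add K a b : ecomp K a -> ecomp K b -> ecomp K (fun n x => a n x + b n x).
Proof.
move=> [a1 a2] [b1 b2]; split; first exact: relsc_add.
by apply: eq_relsc (relsc_add a2 b2) => n x _; rewrite opprD.
Qed.

Lemma ecomp_opp K a : ecomp K a -> ecomp K (fun n x => - a n x).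
Proof.
by move=> [a1 a2]; split=> //; apply: eq_relsc a1 => n x _; rewrite opprK.
Qed.

Lemma ecomp_sub K a b : ecomp K a -> ecomp K b -> ecomp K (fun n x => a n x - b n x).
Proof. by move=> ha hb; apply: ecomp_add => //; exact: ecomp_opp. Qed.

Lemma ecomp_ratr K (Q : nat -> rat) : crat Q -> ecomp K (fun n _ => ratr (Q n)).
Proof.
move=> hQ; split; first exact: relsc_ratr.
have := relsc_ratr K (crat_opp hQ).
by apply: eq_relsc => n x _; rewrite rmorphN.
Qed.

Lemma ecomp_div K a (Q : nat -> rat) : crat Q -> (forall n, 0 < Q n) -> ecomp K a ->
  ecomp K (fun n x => a n x / ratr (Q n)).
Proof.
move=> hQ Q0 [a1 a2]; split; first exact: relsc_div.
by apply: eq_relsc (relsc_div hQ Q0 a2) => n x _; rewrite mulNr.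
Qed.

Lemma ecomp_min K a b : ecomp K a -> ecomp K b ->
  ecomp K (fun n x => Num.min (a n x) (b n x)).
Proof.
move=> [a1 a2] [b1 b2]; split; first exact: relsc_min.
by apply: eq_relsc (relsc_max a2 b2) => n x _; rewrite oppr_min.
Qed.

Lemma ecomp_bmax K (a : nat -> nat -> X -> R) b :
  ecomp K (fun m => a (nfst m) (nsnd m)) -> computable b ->
  ecomp K (fun n x => bmax (fun j => a n j x) (b n)).
Proof.
move=> [a1 a2] hb; split.
  apply: (@eq_eopen _ _ _ _ (fun m x => ratn (nsnd m) < 0 \/
      exists j, (j < b (nfst m))%N /\ ratr (ratn (nsnd m)) < a (nfst m) j x)).
    move=> m x _; rewrite lt_bmax.
    suff -> : ratn (nsnd m) < 0 <-> ratr (ratn (nsnd m)) < 0 :> R by [].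
    by rewrite ltrq0.
  by effective_open.
apply: (@eq_eopen _ _ _ _ (fun m x => ratn (nsnd m) < 0 /\
    forall j, (j < b (nfst m))%N -> ratr (ratn (nsnd m)) < - a (nfst m) j x)).
  move=> m x _; rewrite ltrNr bmax_lt oppr_gt0 ltrq0.
  split=> -[h1 h2]; split=> // j jb.
    by rewrite ltrNr; exact: h2.
  by rewrite ltrNr; exact: h2.
by effective_open.
Qed.

(** For a set that is only open the step would be merely lower semi-computable, when [Q] is
    positive; openness of the complement on [K] provides the upper bounds. *)
Lemma ecomp_indic K (U : nat -> X -> Prop) (Q : nat -> rat) : crat Q ->
  eopen K U -> eopen K (fun n x => ~ U n x) ->
  ecomp K (fun n x => if `[< U n x >] then ratr (Q n) else 0).
Proof.
move=> hQ hU hU'; split.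
  apply: (@eq_eopen _ _ _ _ (fun m x => (U (nfst m) x /\ ratn (nsnd m) < Q (nfst m)) \/
      (~ U (nfst m) x /\ ratn (nsnd m) < 0))).
    move=> m x _; case: asboolP => Ux; rewrite ?ltr_rat ?ltrq0.
      by split=> [[[]|[]]|] //; left.
    by split=> [[[]|[]]|] //; right.
  by effective_open; exact: (eopen_comp hU' (computable_fst computable_id)).
apply: (@eq_eopen _ _ _ _ (fun m x => (U (nfst m) x /\ ratn (nsnd m) < - Q (nfst m)) \/
    (~ U (nfst m) x /\ ratn (nsnd m) < 0))).
  move=> m x _; case: asboolP => Ux; rewrite ?oppr0 -?rmorphN ?ltr_rat ?ltrq0.
    by split=> [[[]|[]]|] //; left.
  by split=> [[[]|[]]|] //; right.
by effective_open; exact: (eopen_comp hU' (computable_fst computable_id)).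
Qed.

End EffectiveSemicontinuityClosure.

(** * Effective integrals *)

Section LowerSums.
Variable R : realType.
Implicit Types (u : nat -> \bar R) (g l : \bar R).

Lemma limn_einfE u : limn_einf u = ereal_sup (range (einfs u)).
Proof. by rewrite limn_einf_lim; apply/cvg_lim => //; exact: cvg_einfs_sup. Qed.

Lemma limn_einf_le u l : (forall n, (u n <= l)%E) -> (limn_einf u <= l)%E.
Proof.
move=> ul; rewrite limn_einfE; apply: ge_ereal_sup => _ [n _ <-].
by apply: le_trans (ul n); apply: ereal_inf_lbound; exists n => //=.
Qed.

Lemma le_limn_einf u l N : (forall n, (N <= n)%N -> (l <= u n)%E) ->
  (l <= limn_einf u)%E.
Proof.
move=> lu; rewrite limn_einfE; apply: le_trans (ereal_sup_ubound _); last by exists N.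
by apply: le_ereal_inf_tmp => _ [n /= Nn <-]; exact: lu.
Qed.

(** A Riemann sum for the layer-cake formula: [d] times the number of levels among [d], [2d], ...,
    [Md] lying strictly below [g]. Strictness matters, since only sets of the form [f > q] are
    open. *)
Definition step_sum (d : R) (g : \bar R) (M : nat) : R :=
  \sum_(j < M) (if ((j.+1%:R * d)%:E < g)%E then d else 0).

Lemma step_sum_le d g M : 0 <= d -> (0 <= g)%E -> ((step_sum d g M)%:E <= g)%E.
Proof.
move=> d0 g0; rewrite /step_sum.
(* The induction also carries the bound [M d]: if the next level lies below [g], the new sum is at
   most that level. *)
suff [] : ((\sum_(j < M) (if ((j.+1%:R * d)%:E < g)%E then d else 0))%:E <= g)%E /\
  \sum_(j < M) (if ((j.+1%:R * d)%:E < g)%E then d else 0) <= M%:R * d by [].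
elim: M => [|M [IH1 IH2]]; first by rewrite big_ord0 mul0r.
rewrite big_ord_recr /=; case: ifPn => h; last first.
  by rewrite addr0; split=> //; rewrite -natr1 mulrDl mul1r; lra.
have h2 : \sum_(j < M) (if ((j.+1%:R * d)%:E < g)%E then d else 0) + d <= M.+1%:R * d.
  by rewrite -natr1 mulrDl mul1r lerD2r.
by split=> //; apply: le_trans (ltW h); rewrite lee_fin.
Qed.

Lemma step_sum_ge d g J M : 0 <= d -> (J <= M)%N -> ((J%:R * d)%:E < g)%E ->
  J%:R * d <= step_sum d g M.
Proof.
move=> d0 JM Jg; rewrite /step_sum -(subnKC JM) big_split_ord /=.
rewrite (eq_bigr (fun=> d)) => [|j _].
  rewrite sumr_const card_ord -[d *+ J]mulr_natl lerDl; apply: sumr_ge0 => j _.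
  by case: ifP.
rewrite ifT //; apply: le_lt_trans Jg; rewrite lee_fin.
by apply: ler_wpM2r => //; rewrite ler_nat.
Qed.

Lemma step_sum_cvg (a : R) g : (a%:E < g)%E ->
  exists N, forall m, (N <= m)%N -> a <= step_sum (2 ^- m) g (m * 2 ^ m).
Proof.
move=> ag; have [a0|a0] := ltP a 0.
  exists 0 => m _; apply: (le_trans (ltW a0)).
  by apply: sumr_ge0 => j _; case: ifP.
have [k [ak kg]] := ratn_lte ag; rewrite lte_fin in ak.
have e0 : 0 < ratr (ratn k) - a by lra.
have [N1 _ hN1] := near_infty_natSinv_expn_lt (PosNum e0).
(* With [J] below, [a <= J 2^-m <= a + 2^-m]. The first bound on [m] keeps this below the rational
   under [g]; the second gives [a + 1 <= m], so that [J] is among the [m 2^m] levels. *)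
exists (maxn N1 (Num.truncn a).+2) => m; rewrite geq_max => /andP[/hN1 /= h1 h2].
pose J := (Num.truncn (a * 2 ^+ m)).+1.
have p0 : 0 < 2 ^+ m :> R by rewrite exprn_gt0.
have am0 : 0 <= a * 2 ^+ m by rewrite mulr_ge0 // ltW.
have /andP[J1 J2] := truncn_itv am0.
have J3 : J%:R <= a * 2 ^+ m + 1 by rewrite /J -natr1; lra.
have JE : a <= J%:R * 2 ^- m by rewrite ler_pdivlMr // ltW.
apply: le_trans JE _; apply: step_sum_ge.
- by rewrite invr_ge0 ltW.
- rewrite -(ler_nat R) natrM natrX (le_trans J3) //.
  have am : a + 1 <= m%:R.
    have /andP[_ h3] := truncn_itv a0.
    have : (Num.truncn a).+2%:R <= m%:R :> R by rewrite ler_nat.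
    by rewrite -natr1; lra.
  have p1 : 1 <= 2 ^+ m :> R by rewrite exprn_ege1 // ler1n.
  by apply: (@le_trans _ _ ((a + 1) * 2 ^+ m)); [lra|rewrite ler_wpM2r // ltW].
apply: le_lt_trans kg; rewrite lee_fin ler_pdivrMr //.
apply: (le_trans J3).
have : 1 / 2 ^+ m * 2 ^+ m < (ratr (ratn k) - a) * 2 ^+ m by rewrite ltr_pM2r.
by rewrite div1r mulVf ?gt_eqF //; lra.
Qed.

Lemma ge0_integral_full d (T : measurableType d) (mu : {measure set T -> \bar R})
    (K : set T) (g : T -> \bar R) :
  measurable K -> mu (~` K) = 0%E -> measurable_fun setT g -> (forall y, (0 <= g y)%E) ->
  (\int[mu]_y g y = \int[mu]_(y in K) g y)%E.
Proof.
move=> mK K0 mg g0; rewrite (ge0_negligible_integral (measurableC mK)) //.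
by rewrite setTD setCK.
Qed.

(** The integral is the supremum of its layer-cake sums with mesh [2^-m] up to height [m], so only
    measures of superlevel sets enter. Fatou's lemma gives the nontrivial inequality without any
    monotonicity in [m]. The sets [W m j] need to be superlevel sets on [K] only, hence may be
    chosen open. The mesh is moved to the left as the factor [2^m]. *)
Lemma integral_lower_sums d (T : measurableType d) (mu : {measure set T -> \bar R})
    (K : set T) (g : T -> \bar R) (W : nat -> nat -> set T) (q : R) :
  measurable K -> mu (~` K) = 0%E -> measurable_fun K g ->
  (forall y, K y -> (0 <= g y)%E) ->
  (forall m j, measurable (W m j)) ->
  (forall m j y, K y -> (W m j y <-> ((ratr (j.+1%:R * 2 ^- m))%:E < g y)%E)) ->
  (q%:E < \int[mu]_(y in K) g y)%E <->
  exists m, ((q * 2 ^+ m)%:E < \sum_(j < m * 2 ^ m) mu (W m j))%E.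
Proof.
move=> mK K0 mg g0 mW Wg.
pose S m y : \bar R := (\sum_(j < m * 2 ^ m) (2 ^- m)%:E * (\1_(W m j) y)%:E)%E.
have muW A : measurable A -> mu A = mu (A `&` K).
  move=> mA; rewrite (measureDI mu mA mK) [X in (X + _)%E](_ : _ = 0%E) ?add0e //.
  by apply: (subset_measure0 _ _ _ K0); [exact: measurableD|exact: measurableC|move=> ? []].
have SE m y : K y -> S m y = (step_sum (2 ^- m) (g y) (m * 2 ^ m))%:E.
  move=> Ky; rewrite /S /step_sum -sumEFin; apply: eq_bigr => j _.
  have -> : (j.+1%:R * 2 ^- m : R) = ratr (j.+1%:R * 2 ^- m).
    by rewrite rmorphM /= fmorphV rmorphXn /= !ratr_nat.
  rewrite indicE; case: ifPn => h.
    by rewrite mem_set ?mule1 //; apply/Wg.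
  rewrite memNset ?mule0 // => /Wg; move/negP: h; tauto.
have p0 m : 0 < 2 ^- m :> R by rewrite invr_gt0 exprn_gt0.
have SI m : (\int[mu]_(y in K) S m y =
    (2 ^- m)%:E * \sum_(j < m * 2 ^ m) mu (W m j))%E.
  rewrite /S ge0_integral_sum //; last first.
    by move=> j; apply/measurable_funeM/measurable_EFinP; exact: measurable_indic.
  rewrite ge0_sume_distrr //.
  apply: eq_bigr => j _; rewrite ge0_integralZl //=.
  - by rewrite integral_indic // -muW.
  - by apply/measurable_EFinP; exact: measurable_indic.
have mS m : measurable_fun K (S m).
  apply: emeasurable_sum => j; apply/measurable_funeM/measurable_EFinP.
  exact: measurable_indic.
have S0 m y : K y -> (0 <= S m y)%E.
  by move=> _; apply: sume_ge0 => j _; rewrite mule_ge0 // lee_fin ltW.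
have intS m : (q%:E < \int[mu]_(y in K) S m y)%E =
    ((q * 2 ^+ m)%:E < \sum_(j < m * 2 ^ m) mu (W m j))%E.
  by rewrite SI muleC lte_pdivlMr ?exprn_gt0 // -EFinM.
split=> [qg|[m]].
  apply: contrapT => /forallNP h; move: qg; apply/negP; rewrite -leNgt.
  have -> : (\int[mu]_(y in K) g y = \int[mu]_(y in K) limn_einf (S ^~ y))%E.
    apply: eq_integral => y /[!inE] Ky; apply/eqP; rewrite eq_le; apply/andP; split.
      rewrite leNgt; apply/negP => /ratn_lte[k [h1 /step_sum_cvg[N hN]]].
      move: h1; apply/negP; rewrite -leNgt; apply: (@le_limn_einf _ _ N) => m Nm.
      by rewrite SE // lee_fin; exact: hN.
    apply: limn_einf_le => m; rewrite SE //.
    by apply: step_sum_le; [exact/ltW/p0|exact: g0].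
  apply: (le_trans (fatou mu mK mS S0)); apply: limn_einf_le => m.
  by rewrite leNgt intS; apply/negP/h.
rewrite -intS => /lt_le_trans; apply; apply: ge0_le_integral => //; first exact: S0.
by move=> y Ky; rewrite SE //; apply: step_sum_le; [exact/ltW/p0|exact: g0].
Qed.

End LowerSums.

Section EffectiveIntegral.
Variables (R : realType) (X : completeMetricType R) (s : nat -> X).
Local Notation eopen := (eopen s).
Local Notation elsc := (elsc s).
Hypothesis polish : computable_polish s.

Lemma measurable_open (U : set X) : open U -> measurable (U : set (borel X)).
Proof. by move=> oU; exact: sub_sigma_algebra oU. Qed.

Lemma elsc_measurable (K : set (borel X)) (G : nat -> X -> \bar R) n : measurable K ->
  elsc K G -> measurable_fun K (G n : borel X -> \bar R).
Proof.
move=> mK /(eopen_ext polish)[V _ [oV VG]].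
move=> mD; apply: (measurability _ (ErealGenOInfty.measurableE R)) => //.
move=> _ [_ [a ->] <-].
rewrite (_ : _ `&` _ =
    K `&` \bigcup_(k in [set k | a < ratr (ratn k)]) V (npair n k)).
  apply: measurableI => //; apply: bigcup_measurable => k _.
  exact: measurable_open.
apply/seteqP; split=> x [Kx].
  rewrite /= in_itv /= andbT => /ratn_lte[k [h1 h2]]; split=> //; exists k.
    by move: h1; rewrite lte_fin.
  by apply/VG => //; rewrite nfstK nsndK.
move=> [k /= ak Vk]; have := (VG (npair n k) x Kx).2 Vk; rewrite nfstK nsndK => h.
split=> //.
by rewrite /= in_itv /= andbT; apply: lt_trans h; rewrite lte_fin.
Qed.

(** Covers two cases by one notion: the constant kernel [nu] and the disintegrations [rho n x]. *)
Definition ekernel (K : set X)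
    (kappa : nat -> X -> {measure set (borel X) -> \bar R}) : Prop :=
  (forall U, eopen setT U -> elsc K (fun m x => kappa (nfst m) x (U (nsnd m)))) /\
  forall n x, K x -> kappa n x (~` K) = 0%E.

Lemma elsc_integral (K : set (borel X)) kappa (G : nat -> X -> \bar R) :
  measurable K -> ekernel K kappa -> (forall n x, K x -> (0 <= G n x)%E) -> elsc K G ->
  elsc K (fun m x => (\int[kappa (nfst m) x]_(y in K) G (nsnd m) y)%E).
Proof.
move=> mK [kU kK] G0 hG; have [V hV [oV VG]] := eopen_ext polish hG.
(* [g] gives codes of the levels [(j+1) 2^-i] in the numbering [ratn], so the superlevel sets can be
   looked up in [V]. *)
have [g hg gE] : crat (fun i => ((nsnd i).+1%:R * 2 ^- nfst i)) by computability.
have hW : eopen setT (fun i => V (npair (nfst i) (g (nsnd i)))) by effective_open.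
have hS := kU _ hW.
pose H n x := (\sum_(j < nsnd n * 2 ^ nsnd n) kappa (nfst (nfst n)) x
   (V (npair (nsnd (nfst n)) (g (npair (nsnd n) j)))))%E.
have hH : elsc K H.
  apply: (@elsc_sum _ _ _ _ (fun n j x => kappa (nfst (nfst n)) x
    (V (npair (nsnd (nfst n)) (g (npair (nsnd n) j)))))); last by computability.
    by move=> n j x _; apply: lt_le_trans (measure_ge0 _ _); rewrite ltNyr.
  have := elsc_comp hS (f := fun m => npair (nfst (nfst (nfst m)))
    (npair (nsnd (nfst (nfst m))) (npair (nsnd (nfst m)) (nsnd m)))).
  have /[swap]/[apply] : computable (fun m => npair (nfst (nfst (nfst m)))
    (npair (nsnd (nfst (nfst m))) (npair (nsnd (nfst m)) (nsnd m)))) by computability.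
  by apply: eq_elsc => n x _; rewrite !(nfstK, nsndK).
apply: (@eq_eopen _ _ _ _ (fun m x => exists i,
    ((ratr (ratn (nsnd m) * 2 ^+ i))%:E < H (npair (nfst m) i) x)%E)); last by effective_open.
move=> m x Kx.
rewrite (@integral_lower_sums _ _ _ _ K _
  (fun i j => V (npair (nsnd (nfst m)) (g (npair i j))))) //.
- have qE i : ratr (ratn (nsnd m) * 2 ^+ i) = ratr (ratn (nsnd m)) * 2 ^+ i :> R.
    by rewrite rmorphM rmorphXn /= ratr_nat.
  by split=> -[i hi]; exists i; move: hi; rewrite /H !(nfstK, nsndK) qE.
- exact: kK.
- exact: elsc_measurable.
- exact: G0.
- by move=> i j; exact: measurable_open.
- move=> i j y Ky; rewrite -VG // !(nfstK, nsndK).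
  by have := gE (npair i j); rewrite nfstK nsndK => ->.
Qed.

End EffectiveIntegral.

(** * An effective Borel-Cantelli lemma *)

Section GeometricSums.
Variable R : realType.

Lemma geometric_partial_sum (y : nat -> R) (C : R) m k :
  (forall i, y i <= C * 2 ^- i) ->
  \sum_(i < m + k) y i <= \sum_(i < m) y i + C * 2 * (2 ^- m - 2 ^- (m + k)).
Proof.
move=> yC; elim: k => [|k IH]; first by rewrite addn0 subrr mulr0 addr0.
rewrite addnS big_ord_recr /=; have := yC (m + k)%N.
rewrite exprS invfM; move: IH; set A := 2 ^- (m + k); set B := 2 ^- m.
by move=> *; lra.
Qed.

(** The last bound controls the tail explicitly; it is what yields upper approximations of the sum
    from finitely many terms. *)
Lemma nneseries_geometric (y : nat -> R) (C : R) : (forall i, 0 <= y i) ->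
  (forall i, y i <= C * 2 ^- i) -> exists c : R,
  [/\ (\sum_(i <oo) (y i)%:E = c%:E)%E, forall m, \sum_(i < m) y i <= c &
      forall m, c <= \sum_(i < m) y i + C * 2 * 2 ^- m].
Proof.
move=> y0 yC.
have C0 : 0 <= C by have := le_trans (y0 0%N) (yC 0%N); rewrite expr0 invr1 mulr1.
have sE m : (\sum_(0 <= i < m) (y i)%:E = (\sum_(i < m) y i)%:E)%E.
  by rewrite sumEFin big_mkord.
have lo m : ((\sum_(i < m) y i)%:E <= \sum_(i <oo) (y i)%:E)%E.
  by rewrite -sE; apply: nneseries_lim_ge => i _ _; rewrite lee_fin.
have hi m : (\sum_(i <oo) (y i)%:E <= (\sum_(i < m) y i + C * 2 * 2 ^- m)%:E)%E.
  apply: lime_le; first by apply: is_cvg_nneseries => i _ _; rewrite lee_fin.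
  exists m => // n /= mn; rewrite sE lee_fin -(subnKC mn).
  apply: le_trans (geometric_partial_sum _ _ yC) _.
  rewrite lerD2l ler_wpM2l ?mulr_ge0 // lerBlDr lerDl invr_ge0 exprn_ge0 //.
have : (\sum_(i <oo) (y i)%:E)%E \is a fin_num.
  by apply/fin_numPlt; rewrite (lt_le_trans _ (lo 0%N)) ?ltNyr // (le_lt_trans (hi 0%N)) ?ltry.
move=> /fineK cE; exists (fine (\sum_(i <oo) (y i)%:E)%E).
by split=> [|m|m]; rewrite ?cE // -lee_fin cE.
Qed.

End GeometricSums.

Section BorelCantelli.
Variables (R : realType) (X : completeMetricType R) (s : nat -> X).
Variable nu : probability (borel X) R.
Local Notation eopen := (eopen s).
Local Notation elsc := (elsc s).
Hypothesis polish : computable_polish s.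
Hypothesis cnu : computable_measure s nu.

Lemma ce_measure_gt (U : nat -> set X) (Q : nat -> rat) : eopen setT U -> crat Q ->
  ce (fun n => ((ratr (Q n))%:E < nu (U n))%E).
Proof.
move=> hU hQ; have [g hg gU] := uniform_eopen polish cnu hU.
apply: (@eq_ce (fun n => exists i, Q n < ratn (g (npair n i)))); last by computability.
move=> n; rewrite (gU n); split=> [[i h]|/ereal_sup_gt[_ [i _ <-]]].
  apply: (@lt_le_trans _ _ (ratr (ratn (g (npair n i))))%:E).
    by rewrite lte_fin ltr_rat.
  by apply: ereal_sup_ubound; exists i.
by rewrite lte_fin ltr_rat => h; exists i.
Qed.

Lemma ekernel_nu (K : set X) : nu (~` K) = 0%E -> ekernel s K (fun _ _ => nu).
Proof.
move=> K0; split=> // U hU.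
apply: (@eopen_ce _ _ _ _ (fun m => ((ratr (ratn (nsnd m)))%:E < nu (U (nsnd (nfst m))))%E)).
have hU' : eopen setT (fun m => U (nsnd (nfst m))) by effective_open.
by apply: ce_measure_gt; computability.
Qed.

Lemma probability_full (K : set (borel X)) : measurable K -> nu (~` K) = 0%E -> nu K = 1%E.
Proof.
move=> mK K0; have := probability_setC nu mK; rewrite K0 => /esym/eqP.
by rewrite sube_eq ?fin_num_measure // add0e => /eqP.
Qed.

(** Turns lower bounds for the integral of [1 - f] into upper bounds for that of [f]. *)
Lemma integral_onem (K : set (borel X)) (f : borel X -> R) : measurable K ->
  nu (~` K) = 0%E -> measurable_fun K (fun z => (f z)%:E) ->
  (forall z, K z -> 0 <= f z <= 1) ->
  (\int[nu]_(z in K) (1 - f z)%:E = 1 - \int[nu]_(z in K) (f z)%:E)%E.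
Proof.
move=> mK K0 mf f01.
have f0 z : K z -> (0 <= (f z)%:E)%E by move=> /f01 /andP[]; rewrite lee_fin.
have g0 z : K z -> (0 <= (1 - f z)%:E)%E.
  by move=> /f01 /andP[_]; rewrite lee_fin subr_ge0.
have mg : measurable_fun K (fun z => (1 - f z)%:E).
  apply/measurable_EFinP/measurable_funB; first exact: measurable_cst.
  by apply/measurable_EFinP; exact: mf.
have e : (\int[nu]_(z in K) (1 - f z)%:E + \int[nu]_(z in K) (f z)%:E = 1)%E.
  rewrite -ge0_integralD // (eq_integral (cst 1%E)) => [|z _].
    by rewrite integral_cst // mul1e; exact: probability_full.
  by rewrite -EFinD subrK.
have fin : (\int[nu]_(z in K) (f z)%:E)%E \is a fin_num.
  rewrite ge0_fin_numE ?integral_ge0 //; apply: (@le_lt_trans _ _ 1%E); last exact: ltry.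
  by rewrite -e leeDr // integral_ge0.
by rewrite -e addeK.
Qed.

(** The open set [V n] contains [K] if [P n] holds and misses [K] otherwise, so its measure is 1 or
    0, and being positive is a c.e. property. Hence no particular point of [K] has to be
    consulted. *)
Lemma ce_eopen_const (K : set (borel X)) (P : nat -> Prop) : measurable K ->
  nu (~` K) = 0%E -> eopen K (fun n _ => P n) -> ce P.
Proof.
move=> mK K0 /(eopen_ext polish)[V hV [oV VP]].
have := ce_measure_gt hV (crat_const 0); apply: eq_ce => n; rewrite rmorph0.
have nuK := probability_full mK K0.
split=> [h|Pn]; last first.
  apply: (@lt_le_trans _ _ (nu K)); first by rewrite nuK lte_fin.
  by apply: le_measure; rewrite ?inE //; [exact: measurable_open|move=> x Kx; apply/VP].
apply: contrapT => Pn; move: h; apply/negP; rewrite -leNgt.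
apply: (@le_trans _ _ (nu (~` K))); last by rewrite K0.
apply: le_measure; rewrite ?inE.
- exact: measurable_open.
- exact: measurableC.
- by move=> x Vx Kx; apply: Pn; apply/(VP n x Kx).
Qed.

Lemma ce_integral_gt (K : set (borel X)) (G : nat -> X -> \bar R) f (Q : nat -> rat) :
  measurable K -> nu (~` K) = 0%E -> (forall n x, K x -> (0 <= G n x)%E) ->
  elsc K G -> computable f -> crat Q ->
  ce (fun n => ((ratr (Q n))%:E < \int[nu]_(y in K) G (f n) y)%E).
Proof.
move=> mK K0 G0 hG hf hQ.
have := elsc_integral polish mK (ekernel_nu K0) G0 hG.
move=> /elsc_lt /(_ (computable_pair computable_id hf) hQ) h.
apply: (ce_eopen_const mK K0); apply: eq_eopen h => n x _.
by rewrite nsndK.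
Qed.

(** The sum of the [a i] is turned into a Schnorr test. As [a i x <= 1], a failure of the conclusion
    at [i] means a term equal to 1, and infinitely many of these make the test infinite at [x]. *)
Lemma borel_cantelli (K : set (borel X)) (a : nat -> X -> R) (C : nat) :
  measurable K -> nu (~` K) = 0%E -> ecomp s K a ->
  (forall n x, K x -> 0 <= a n x <= 1) ->
  (forall n, (\int[nu]_(y in K) (a n y)%:E <= (C%:R * 2 ^- n)%:E)%E) ->
  forall x, SR s nu x -> K x -> exists I, forall i, (I <= i)%N -> a i x < 1.
Proof.
move=> mK K0 [ha ha'] a01 aC x SRx Kx.
have [V hV [oV VA]] := eopen_ext polish ha.
(* A test must be lower semi-computable on the whole space, whereas [a] is controlled on [K] only.
   [L] is rebuilt from the extended open sets [V], with 0 thrown in to make it nonnegative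
   everywhere. *)
pose L n y : \bar R := ereal_sup ([set 0%E] `|` [set (ratr (ratn k))%:E | k in
  [set k | V (npair n k) y]]).
have L0 n y : (0 <= L n y)%E by apply: ereal_sup_ubound; left.
have LE n y : K y -> L n y = (a n y)%:E.
  move=> Ky; have /andP[a0 _] := a01 n _ Ky.
  apply/eqP; rewrite eq_le; apply/andP; split.
    apply: ge_ereal_sup => _ [->|[k /= Vk <-]]; rewrite lee_fin //.
    by have := (VA _ _ Ky).2 Vk; rewrite nfstK nsndK; exact: ltW.
  rewrite leNgt; apply/negP => /ratn_lte[k [h1 h2]].
  move: h1; apply/negP; rewrite -leNgt; apply: ereal_sup_ubound; right.
  by exists k => //=; apply/VA; rewrite ?nfstK ?nsndK //; move: h2; rewrite lte_fin.
have hL : elsc setT L.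
  apply: (@eq_eopen _ _ _ _ (fun m y => ratn (nsnd m) < 0 \/ exists k,
    ratn (nsnd m) < ratn k /\ V (npair (nfst m) k) y)); last by effective_open.
  move=> m y _; split=> [[q0|[k [qk Vk]]]|/ereal_sup_gt[_ [->|[k Vk <-]]]].
  - by apply: lt_le_trans (L0 _ _); rewrite lte_fin ltrq0.
  - apply: (@lt_le_trans _ _ (ratr (ratn k))%:E); first by rewrite lte_fin ltr_rat.
    by apply: ereal_sup_ubound; right; exists k.
  - by rewrite lte_fin ltrq0; left.
  - by rewrite lte_fin ltr_rat => h; right; exists k.
pose g y : \bar R := (\sum_(i <oo) L i y)%E.
have g0 y : (0 <= g y)%E by apply: nneseries_ge0.
have gE y q : (q%:E < g y)%E <-> exists m, (q%:E < \sum_(i < m) L i y)%E.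
  split=> [h|[m /lt_le_trans]]; last first.
    by apply; rewrite -(big_mkord xpredT (fun i => L i y)); exact: nneseries_lim_ge.
  apply: contrapT => /forallNP hm; move: h; apply/negP; rewrite -leNgt.
  apply: lime_le; first by apply: is_cvg_nneseries.
  by apply: nearW => m; rewrite big_mkord leNgt; apply/negP/hm.
pose Ls n y := (\sum_(i < n) L i y)%E.
have hLs : elsc setT Ls.
  apply: (@elsc_sum _ _ _ _ (fun _ j => L j)); last by computability.
    by move=> n j y _; apply: lt_le_trans (L0 _ _); rewrite ltNyr.
  exact: (elsc_comp hL (computable_snd computable_id)).
have hg : elsc setT (fun _ => g).
  apply: (@eq_eopen _ _ _ _ (fun m y => exists n,
    ((ratr (ratn (nsnd m)))%:E < Ls n y)%E)); last by effective_open.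
  by move=> m y _; rewrite gE.
have mL n : measurable_fun setT (L n : borel X -> \bar R).
  have mT : measurable [set: borel X] by exact: measurableT.
  exact (@elsc_measurable _ _ _ polish [set: borel X] L n mT hL).
have ma n : measurable_fun K (fun y : borel X => (a n y)%:E).
  have h : elsc K (fun n z => (a n z)%:E) by apply/elscEFin.
  exact (@elsc_measurable _ _ _ polish K (fun n z => (a n z)%:E) n mK h).
pose y n := fine (\int[nu]_(z in K) (a n z)%:E)%E.
have I0 n : (0 <= \int[nu]_(z in K) (a n z)%:E)%E.
  by apply: integral_ge0 => z Kz; rewrite lee_fin; case/andP: (a01 n _ Kz).
have yE n : (\int[nu]_(z in K) (a n z)%:E = (y n)%:E)%E.
  by rewrite fineK // ge0_fin_numE // (le_lt_trans (aC n)) ?ltry.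
have y0 n : 0 <= y n by rewrite -lee_fin -yE.
have yC n : y n <= C%:R * 2 ^- n by rewrite -lee_fin -yE.
have [c [cE c1 c2]] := nneseries_geometric y0 yC.
have intL n : (\int[nu]_z L n z = (y n)%:E)%E.
  rewrite (ge0_integral_full mK K0) // -yE.
  by apply: eq_integral => z /[!inE] Kz; exact: LE.
have intg : (\int[nu]_z g z = c%:E)%E.
  rewrite integral_nneseries // -cE; by apply: eq_eseriesr => i _.
(* The lower cut comes from [g] being lower semi-computable. For the upper cut, [c < q] holds iff
   for some [m] the first [m] integrals plus the tail bound [2C 2^-m] stay below [q]; this is read
   as a lower bound on the integral of the sum of the [1 - a i], which equals [m] minus those
   integrals. *)
have cc : computable_real c.
  apply: computable_real_cut.
    have := ce_integral_gt (K := setT) measurableT _ (fun _ z _ => g0 z) hg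
      (computable_const 0) (crat_ratn computable_id).
    by rewrite setCT measure0 intg => /(_ erefl); apply: eq_ce => n; rewrite lte_fin.
  pose G m z := (\sum_(i < m) (1 - a i z)%:E)%E.
  have G0 m z : K z -> (0 <= G m z)%E.
    move=> Kz; apply: sume_ge0 => i _; rewrite lee_fin subr_ge0.
    by case/andP: (a01 i _ Kz).
  have hG : elsc K G.
    apply: (@elsc_sum _ _ _ _ (fun _ j z => (1 - a j z)%:E)); [|apply/elscEFin|computability].
      by move=> n j z _; rewrite ltNyr.
    apply: (@eq_relsc _ _ _ _ (fun m z => ratr 1 + - a (nsnd m) z)).
      by move=> n z _; rewrite rmorph1.
    apply: relsc_add; first by apply: relsc_ratr; computability.
    exact: (relsc_comp ha' (computable_snd computable_id)).
  have := @ce_integral_gt K G nsnd (fun n => (nsnd n)%:R - ratn (nfst n) +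
    C%:R * 2 * 2 ^- nsnd n) mK K0 G0 hG.
  have hs : computable nsnd := computable_snd computable_id.
  have hQ : crat (fun n => (nsnd n)%:R - ratn (nfst n) + C%:R * 2 * 2 ^- nsnd n) by computability.
  move=> /(_ hs hQ) h.
  have h' : ce (fun n => exists m, ((ratr (m%:R - ratn n + C%:R * 2 * 2 ^- m))%:E <
      \int[nu]_(z in K) G m z)%E).
    by apply: (@ce_ex (fun n m => ((ratr (m%:R - ratn n + C%:R * 2 * 2 ^- m))%:E <
      \int[nu]_(z in K) G m z)%E)).
  apply: eq_ce h' => n.
  have GE m : (\int[nu]_(z in K) G m z = (m%:R - \sum_(i < m) y i)%:E)%E.
    have m1a i : measurable_fun K (fun z : borel X => (1 - a i z)%:E).
      apply/measurable_EFinP/measurable_funB; first exact: measurable_cst.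
      by apply/measurable_EFinP; exact: (ma i).
    rewrite ge0_integral_sum //; last first.
      by move=> j z Kz; rewrite lee_fin subr_ge0; case/andP: (a01 j _ Kz).
    have yi i : (\int[nu]_(z in K) (1 - a i z)%:E = (1 - y i)%:E)%E.
      by rewrite (integral_onem mK K0 (ma i)) ?yE //; exact: a01.
    rewrite (eq_bigr (fun i : 'I_m => (1 - y i)%:E)) // sumEFin sumrB.
    by rewrite sumr_const card_ord.
  have QE k : ratr (k%:R - ratn n + C%:R * 2 * 2 ^- k) =
      k%:R - ratr (ratn n) + C%:R * 2 * 2 ^- k :> R.
    by rewrite rmorphD rmorphB !rmorphM /= ratr_exp2V !ratr_nat.
  split=> [[m]|cn].
    by rewrite GE QE lte_fin; have := c2 m; lra.
  have d0 : 0 < C%:R * 2 + 1 :> R by rewrite ltr_wpDl // mulr_ge0.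
  have e0 : 0 < (ratr (ratn n) - c) / (C%:R * 2 + 1) by rewrite divr_gt0 ?subr_gt0.
  have [m _ hm] := near_infty_natSinv_expn_lt (PosNum e0).
  exists m; rewrite GE QE lte_fin; have := c1 m.
  have := hm m (leqnn m); rewrite /= div1r ltr_pdivlMr // mulrDr mulr1.
  rewrite [2 ^- m * _]mulrC.
  have : 0 < 2 ^- m :> R by rewrite invr_gt0 exprn_gt0.
  by move=> *; lra.
have tg : schnorr_test s nu 1 g.
  split=> //.
  - have h := elsc_lt hg (computable_const 0) (crat_ratn computable_id).
    have [f hf fg] := eopen_names polish h.
    exists f => //; split=> [z|k]; first by apply: lt_le_trans (g0 z); rewrite ltNyr.
    by apply/seteqP; split=> z /fg; exact.
  - exists c => //; rewrite Lnorm1.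
    by rewrite -intg; apply: eq_integral => z _; rewrite gee0_abs.
have gx := SRx g tg.
apply: contrapT => /forallNP h; move: gx; apply/negP; rewrite -leNgt.
(* Every further index with [a i x >= 1] raises the partial sums by at least 1. *)
have big N : exists m, (N%:R%:E <= \sum_(i < m) L i x)%E.
  elim: N => [|N [m hm]]; first by exists 0; rewrite big_ord0.
  have [i] : exists i, ~ ((m <= i)%N -> a i x < 1).
    by apply: contrapT => /forallNP h'; apply: (h m) => i; apply: contrapT.
  move=> /not_implyP[mi /negP]; rewrite -leNgt => ai.
  exists i.+1; rewrite big_ord_recr /= -natr1 EFinD leeD //; last by rewrite LE.
  apply: (le_trans hm).
  by rewrite -!(big_mkord xpredT (fun i => L i x)); exact: lee_sum_nneg_natr.
rewrite leye_eq; apply/eqP/eq_infty => r; have [m hm] := big (Num.truncn r).+1.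
apply: (@le_trans _ _ (Num.truncn r).+1%:R%:E).
  by rewrite lee_fin ltW // truncnS_gt.
apply: (le_trans hm); rewrite -(big_mkord xpredT (fun i => L i x)).
exact: nneseries_lim_ge.
Qed.

End BorelCantelli.

(** * Schnorr randoms are Kurtz random *)

Lemma prog_code_inj : injective prog_code.
Proof.
elim=> [||||| p1 h1 p2 h2| p1 h1 p2 h2| p1 h1 p2 h2| p1 h1] [||||| q1 q2| q1 q2| q1 q2| q1];
  move=> /= /npair_inj[] //.
- by move=> _ /npair_inj[/h1 -> /h2 ->].
- by move=> _ /npair_inj[/h1 -> /h2 ->].
- by move=> _ /npair_inj[/h1 -> /h2 ->].
- by move=> _ /h1 ->.
Qed.

Lemma run_fun o p a b b' : run o p a b -> run o p a b' -> b = b'.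
Proof.
elim: p a b b' => [||||| p1 h1 p2 h2| p1 h1 p2 h2| p1 h1 p2 h2| p1 h1] a b b' /=;
  try by move=> -> ->.
- move=> [u [v [ru rv ->]]] [u' [v' [ru' rv' ->]]].
  by rewrite (h1 _ _ _ ru ru') (h2 _ _ _ rv rv').
- by move=> [u ru rb] [u' /(h2 _ _ _ ru) <- rb']; exact: h1 rb rb'.
- move=> [v [v0 vS ->]] [v' [v0' vS' ->]].
  have : (nsnd a <= nsnd a)%N by [].
  move: {1 3 4}(nsnd a) => i; elim: i => [|i IH] ia; first exact: h1 v0 v0'.
  have := vS' i ia; rewrite -(IH (ltnW ia)) => r'.
  exact: h2 (vS i ia) r'.
- move=> [r0 hlt] [r0' hlt'].
  case: (ltngtP b b') => // h.
    by have [v rv] := hlt' _ h; have := h1 _ _ _ rv r0.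
  by have [v rv] := hlt _ h; have := h1 _ _ _ rv r0'.
Qed.

Section KurtzRandom.
Variables (R : realType) (X : completeMetricType R) (s : nat -> X).
Variable nu : probability (borel X) R.

(** Indexing by program codes exhibits [KR] as a countable intersection of open sets of full
    measure. Codes and runs are unambiguous, so each [full c] has at most one element; [V c] is that
    set, or the whole space if there is none. *)
Let full (c : nat) : set (set X) := [set U | exists p g,
  [/\ prog_code p = c, computes p g, U = listed (basic_ball s) g & nu U = 1%E]].

Let full_unique c U U' : full c U -> full c U' -> U = U'.
Proof.
move=> [p [g [pc pg -> _]]] [p' [g' [pc' pg' -> _]]].
have pp' : p = p' by apply: prog_code_inj; rewrite pc.
subst p'; congr listed; apply/funext => a; exact: run_fun (pg a) (pg' a).
Qed.

Let V c := xget setT (full c).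

Let VP c : open (V c) /\ nu (V c) = 1%E.
Proof.
rewrite /V; case: xgetP => [U _ [p [g [_ _ -> h]]]|_]; first by split=> //; exact: open_listed.
by split; [exact: openT|exact: probability_setT].
Qed.

Let KR_bigcap : KR s nu = \bigcap_c V c.
Proof.
apply/seteqP; split=> x Kx.
  move=> c _; rewrite /V; case: xgetP => // U _ [p [g [_ pg -> h]]].
  by apply: Kx => //; exists g => //; exists p.
move=> U [g [p pg] gU] nuU; have := Kx (prog_code p) I; rewrite /V.
have fU : full (prog_code p) U by exists p, g.
case: xgetP => [U' _ fU'|/(_ U)]; last by [].
by rewrite (full_unique fU' fU).
Qed.

Lemma measurable_KR : measurable (KR s nu : set (borel X)).
Proof.
rewrite KR_bigcap; apply: bigcapT_measurable => c.
by apply: measurable_open; case: (VP c).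
Qed.

Lemma measure_setC_KR : nu (~` KR s nu) = 0%E.
Proof.
rewrite KR_bigcap setC_bigcap; apply/eqP; rewrite eq_le measure_ge0 andbT.
have mV c : measurable (V c : set (borel X)) by apply: measurable_open; case: (VP c).
have h : nu.-negligible (\bigcup_c ~` V c).
  apply: negligible_bigcup => c; apply/negligibleP; first exact: measurableC.
  by have := probability_setC nu (mV c); rewrite (VP c).2 subee // => h; exact: h.
move/negligibleP : h => -> //; apply: bigcup_measurable => c _; exact: measurableC.
Qed.

Local Notation eopen := (eopen s).
Hypothesis polish : computable_polish s.
Hypothesis cnu : computable_measure s nu.

(** For [U] c.e. open of measure 1, the functions [th m] are computable with values in [0,1], vanish
    off [U], and are eventually 1 at each point of [U]. Hence computable levels [t i] exist at which
    the integral exceeds [1 - 2^-i]. Outside [U] the functions [1 - th (t i)] are constantly 1,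
    which the effective Borel-Cantelli lemma forbids at a Schnorr random point. *)
Lemma SR_sub_KR : SR s nu `<=` KR s nu.
Proof.
move=> x SRx U [g hg gU] nuU; rewrite gU in nuU *; apply: contrapT => Ux.
(* The depth of [y] inside the ball listed at position [l], positive exactly in its interior; an
   entry that lists nothing gets 0. *)
pose v (l : nat) (y : X) : R :=
  if (g l == 0)%N then 0 else ball_rad _ (g l).-1 - mdist (s (nfst (g l).-1)) y.
have hv : ecomp s setT v.
  have hQ1 : crat (fun m => posratn (nsnd (g (nfst m)).-1) - ratn (nsnd m)) by computability.
  have hQ2 : crat (fun m => posratn (nsnd (g (nfst m)).-1) + ratn (nsnd m)) by computability.
  have hg' : computable (fun m => nfst (g (nfst m)).-1) by computability.
  have h1 := eopen_dist_lt polish setT hg' hQ1.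
  have h2 := eopen_dist_gt polish setT hg' hQ2.
  split.
    apply: (@eq_eopen _ _ _ _ (fun m y => (((g (nfst m) == 0)%N /\ ratn (nsnd m) < 0) \/
      ((g (nfst m) != 0)%N /\ mdist (s (nfst (g (nfst m)).-1)) y <
        ratr (posratn (nsnd (g (nfst m)).-1) - ratn (nsnd m)))))); last by effective_open.
    move=> m y _; rewrite /v /ball_rad rmorphB /=; case: eqP => _; rewrite ?ltrq0.
      by split=> [[[]|[]]|] //; left.
    by split=> [[[]|[_]]|h] //; [lra|right; split=> //; lra].
  apply: (@eq_eopen _ _ _ _ (fun m y => (((g (nfst m) == 0)%N /\ ratn (nsnd m) < 0) \/
    ((g (nfst m) != 0)%N /\ ratr (posratn (nsnd (g (nfst m)).-1) + ratn (nsnd m)) <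
        mdist (s (nfst (g (nfst m)).-1)) y)))); last by effective_open.
  move=> m y _; rewrite /v /ball_rad rmorphD /=; case: eqP => _; rewrite ?oppr0 ?ltrq0.
    by split=> [[[]|[]]|] //; left.
  by split=> [[[]|[_]]|h] //; [lra|right; split=> //; lra].
pose th m y := Num.min (ratr 1) (bmax (v^~ y) m / ratr (m.+1%:R^-1)) : R.
have hth : ecomp s setT th.
  apply: ecomp_min; first by apply: ecomp_ratr; computability.
  apply: ecomp_div; [by computability|by move=> n; rewrite invr_gt0|].
  apply: (ecomp_bmax (a := fun _ j => v j)); last by computability.
  exact: (ecomp_comp hv (computable_snd computable_id)).
have th01 m y : 0 <= th m y <= 1.
  rewrite /th rmorph1 le_min ler01 ge_min lexx /= andbT.
  by rewrite divr_ge0 ?bmax_ge0 // ler0q invr_ge0.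
have cE m : ratr (m.+1%:R^-1) = m.+1%:R^-1 :> R by rewrite fmorphV rmorph_nat.
have thE y : listed (basic_ball s) g y -> exists N, forall m, (N <= m)%N -> th m y = 1.
  move=> /listedP[i [k [gi]]]; rewrite basic_ballE => h.
  have vi : 0 < v i y by rewrite /v gi /=; lra.
  exists (maxn i.+1 (Num.truncn (v i y)^-1)) => m; rewrite geq_max => /andP[im m2].
  rewrite /th rmorph1; apply/min_idPl; rewrite cE invrK.
  have b1 := le_bmax (v^~ y) im.
  have : (v i y)^-1 < m.+1%:R by apply: lt_le_trans (truncnS_gt _) _; rewrite ler_nat.
  rewrite -(ltr_pM2l vi) mulfV ?gt_eqF // => /ltW /le_trans; apply.
  by rewrite ler_wpM2r.
have mth m : measurable_fun setT (fun y : borel X => (th m y)%:E).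
  have h : elsc s setT (fun n z => (th n z)%:E) by apply/elscEFin; case: hth.
  exact (@elsc_measurable _ _ _ polish [set: borel X] (fun n z => (th n z)%:E) m measurableT h).
have th0 m y : (0 <= (th m y)%:E)%E by rewrite lee_fin; case/andP: (th01 m y).
have tot i : exists m, ((ratr (1 - 2 ^- i))%:E < \int[nu]_(y in setT) (th m y)%:E)%E.
  apply: contrapT => /forallNP h.
  have mD : measurable (listed (basic_ball s) g : set (borel X)).
    by apply: measurable_open; exact: open_listed.
  have mthD m : measurable_fun (listed (basic_ball s) g : set (borel X)) (fun y => (th m y)%:E).
    exact: measurable_funTS.
  have := fatou nu mD mthD (fun m y _ => th0 m y).
  rewrite (eq_integral (cst 1%E)) => [|y /[!inE] /thE[N hN]]; last first.
    apply/eqP; rewrite eq_le; apply/andP; split.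
      by apply: limn_einf_le => m; rewrite lee_fin; case/andP: (th01 m y).
    by apply: (@le_limn_einf _ _ _ N) => m /hN ->.
  rewrite integral_cst // mul1e => hF.
  have : (nu (listed (basic_ball s) g) <= _)%E := hF; rewrite nuU; apply/negP; rewrite -ltNge.
  apply: (@le_lt_trans _ _ (1 - 2 ^- i)%:E).
    apply: limn_einf_le => m.
    apply: (@le_trans _ _ (\int[nu]_(y in setT) (th m y)%:E)%E).
      by apply: ge0_subset_integral => //; exact: measurableT.
    have := h m; rewrite rmorphB rmorph1 /= ratr_exp2V => /negP; by rewrite -leNgt.
  by rewrite lte_fin ltrBlDr ltrDl invr_gt0 exprn_gt0.
have [t ht tP] : exists2 t, computable t & forall i,
    ((ratr (1 - 2 ^- i))%:E < \int[nu]_(y in setT) (th (t i) y)%:E)%E.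
  apply: (@ce_select (fun i m => ((ratr (1 - 2 ^- i))%:E <
    \int[nu]_(y in setT) (th m y)%:E)%E) _ tot).
  have h : elsc s setT (fun n z => (th n z)%:E) by apply/elscEFin; case: hth.
  have hQ : crat (fun m => 1 - 2 ^- nfst m) by computability.
  apply: (ce_integral_gt polish cnu measurableT _ _ h (computable_snd computable_id) hQ).
    by rewrite setCT measure0.
  by move=> n y _; exact: th0.
(* Used with the whole space as [K], since membership of [x] in [KR] is what is being proved. *)
have [||||I hI] := @borel_cantelli _ _ _ _ polish cnu setT (fun i y => 1 - th (t i) y)
   1 measurableT _ _ _ _ x SRx I.
- by rewrite setCT measure0.
- apply: (@eq_ecomp _ _ _ _ (fun n y => ratr 1 - th (t n) y)).
    by move=> n y _; rewrite rmorph1.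
  apply: ecomp_sub; first by apply: ecomp_ratr; computability.
  exact: ecomp_comp.
- by move=> n y _; have /andP[] := th01 (t n) y; move=> *; apply/andP; split; lra.
- move=> n; rewrite (@integral_onem _ _ nu setT (th (t n))) ?setCT ?measure0 //.
  have := tP n; rewrite rmorphB rmorph1 /= ratr_exp2V => h.
  apply: (@le_trans _ _ (1 - (1 - 2 ^- n)%:E)%E); first by apply: leeB => //; exact: ltW.
  by rewrite -EFinB lee_fin mul1r opprB addrC subrK.
have := hI I (leqnn I).
suff -> : th (t I) x = 0 by rewrite subr0 ltxx.
suff b0 : bmax (v^~ x) (t I) = 0 by rewrite /th b0 mul0r rmorph1 min_r // ler01.
apply/eqP; rewrite eq_le bmax_ge0 andbT; apply: bmax_le => // l _.
rewrite /v; case: eqP => // gl; rewrite subr_le0 leNgt; apply/negP => h; apply: Ux.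
by apply/listedP; exists l, (g l).-1; rewrite basic_ballE prednK ?lt0n //; apply/eqP.
Qed.

End KurtzRandom.

(** * Algebras of sets *)

Section AlgebraForcing.
Variables P N : nat -> nat -> Prop.

(** Ball [k] is forced into the set ([b] true) or into its complement ([b] false). Complements flip
    the polarity, so both kinds of information are built positively from [P] and [N] and neither is
    inferred from a lack of the other. *)
Fixpoint forces (b : bool) (e : alg_term) (k : nat) : Prop :=
  match e with
  | AAtom j => if b then P j k else N j k
  | ACompl e1 => forces (~~ b) e1 k
  | AUnion e1 e2 => if b then forces b e1 k \/ forces b e2 k
                    else forces b e1 k /\ forces b e2 k
  end.

Let stepP wp wn k c :=
  (nfst c = 0%N /\ P (nsnd c) k) \/ (nfst c = 1%N /\ lookup wn (nsnd c) = 1%N) \/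
  (nfst c = 2%N /\ (lookup wp (nfst (nsnd c)) = 1%N \/ lookup wp (nsnd (nsnd c)) = 1%N)).

Let stepN wp wn k c :=
  (nfst c = 0%N /\ N (nsnd c) k) \/ (nfst c = 1%N /\ lookup wp (nsnd c) = 1%N) \/
  (nfst c = 2%N /\ lookup wn (nfst (nsnd c)) = 1%N /\ lookup wn (nsnd (nsnd c)) = 1%N).

(* [forces] on the codes of terms is c.e. because it is witnessed by a finite
   table of the codes that are claimed to be forced. *)
Let table c k wp wn := forall c', (c' < c.+1)%N ->
  ((lookup wp c' != 1%N) \/ stepP wp wn k c') /\ ((lookup wn c' != 1%N) \/ stepN wp wn k c').

(** The induction is on terms, not on codes, so it suffices that codes of subterms are not larger
    than that of the term. Entries at numbers that code no term are harmless. *)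
Let table_sound c k wp wn : table c k wp wn -> forall e, (alg_code e <= c)%N ->
  (lookup wp (alg_code e) = 1%N -> forces true e k) /\
  (lookup wn (alg_code e) = 1%N -> forces false e k).
Proof.
move=> tb; elim=> [j|e1 IH1|e1 IH1 e2 IH2] /= ec.
- have [h1 h2] := tb _ ec; rewrite /stepP /stepN !(nfstK, nsndK) in h1 h2.
  split=> [w|w]; [case: h1|case: h2]; rewrite ?w ?eqxx //;
    by case=> [[]|[[]|[]]].
- have [h1 h2] := tb _ ec; rewrite /stepP /stepN !(nfstK, nsndK) in h1 h2.
  have [g1 g2] := IH1 (leq_trans (leq_npairr _ _) ec).
  split=> [w|w]; [case: h1|case: h2]; rewrite ?w ?eqxx //;
    by case=> [[]|[[_]|[]]].
- have [h1 h2] := tb _ ec; rewrite /stepP /stepN !(nfstK, nsndK) in h1 h2.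
  have ec2 := leq_trans (leq_npairr _ _) ec.
  have [g1 g2] := IH1 (leq_trans (leq_npairl _ _) ec2).
  have [g3 g4] := IH2 (leq_trans (leq_npairr _ _) ec2).
  split=> [w|w]; [case: h1|case: h2]; rewrite ?w ?eqxx //.
    by case=> [[]|[[]|[_ [/g1|/g3]]]] //; [left|right].
  by case=> [[]|[[]|[_ [/g2 ? /g4 ?]]]].
Qed.

Let table_complete c k : exists wp wn, table c k wp wn /\
  forall e, (alg_code e <= c)%N -> forces true e k -> lookup wp (alg_code e) = 1%N.
Proof.
(* The witnessing table is the true one: it marks exactly the codes of forced terms. *)
pose f b c' : nat := `[< exists2 e, alg_code e = c' & forces b e k >].
have f1 b c' : f b c' = 1%N <-> exists2 e, alg_code e = c' & forces b e k.
  by rewrite /f; case: asboolP.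
have [wp hp] := lookup_exists c.+1 (f true); have [wn hn] := lookup_exists c.+1 (f false).
have fe b e : forces b e k -> f b (alg_code e) = 1%N by move=> h; apply/f1; exists e.
exists wp, wn; split=> [c' c'c|e ec h]; last by rewrite hp //; exact: fe.
rewrite hp // hn //; split.
- have [h|] := pselect (f true c' = 1%N); last by move=> /eqP ?; left.
  right; move/f1: h => [e ec]; subst c'; rewrite /stepP; case: e c'c => [j|e1|e1 e2] /= c'c;
    rewrite !(nfstK, nsndK); first by left.
    have := leq_trans (leq_npairr _ _) c'c => lt1.
    by move=> /fe h; right; left; rewrite hn.
  have lt1 := leq_ltn_trans (leq_npairr _ _) c'c.
  have lt2 := leq_ltn_trans (leq_npairl _ _) lt1.
  have lt3 := leq_ltn_trans (leq_npairr _ _) lt1.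
  by move=> h; right; right; split=> //; rewrite !hp //; case: h => /fe; [left|right].
- have [h|] := pselect (f false c' = 1%N); last by move=> /eqP ?; left.
  right; move/f1: h => [e ec]; subst c'; rewrite /stepN; case: e c'c => [j|e1|e1 e2] /= c'c;
    rewrite !(nfstK, nsndK); first by left.
    have lt1 := leq_ltn_trans (leq_npairr _ _) c'c.
    by move=> /fe h; right; left; rewrite hp.
  have lt1 := leq_ltn_trans (leq_npairr _ _) c'c.
  have lt2 := leq_ltn_trans (leq_npairl _ _) lt1.
  have lt3 := leq_ltn_trans (leq_npairr _ _) lt1.
  by move=> [h1 h2]; right; right; rewrite !hn //; split=> //; split; exact: fe.
Qed.

Lemma ce_forces (e : nat -> alg_term) : computable (fun n => alg_code (e n)) ->
  ce (fun m => P (nfst m) (nsnd m)) -> ce (fun m => N (nfst m) (nsnd m)) ->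
  ce (fun m => forces true (e (nfst m)) (nsnd m)).
Proof.
set ec := (fun n => alg_code (e n)) => hec hP hN.
apply: (@eq_ce (fun m => exists wp wn, lookup wp (ec (nfst m)) = 1%N /\
   table (ec (nfst m)) (nsnd m) wp wn)) => [m|].
  split=> [[wp [wn [w tb]]]|h].
    exact: (table_sound tb (leqnn _)).1 w.
  have [wp [wn [tb cl]]] := table_complete (ec (nfst m)) (nsnd m).
  by exists wp, wn; split=> //; exact: cl.
rewrite /table /stepP /stepN; computability.
Qed.

End AlgebraForcing.

Section EffectiveAlgebra.
Variables (R : realType) (X : completeMetricType R) (s : nat -> X).

(** The induction treats a set and its complement together, and complementation swaps the two
    claims: on [K] the basis is effectively clopen, hence so is the algebra. *)
Lemma eopen_alg_set (K : set X) (B : nat -> set X) (e : nat -> alg_term) :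
  eopen s K B -> eopen s K (fun j x => ~ B j x) ->
  computable (fun n => alg_code (e n)) ->
  eopen s K (fun n => alg_set B (e n)).
Proof.
move=> [P hP PB] [N hN NB] he; exists (fun n k => forces P N true (e n) k).
  exact: ce_forces.
move=> n; suff H b (e' : alg_term) :
   (forall k x, forces P N b e' k -> basic_ball s k x -> K x ->
       if b then alg_set B e' x else ~ alg_set B e' x) /\
   (forall x, K x -> (if b then alg_set B e' x else ~ alg_set B e' x) ->
     exists2 d, 0 < d & forall k, basic_ball s k x -> ball_rad R k < d ->
        forces P N b e' k) by exact: (H true).
elim: e' b => [j|e1 IH1|e1 IH1 e2 IH2] b /=.
- by case: b; [exact: PB|exact: NB].
- have [h1 h2] := IH1 (~~ b); split.
    by move=> k x hf Bk Kx; have := h1 k x hf Bk Kx; case: b {h1 h2 hf} => //= h nh; exact: nh.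
  move=> x Kx hx; apply: h2 => //; case: b {h1} hx => //= h.
  exact: contrapT.
- have [h1 h2] := IH1 b; have [h3 h4] := IH2 b; split.
    move=> k x hf Bk Kx; case: b {IH1 IH2 h2 h4} hf h1 h3 => hf h1 h3.
      by case: hf => hf; [left; exact: h1 Bk Kx|right; exact: h3 Bk Kx].
    by case: hf => hf1 hf2 [|]; [exact: h1 Bk Kx|exact: h3 Bk Kx].
  move=> x Kx; case: b h2 h4 {IH1 IH2 h1 h3} => h2 h4.
    case=> [/(h2 _ Kx)|/(h4 _ Kx)] [d d0 hd]; exists d => // k Bk kd; [left|right];
    exact: hd.
  move=> /not_orP[/(h2 _ Kx)[d d0 hd] /(h4 _ Kx)[d' d'0 hd']].
  exists (Num.min d d'); first by rewrite lt_min d0.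
  by move=> k Bk; rewrite lt_min => /andP[? ?]; split; [exact: hd|exact: hd'].
Qed.

End EffectiveAlgebra.

(** * Filtrations and disintegrations *)

Section Atoms.
Variables (R : realType) (X : completeMetricType R).

Lemma measurable_alg_set (B : nat -> set X) e : (forall j, open (B j)) ->
  measurable (alg_set B e : set (borel X)).
Proof.
move=> oB; elim: e => [j|e IH|e1 IH1 e2 IH2] /=; first exact: measurable_open.
  exact: measurableC.
exact: measurableU.
Qed.

(** The sets that do not separate [x] from [y] form a sigma-algebra, so it is enough to test
    generators. Countably many of these make the atom a Borel set. *)
Lemma atom_class_generated (A : nat -> set X) x :
  atom_class <<s range A >> x = \bigcap_m (if `[< A m x >] then A m else ~` A m).
Proof.
apply/seteqP; split=> y.
  move=> h m _; have := h (A m).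
  have /[swap]/[apply] : <<s range A >> (A m) by apply: sub_sigma_algebra; exists m.
  by case: asboolP => Ax [h1 h2]; [exact: h1|move=> /h2].
move=> h S; pose G := [set S : set X | S x <-> S y].
have GS : sigma_algebra setT G.
  split=> [//|S' GS'|S' GS'].
    by split=> -[_ h1]; split=> // h2; apply: h1; apply/GS'.
  by split=> -[i _ h1]; exists i => //; exact/GS'.
move=> hS; apply: (hS G); split=> // _ [m _ <-]; have := h m I; rewrite /G /=.
by case: asboolP.
Qed.

Lemma measurable_atom_class (A : nat -> set X) x :
  (forall m, measurable (A m : set (borel X))) ->
  measurable (atom_class <<s range A >> x : set (borel X)).
Proof.
move=> mA; rewrite atom_class_generated; apply: bigcapT_measurable => m.
by case: asboolP => _ //; exact: measurableC.
Qed.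

Lemma generated_sub_borel (A : nat -> set X) : (forall m, measurable (A m : set (borel X))) ->
  <<s range A >> `<=` (measurable : set (set (borel X))).
Proof.
move=> mA S; apply; split; last by move=> _ [m _ <-]; exact: mA.
exact: sigma_algebra_measurable.
Qed.

End Atoms.

(** * Doob's maximal inequality for a nonnegative function *)

Section MaximalInequality.
Variables (R : realType) (d : measure_display) (T : measurableType d).
Variable mu : {measure set T -> \bar R}.
Variable F : nat -> set (set T).
Hypothesis F_sigma : forall n, sigma_algebra setT (F n).
Hypothesis F_measurable : forall n S, F n S -> measurable S.
Hypothesis F_mono : forall n, F n `<=` F n.+1.
Variables (h : T -> \bar R) (g : nat -> T -> \bar R).
Hypothesis h0 : forall x, (0 <= h x)%E.
Hypothesis mh : measurable_fun setT h.
Hypothesis mg : forall n, measurable_fun setT (g n).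
Hypothesis Fg : forall n E, measurable E -> F n (g n @^-1` E).
Hypothesis gh : forall n S, F n S -> (\int[mu]_(x in S) g n x = \int[mu]_(x in S) h x)%E.
Variable r : R.
Hypothesis r0 : 0 <= r.

Let E n := [set x | (r%:E < g n x)%E].
Let G M := \bigcup_(n in [set n | (n < M)%N]) E n.

Let FU n A B : F n A -> F n B -> F n (A `|` B).
Proof.
move=> FA FB; have [F0 FC Fb] := F_sigma n.
rewrite -bigcup2E; apply: Fb => -[|[|i]] //=.
Qed.

Let FC n A : F n A -> F n (~` A).
Proof. by move=> FA; have [_ FC _] := F_sigma n; rewrite -setTD; exact: FC. Qed.

Let FI n A B : F n A -> F n B -> F n (A `&` B).
Proof.
by move=> FA FB; rewrite -(setCK (A `&` B)) setCI; apply: FC; apply: FU; exact: FC.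
Qed.

Let F_le m n : (m <= n)%N -> F m `<=` F n.
Proof.
by move=> /subnKC <-; elim: (n - m)%N => [|k IH]; rewrite ?addn0 // addnS => S /IH /F_mono.
Qed.

Let FE n : F n (E n).
Proof.
have -> : E n = g n @^-1` `]r%:E, +oo[%classic by rewrite preimage_itvoy.
by apply: Fg; exact: emeasurable_itv.
Qed.

Let GS M : G M.+1 = G M `|` (E M `&` ~` G M).
Proof.
apply/seteqP; split=> x.
  move=> [n /= nM Ex]; have [Gx|Gx] := pselect (G M x); [by left|right; split=> //].
  move: nM; rewrite ltnS leq_eqVlt => /orP[/eqP <- //|nM].
  by exfalso; apply: Gx; exists n.
by move=> [[n /= nM Ex]|[Ex _]]; [exists n => //=; exact: leqW|exists M => /=].
Qed.

Let FG M : F M (G M).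
Proof.
elim: M => [|M IH].
  have -> : G 0 = set0 by rewrite /G bigcup0.
  by case: (F_sigma 0).
by rewrite GS; apply: F_mono; apply: FU => //; apply: FI => //; exact: FC.
Qed.

(* Splits according to the first index [n] with [r < g n]. *)
Lemma filtration_maximal_inequality M :
  (r%:E * mu [set x | exists2 n, (n < M)%N & (r%:E < g n x)%E] <= \int[mu]_x h x)%E.
Proof.
have -> : [set x | exists2 n, (n < M)%N & (r%:E < g n x)%E] = G M.
  by apply/seteqP; split=> x [n nM Ex]; exists n.
have mG n : measurable (G n) by exact: F_measurable (FG n).
apply: (@le_trans _ _ (\int[mu]_(x in G M) h x)%E); last first.
  by apply: ge0_subset_integral => //; exact: mG.
elim: M => [|M IH].
  have -> : G 0 = set0 by rewrite /G bigcup0.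
  by rewrite measure0 mule0 integral_set0.
(* The points where [M] is the first index form a set of [F M], on which the integral of [h] equals
   that of [g M], and there [g M] exceeds [r]. *)
have FD : F M (E M `&` ~` G M) by apply: FI => //; exact: FC.
have mD := F_measurable FD.
have dis : G M `&` (E M `&` ~` G M) = set0.
  by apply/seteqP; split=> // x [Gx [_ nGx]].
rewrite GS measureU // ge0_integral_setU //; last 2 first.
- exact: measurable_funTS.
- by apply/disj_setPS; rewrite dis.
rewrite ge0_muleDr //; apply: leeD => //; rewrite -(gh FD).
rewrite -integral_cst //; apply: ge0_le_integral => //.
- exact: measurable_funTS.
- by move=> x [/ltW].
Qed.

End MaximalInequality.

Section FullMeasure.
Variables (R : realType) (d : measure_display) (T : measurableType d).
Variables (mu : {measure set T -> \bar R}) (A : set T).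
Hypotheses (mA : measurable A) (muT : mu setT = 1%E).

Let split : (1 = mu (~` A) + mu A)%E.
Proof. by rewrite -muT -setTD -[in X in (_ + X)%E](setTI A); exact: measureDI. Qed.

Lemma measure_setC0 : mu A = 1%E -> mu (~` A) = 0%E.
Proof.
move=> A1; move: split; rewrite A1 => /(congr1 (fun z => z - 1)%E).
by rewrite subee // addeK.
Qed.

Lemma measure_setC0_full : mu (~` A) = 0%E -> mu A = 1%E.
Proof. by move=> A0; rewrite split A0 add0e. Qed.

End FullMeasure.

Section Kernels.
Variables (R : realType) (X : completeMetricType R) (s : nat -> X).
Variables (nu : probability (borel X) R) (F : nat -> set (set X)).
Variable rho : nat -> X -> {finite_measure set (borel X) -> \bar R}.
Hypothesis polish : computable_polish s.
Hypothesis Frho : uniform_kurtz_disintegrations s nu F rho.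
Hypothesis matom : forall n x, measurable (atom_class (F n) x : set (borel X)).
Let K := KR s nu.
Let mK : measurable (K : set (borel X)) := measurable_KR s nu.

Lemma kurtz_atom n x : K x -> rho n x (~` (atom_class (F n) x `&` K)) = 0%E.
Proof.
move=> Kx; have [[_ _ /(_ x Kx)[h1 h2] _] _] := (Frho.1 n, Frho.2).
have mA : measurable (atom_class (F n) x `&` K : set (borel X)) by exact: measurableI.
exact: measure_setC0 mA h1 h2.
Qed.

Lemma kurtz_setC n x : K x -> rho n x (~` K) = 0%E.
Proof.
move=> Kx; apply: (subset_measure0 _ _ _ (kurtz_atom n Kx)).
- exact: measurableC.
- by apply: measurableC; exact: measurableI.
- by apply: subsetC => y [].
Qed.

Lemma kurtz_full n x : K x -> rho n x K = 1%E.
Proof.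
move=> Kx; have [_ _ /(_ x Kx)[h1 _] _] := Frho.1 n.
by apply: (measure_setC0_full mK h1); exact: kurtz_setC.
Qed.

Lemma ekernel_kurtz : ekernel s K (fun n x => rho n x).
Proof.
split; last exact: kurtz_setC.
move=> U hU; have [g hg gP] := uniform_eopen polish Frho.2 hU.
(* The nested slices take, from the outside, the index of the open set, the filtration index and the
   rational threshold; [m] carries the same data in another order. *)
have hg' : computable (fun m => g (npair (nsnd (nfst (nfst m)))
  (npair (nfst (nfst (nfst m))) (npair (nsnd (nfst m)) (nsnd m))))) by computability.
apply: eq_eopen (eopen_listed polish K hg') => m x _.
have [_ h] := gP (nsnd (nfst m)) (nfst (nfst m)).
have := h (nsnd m); rewrite /open_name => /seteqP[h1 h2].
have -> : slice (fun m => g (npair (nsnd (nfst (nfst m))) (npair (nfst (nfst (nfst m)))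
    (npair (nsnd (nfst m)) (nsnd m))))) m =
    slice (slice (slice g (nsnd (nfst m))) (nfst (nfst m))) (nsnd m).
  by apply/funext => i; rewrite /slice !(nfstK, nsndK).
by split=> [/h2|/h1].
Qed.

End Kernels.

(** * Step approximations *)

Section StepApproximations.
Variables (R : realType) (X : completeMetricType R) (s : nat -> X).
Variables (nu : probability (borel X) R) (F : nat -> set (set X)).
Variable rho : nat -> X -> {finite_measure set (borel X) -> \bar R}.
Hypothesis polish : computable_polish s.
Hypothesis cnu : computable_measure s nu.
Hypothesis Frho : uniform_kurtz_disintegrations s nu F rho.
Hypothesis matom : forall n x, measurable (atom_class (F n) x : set (borel X)).
Hypothesis F_sigma : forall n, sigma_algebra setT (F n).
Hypothesis F_measurable : forall n S, F n S -> measurable (S : set (borel X)).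
Hypothesis F_mono : forall n, F n `<=` F n.+1.
Local Notation K := (KR s nu).
Let mK : measurable (K : set (borel X)) := measurable_KR s nu.
Let K0 : nu (~` K) = 0%E := measure_setC_KR s nu.

Variables (D : nat -> set X) (q : nat -> rat) (idx bd : nat -> nat).
Hypothesis hD : eopen s K D.
Hypothesis hDC : eopen s K (fun i x => ~ D i x).
Hypothesis hq : crat q.
Hypothesis hidx : computable idx.
Hypothesis hbd : computable bd.
Hypothesis q_le : forall i, q i <= (bd i)%:R.
Hypothesis D_idx : forall i, F (idx i) (D i).

Let u i x : R := if `[< D i x >] then ratr (q i) else 0.

(* [step_max t] is the maximum of [0] and of the steps [q i] on [D i], [i < t];
   it is measurable for [F (step_level t)]. *)
Definition step_max t x : R := bmax (u^~ x) t.
(** Sums here and in [step_level] serve as computable upper bounds for the maxima over [i < t]. *)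
Definition step_bound t := (\sum_(i < t) bd i)%N.
Definition step_level t := (\sum_(i < t) idx i)%N.

Lemma computable_step_bound : computable step_bound.
Proof.
apply: (@computable_sum (fun n => n) (fun _ i => bd i)); first by computability.
exact: (computable_comp hbd (computable_snd computable_id)).
Qed.

Lemma computable_step_level : computable step_level.
Proof.
apply: (@computable_sum (fun n => n) (fun _ i => idx i)); first by computability.
exact: (computable_comp hidx (computable_snd computable_id)).
Qed.

Lemma step_level_mono t t' : (t <= t')%N -> (step_level t <= step_level t')%N.
Proof. by move=> /subnKC <-; rewrite /step_level big_split_ord leq_addr. Qed.

Lemma ecomp_step_max : ecomp s K step_max.
Proof.
have hu : ecomp s K u by exact: ecomp_indic.
apply: (@ecomp_bmax _ _ _ _ (fun _ i => u i)); last by computability.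
exact: (ecomp_comp hu (computable_snd computable_id)).
Qed.

Lemma step_max_ge0 t x : 0 <= step_max t x. Proof. exact: bmax_ge0. Qed.

Lemma step_max_mono t t' x : (t <= t')%N -> step_max t x <= step_max t' x.
Proof. exact: bmax_mono. Qed.

Lemma step_max_le t x : step_max t x <= (step_bound t)%:R.
Proof.
apply: bmax_le => // i it; rewrite /u; case: asboolP => // _.
apply: (@le_trans _ _ (bd i)%:R); first by rewrite -(ratr_nat R) ler_rat.
by rewrite ler_nat /step_bound (bigD1 (Ordinal it)) //= leq_addr.
Qed.

Lemma F_le m n : (m <= n)%N -> F m `<=` F n.
Proof.
by move=> /subnKC <-; elim: (n - m)%N => [|k IH]; rewrite ?addn0 // addnS => S /IH /F_mono.
Qed.

Lemma step_max_atom n t x y : (step_level t <= n)%N -> atom_class (F n) x y ->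
  step_max t y = step_max t x.
Proof.
move=> tn xy; rewrite /step_max.
have h i : (i < t)%N -> u i y = u i x.
  move=> it; have FD : F n (D i).
    apply: (F_le _ (D_idx i)); apply: leq_trans tn.
    by rewrite /step_level (bigD1 (Ordinal it)) //= leq_addr.
  by rewrite /u; have [h1 h2] := xy _ FD; case: asboolP => Dy; case: asboolP => Dx //;
    exfalso; [apply: Dx; exact: h2|apply: Dy; exact: h1].
elim: t h {tn} => //= t IH h; rewrite h // IH // => i it; apply: h; exact: leqW.
Qed.

Lemma measurable_step_max t : measurable_fun [set: borel X] (step_max t : borel X -> R).
Proof.
rewrite /step_max; elim: t => [|t IH] /=; first exact: measurable_cst.
apply: measurable_maxr => //.
have -> : u t = (fun x => ratr (q t) * \1_(D t) x).
  apply/funext => x; rewrite /u indicE; case: asboolP => h.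
    by rewrite mem_set // mulr1.
  by rewrite memNset // mulr0.
apply: measurable_funM => //; apply: measurable_indic.
exact: F_measurable (D_idx t).
Qed.

Lemma measurable_EFin_step_max (A : set (borel X)) t :
  measurable_fun A (fun y : borel X => (step_max t y)%:E).
Proof. by apply/measurable_EFinP; apply: measurable_funTS; exact: measurable_step_max. Qed.

Let phi0 t y : (0 <= (step_max t y)%:E)%E. Proof. by rewrite lee_fin step_max_ge0. Qed.

(** At points of [K] the integral is finite, the step function being bounded and [rho n x] a
    probability, so [fine] loses nothing there. *)
Definition cond_step n t x : R := fine (\int[rho n x]_(y in K) (step_max t y)%:E)%E.

Lemma cond_stepE n t x : K x ->
  (\int[rho n x]_(y in K) (step_max t y)%:E = (cond_step n t x)%:E)%E.
Proof.
move=> Kx; rewrite fineK // ge0_fin_numE ?integral_ge0 //.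
apply: (@le_lt_trans _ _ (\int[rho n x]_(y in K) (cst (step_bound t)%:R%:E) y)%E).
  apply: ge0_le_integral => //; first exact: measurable_EFin_step_max.
  by move=> y _; rewrite lee_fin step_max_le.
by rewrite integral_cst // (_ : _ K = 1%E) ?mule1 ?ltry //; exact: kurtz_full Frho matom _ _ Kx.
Qed.

Lemma cond_step_mono n t t' x : K x -> (t <= t')%N -> cond_step n t x <= cond_step n t' x.
Proof.
move=> Kx tt'; rewrite -lee_fin -!cond_stepE //; apply: ge0_le_integral => //.
- exact: measurable_EFin_step_max.
- exact: measurable_EFin_step_max.
- by move=> y _; rewrite lee_fin step_max_mono.
Qed.

Lemma cond_step_level n t x : K x -> (step_level t <= n)%N -> cond_step n t x = step_max t x.
Proof.
move=> Kx tn; apply/eqP; rewrite -eqe -cond_stepE //; apply/eqP.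
have mA : measurable (atom_class (F n) x `&` K : set (borel X)) by exact: measurableI.
have -> : (\int[rho n x]_(y in K) (step_max t y)%:E = \int[rho n x]_y (step_max t y)%:E)%E.
  apply/esym/ge0_integral_full => //; last exact: measurable_EFin_step_max.
  exact: kurtz_setC Frho matom _ _ Kx.
rewrite (ge0_integral_full mA) //; last 2 first.
- exact: kurtz_atom Frho matom _ _ Kx.
- exact: measurable_EFin_step_max.
rewrite (eq_integral (cst (step_max t x)%:E)) => [|y /[!inE] -[xy _]]; last first.
  by rewrite (step_max_atom tn xy).
rewrite integral_cst // (_ : _ (_ `&` _) = 1%E) ?mule1 //.
apply: measure_setC0_full => //; last exact: kurtz_atom Frho matom _ _ Kx.
by have [_ _ /(_ x Kx)[]] := Frho.1 n.
Qed.

(** Lower bounds come from integrating the step function, upper bounds from integrating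
    [step_bound t - step_max t], which is nonnegative and also lower semi-computable. The two
    integrals add up to [step_bound t] because [K] has mass 1. *)
Lemma ecomp_cond_step : ecomp s K (fun m => cond_step (nfst m) (nsnd m)).
Proof.
have hk := ekernel_kurtz polish Frho matom.
have [p1 p2] := ecomp_step_max; have hb := computable_step_bound; split.
  have h : elsc s K (fun t y => (step_max t y)%:E) by apply/elscEFin.
  have := elsc_integral polish mK hk (fun t y _ => phi0 t y) h.
  move=> hi; apply: (proj1 (elscEFin _ _ _)); apply: eq_elsc hi => m x Kx.
  by rewrite cond_stepE.
pose G t y := ratr (step_bound t)%:R + - step_max t y.
have GE t y : G t y = (step_bound t)%:R - step_max t y by rewrite /G ratr_nat.
have hG : relsc s K G.
  apply: (relsc_add (a := fun t _ => ratr (step_bound t)%:R)) => //.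
  by apply: relsc_ratr; computability.
have G0 t y : K y -> (0 <= (G t y)%:E)%E.
  by move=> _; rewrite lee_fin GE subr_ge0 step_max_le.
have := elsc_integral polish mK hk G0 (proj2 (elscEFin _ _ _) hG).
have GI n t x : K x ->
    (\int[rho n x]_(y in K) (G t y)%:E = ((step_bound t)%:R - cond_step n t x)%:E)%E.
  move=> Kx; rewrite EFinB -cond_stepE //.
  have mG : measurable_fun (K : set (borel X)) (fun y : borel X => (G t y)%:E).
    rewrite (_ : (fun y => _) = (fun y => ((step_bound t)%:R - step_max t y)%:E)).
      apply/measurable_EFinP/measurable_funB; first exact: measurable_cst.
      by apply: measurable_funTS; exact: measurable_step_max.
    by apply/funext => y; rewrite GE.
  have e : (\int[rho n x]_(y in K) (G t y)%:E + \int[rho n x]_(y in K) (step_max t y)%:E =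
      (step_bound t)%:R%:E)%E.
    rewrite -ge0_integralD //; [|exact: G0|exact: measurable_EFin_step_max].
    rewrite (eq_integral (cst (step_bound t)%:R%:E)) => [|y _]; last by rewrite -EFinD GE subrK.
    by rewrite integral_cst // (_ : _ K = 1%E) ?mule1 //; exact: kurtz_full Frho matom _ _ Kx.
  by rewrite -e addeK // cond_stepE.
move=> hi.
have h1 : relsc s K (fun m x => (step_bound (nsnd m))%:R - cond_step (nfst m) (nsnd m) x).
  by apply: (proj1 (elscEFin _ _ _)); apply: eq_elsc hi => m x Kx; rewrite GI.
have h2 : relsc s K (fun m _ => ratr (- (step_bound (nsnd m))%:R)) by apply: relsc_ratr; computability.
apply: eq_relsc (relsc_add h1 h2) => m x _.
by rewrite rmorphN /= ratr_nat addrAC subrr add0r.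
Qed.

Lemma integral_step_max_diff n t t' x : K x -> (t <= t')%N ->
  (\int[rho n x]_y (step_max t' y - step_max t y)%:E = (cond_step n t' x - cond_step n t x)%:E)%E.
Proof.
move=> Kx tt'.
have md (A : set (borel X)) :
    measurable_fun A (fun y : borel X => (step_max t' y - step_max t y)%:E).
  by apply/measurable_EFinP/measurable_funB; apply: measurable_funTS; exact: measurable_step_max.
have d0 y : (0 <= (step_max t' y - step_max t y)%:E)%E by rewrite lee_fin subr_ge0 step_max_mono.
rewrite (ge0_integral_full mK (kurtz_setC Frho matom n Kx)) //.
have e : (\int[rho n x]_(y in K) (step_max t' y - step_max t y)%:E +
    \int[rho n x]_(y in K) (step_max t y)%:E = \int[rho n x]_(y in K) (step_max t' y)%:E)%E.
  rewrite -ge0_integralD //; last exact: measurable_EFin_step_max.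
  by apply: eq_integral => y _; rewrite -EFinD subrK.
by rewrite EFinB -!cond_stepE // -e addeK // cond_stepE.
Qed.

Lemma measurable_cond_step n t : measurable_fun (K : set (borel X)) (cond_step n t : borel X -> R).
Proof.
have [h _] := ecomp_cond_step; apply/measurable_EFinP.
have h' := proj2 (elscEFin _ _ _) h.
have := @elsc_measurable _ _ _ polish K _ (npair n t) mK h'.
by rewrite nfstK nsndK.
Qed.

(** Let [GM] be the set where some conditional expectation exceeds [d]. The truncated integrand is
    at most 1 on [GM], whose measure the maximal inequality bounds by [d^-1] times the integral of
    the difference, and at most [c d] elsewhere. *)
Lemma cond_step_maximal t t' M (c d : R) : (t <= t')%N -> 0 <= c -> 0 < d ->
  (\int[nu]_(x in K) (Num.min 1 (c * bmax (fun n => cond_step n t' x - cond_step n t x)%R M))%:E <=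
   (c * d)%:E + (d^-1)%:E * (\int[nu]_x (step_max t' x - step_max t x)%:E))%E.
Proof.
move=> tt' c0 d0.
pose h (y : borel X) : \bar R := (step_max t' y - step_max t y)%:E.
have h0 y : (0 <= h y)%E by rewrite lee_fin subr_ge0 step_max_mono.
have mh : measurable_fun setT h.
  by apply/measurable_EFinP/measurable_funB; exact: measurable_step_max.
have ih : nu.-integrable setT h.
  apply/integrableP; split=> //.
  apply: (@le_lt_trans _ _ (\int[nu]_y (cst (step_bound t')%:R%:E) y)%E).
    apply: ge0_le_integral => //; first exact: measurableT_comp.
    move=> y _; rewrite gee0_abs // lee_fin (le_trans _ (step_max_le t' y)) //.
    by rewrite gerBl step_max_ge0.
  by rewrite integral_cst //= probability_setT mule1 ltry.
(* The maximal inequality needs functions measurable for [F n], and integrals against [rho] are such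
   only up to null sets. So genuine versions [g n] are chosen and compared almost everywhere
   afterwards. *)
have [g gP] := choice (fun n => let: And4 _ hv _ _ := Frho.1 n in hv h ih).
have mg n : measurable_fun setT (g n) by case: (gP n) => _ /measurable_int.
pose GM : set (borel X) := [set x | exists2 n, (n < M)%N & (d%:E < g n x)%E].
have hmax : (d%:E * nu GM <= \int[nu]_x h x)%E.
  have Fg n E : measurable E -> F n (g n @^-1` E).
    by move=> mE; case: (gP n) => h1 _ _ _; exact: h1.
  have gh n S : F n S -> (\int[nu]_(x in S) g n x = \int[nu]_(x in S) h x)%E.
    by move=> FS; case: (gP n) => _ _ h1 _; exact: h1.
  exact (@filtration_maximal_inequality R _ _ nu F F_sigma F_measurable F_mono h g h0 mh mg
    Fg gh d (ltW d0) M).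
have mGM : measurable GM.
  have -> : GM = \bigcup_(n in [set n | (n < M)%N]) [set x | (d%:E < g n x)%E].
    by apply/seteqP; split=> x [n nM Ex]; exists n.
  apply: bigcup_measurable => n _; rewrite -[X in measurable X]setTI.
  exact: emeasurable_fun_o_infty.
pose f2 (x : borel X) : \bar R := ((c * d)%:E + (\1_GM x)%:E)%E.
have b0 x : 0 <= bmax (fun n => cond_step n t' x - cond_step n t x)%R M by exact: bmax_ge0.
have mb : measurable_fun (K : set (borel X))
    (fun x : borel X => bmax (fun n => cond_step n t' x - cond_step n t x) M).
  elim: M {hmax mGM f2 b0 GM} => [|M IH] /=; first exact: measurable_cst.
  by apply: measurable_maxr => //; apply: measurable_funB; exact: measurable_cond_step.
apply: (@le_trans _ _ (\int[nu]_(x in K) f2 x)%E).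
  apply: ae_ge0_le_integral => //.
  - by move=> x _; rewrite lee_fin le_min ler01 mulr_ge0.
  - apply/measurable_EFinP; apply: measurable_minr; first exact: measurable_cst.
    by apply: measurable_funM => //; exact: measurable_cst.
  - by move=> x _; rewrite adde_ge0 // lee_fin // mulr_ge0 // ltW.
  - apply: emeasurable_funD; first exact: measurable_cst.
    by apply/measurable_EFinP; exact: measurable_indic.
  have := ae_foralln (fun n => let: And4 _ _ _ hae := gP n in hae).
  apply: filterS => x hx Kx; rewrite /f2 -EFinD lee_fin indicE.
  have [GMx|GMx] := pselect (GM x).
    rewrite mem_set //; apply: (@le_trans _ _ 1); first by rewrite ge_min lexx.
    by rewrite lerDr mulr_ge0 // ltW.
  rewrite memNset // addr0 ge_min; apply/orP; right; apply: ler_wpM2l => //.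
  apply: bmax_le => [|n nM]; first exact: ltW.
  rewrite leNgt; apply/negP => dn; apply: GMx; exists n => //.
  by rewrite -hx integral_step_max_diff // lte_fin.
have cd0 : 0 <= c * d by rewrite mulr_ge0 // ltW.
have mi : measurable_fun (K : set (borel X)) (fun x => (\1_GM x : R)%:E).
  by apply/measurable_EFinP; exact: measurable_indic.
rewrite ge0_integralD //.
apply: leeD.
  rewrite (integral_cst nu mK) [X in (_ * X)%E](_ : _ = 1%E) ?mule1 //.
  exact: probability_full mK K0.
rewrite integral_indic //; apply: (@le_trans _ _ (nu GM)).
  by apply: le_measure; rewrite ?inE //; exact: measurableI.
by rewrite lee_pdivlMl.
Qed.

End StepApproximations.

(** * Real powers *)

Section RealPowers.
Variable R : realType.
Implicit Types (r p Q : R).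

(** With exponent [(a+1)/(b+1)], raising to the power [b+1] leaves a comparison of integer powers,
    decidable for rational [r] and [Q]. *)
Lemma powR_gt_posratn r Q k : 0 <= r -> 0 <= Q ->
  (Q < r `^ ratr (posratn k)) = (Q ^+ (nsnd k).+1 < r ^+ (nfst k).+1).
Proof.
move=> r0 Q0.
have -> : r ^+ (nfst k).+1 = (r `^ ratr (posratn k)) ^+ (nsnd k).+1.
  rewrite -(powR_mulrn _ (powR_ge0 r _)) -powRrM -(powR_mulrn _ r0); congr (_ `^ _).
  rewrite -[(nsnd k).+1%:R](ratr_nat R) -rmorphM /= /posratn.
  by rewrite divfK ?pnatr_eq0 // ratr_nat.
by rewrite ltr_pXn2r // nnegrE ?powR_ge0.
Qed.

Lemma powR_gt_near r p Q : 0 < r -> 0 < p -> 0 <= Q -> Q < r `^ p ->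
  exists k l, [/\ ratr (posratn k) < p, p < ratr (posratn l),
    Q < r `^ ratr (posratn k) & Q < r `^ ratr (posratn l)].
Proof.
move=> r0 p0 Q0 Qr.
have powE s : r `^ s = expR (s * ln r) by rewrite /powR gt_eqF.
(* [Q] may be 0 and is replaced by a midpoint so that its logarithm makes sense; in [e] below, the
   added 1 covers [ln r = 0]. *)
pose Q' := (Q + r `^ p) / 2.
have rp : 0 < r `^ p by rewrite powR_gt0.
have Q'0 : 0 < Q' by rewrite /Q'; lra.
have QQ' : Q <= Q' by rewrite /Q'; lra.
have lQ : ln Q' < p * ln r.
  by rewrite -ltr_expR lnK ?posrE // -powE /Q'; lra.
pose e := (p * ln r - ln Q') / (`|ln r| + 1).
have d0 : 0 < `|ln r| + 1 by rewrite ltr_wpDl.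
have e0 : 0 < e by rewrite divr_gt0 // subr_gt0.
have near_p s : `|s - p| < e -> Q < r `^ s.
  move=> sp; apply: le_lt_trans QQ' _; rewrite powE -(lnK (x := Q')) ?posrE // ltr_expR.
  have h1 : `|(s - p) * ln r| <= `|s - p| * (`|ln r| + 1).
    by rewrite normrM ler_wpM2l // lerDl.
  have h2 : `|s - p| * (`|ln r| + 1) < p * ln r - ln Q' by rewrite -ltr_pdivlMr.
  have := le_lt_trans h1 h2; rewrite ltr_norml => /andP[h3 _].
  by rewrite mulrBl in h3; lra.
have [|k1 /andP[a1 a2]] := @ratn_between R (Num.max 0 (p - e)) p.
  by rewrite gt_max p0; lra.
have [|k2 /andP[a3 a4]] := @ratn_between R p (p + e); first by lra.
have [k kE] : exists k, posratn k = ratn k1.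
  by apply: posratn_surj; rewrite -(ltr0q R) (le_lt_trans _ a1) // le_max lexx.
have [l lE] : exists k, posratn k = ratn k2.
  by apply: posratn_surj; rewrite -(ltr0q R) (lt_trans p0).
exists k, l; rewrite kE lE; move: a1; rewrite gt_max => /andP[_ a1].
by split=> //; apply: near_p; rewrite ltr_norml; apply/andP; split; lra.
Qed.

(** Powers of [r] increase with the exponent if [r >= 1] and decrease if [r <= 1]. Testing rational
    exponents on both sides of [p] settles both cases without deciding which one holds. *)
Lemma powR_gt_between r p Q s1 s2 : 0 < r -> s1 < p -> p < s2 ->
  Q < r `^ s1 -> Q < r `^ s2 -> Q < r `^ p.
Proof.
move=> r0 s1p ps2 h1 h2; have [r1|r1] := leP 1 r.
  by apply: lt_le_trans h1 _; apply: ler_powR => //; exact: ltW.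
by apply: lt_le_trans h2 _; apply: ger_powR; rewrite ?r0 ?ltW.
Qed.

Lemma ce_powR_gt p (r Q : nat -> rat) : computable_real p -> 0 < p -> crat r -> crat Q ->
  ce (fun n => 0 < r n /\ ratr (Q n) < ratr (r n) `^ p).
Proof.
move=> hp p0 hr hQ.
pose lo k : Prop := ratr (posratn k) < p.
have hp1 : ce lo := ce_real_gtr hp (crat_posratn computable_id).
pose hi k : Prop := p < ratr (posratn k).
have hp2 : ce hi := ce_real_ltr hp (crat_posratn computable_id).
apply: (@eq_ce (fun n => 0 < r n /\ (Q n < 0 \/ exists k l,
  (lo k /\ hi l) /\
  (Q n ^+ (nsnd k).+1 < r n ^+ (nfst k).+1 /\
   Q n ^+ (nsnd l).+1 < r n ^+ (nfst l).+1)))); last by computability.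
move=> n; split=> -[r0]; have r0' : 0 < ratr (r n) :> R by rewrite ltr0q.
  move=> [Q0|[k [l [[h1 h2] [h3 h4]]]]]; split=> //.
    by apply: lt_le_trans (powR_ge0 _ _); rewrite ltrq0.
  have [Q0|Q0] := ltP (Q n) 0.
    by apply: lt_le_trans (powR_ge0 _ _); rewrite ltrq0.
  have Q0' : 0 <= ratr (Q n) :> R by rewrite ler0q.
  by apply: (powR_gt_between r0' h1 h2); rewrite powR_gt_posratn ?(ltW r0') //
    -!rmorphXn ltr_rat.
move=> h; split=> //; have [Q0|Q0] := ltP (Q n) 0; [by left|right].
have Q0' : 0 <= ratr (Q n) :> R by rewrite ler0q.
have [k [l [h1 h2 h3 h4]]] := powR_gt_near r0' p0 Q0' h.
exists k, l; split=> //.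
by move: h3 h4; rewrite !powR_gt_posratn ?(ltW r0') // -!rmorphXn !ltr_rat.
Qed.

(** Reduced to [ce_powR_gt] by reciprocals, with rationals [k > c] and [l <= Q n] in place of the
    reals; inverting a positive rational just swaps the two parts of its code. *)
Lemma ce_powR_lt p c (Q : nat -> rat) : computable_real p -> 0 < p ->
  computable_real c -> 0 <= c -> crat Q -> ce (fun n => c `^ p < ratr (Q n)).
Proof.
move=> hp p0 hc c0 hQ.
pose inv k := posratn (npair (nsnd k) (nfst k)).
have invE k : inv k = (posratn k)^-1 by rewrite /inv /posratn nfstK nsndK invf_div.
pose above k : Prop := c < ratr (posratn k).
have hc1 : ce above := ce_real_ltr hc (crat_posratn computable_id).
have hinv : crat inv by rewrite /inv; computability.
have h1 : crat (fun m => inv (nfst m)) by computability.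
have h2 : crat (fun m => inv (nsnd m)) by computability.
pose big m : Prop := 0 < inv (nfst m) /\ ratr (inv (nsnd m)) < ratr (inv (nfst m)) `^ p.
have hce : ce big := ce_powR_gt hp p0 h1 h2.
apply: (@eq_ce (fun n => exists m, above (nfst m) /\ posratn (nsnd m) <= Q n /\
  big m)); last by computability.
have invp k l : (ratr (inv l) < ratr (inv k) `^ p) =
    (ratr (posratn k) `^ p < ratr (posratn l)) :> bool.
  have k0 : 0 < ratr (posratn k) :> R by rewrite ltr0q posratn_gt0.
  have l0 : 0 < ratr (posratn l) :> R by rewrite ltr0q posratn_gt0.
  have kE : (ratr (posratn k))^-1 `^ p = (ratr (posratn k) `^ p)^-1 :> R.
    by rewrite -(powR_inv1 (ltW k0)) -powRrM mulN1r powRN.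
  rewrite !invE !fmorphV kE.
  by rewrite ltf_pV2 // posrE powR_gt0.
move=> n; split=> [[m [cm [mQ [_]]]]|h].
  rewrite invp => h; apply: le_lt_trans (lt_le_trans h _); last by rewrite ler_rat.
  have cm' : c <= ratr (posratn (nfst m)) := ltW cm.
  by apply: ge0_ler_powR; rewrite ?nnegrE ?(ltW p0) // (le_trans c0).
pose y := ratr (Q n) `^ p^-1 : R.
have Qn0 : 0 < ratr (Q n) :> R by apply: le_lt_trans h; exact: powR_ge0.
have yp : y `^ p = ratr (Q n) by rewrite /y -powRrM mulVf ?gt_eqF // powRr1 // ltW.
have cy : c < y.
  rewrite ltNge; apply/negP => yc; move: h; apply/negP; rewrite -leNgt -yp.
  by apply: ge0_ler_powR; rewrite ?nnegrE ?powR_ge0 ?(ltW p0).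
have [k /andP[ck ky]] := ratn_between cy.
have [k' k'E] : exists k', posratn k' = ratn k.
  by apply: posratn_surj; rewrite -(ltr0q R) (le_lt_trans c0).
have [l lE] : exists l, posratn l = Q n by apply: posratn_surj; rewrite -(ltr0q R).
exists (npair k' l); rewrite /above /big !nfstK !nsndK k'E lE lexx; do 2!split=> //.
split; first by rewrite invE k'E invr_gt0 -(ltr0q R) (le_lt_trans c0).
rewrite invp k'E lE -yp; apply: gt0_ltr_powR; rewrite ?nnegrE ?powR_ge0 //.
by rewrite ltW // (le_lt_trans c0).
Qed.

Lemma powR_superadditive p a b : 1 <= p -> 0 <= a -> 0 <= b ->
  a `^ p + b `^ p <= (a + b) `^ p.
Proof.
move=> p1 a0 b0.
have powS x : 0 <= x -> x `^ p = x * x `^ (p - 1).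
  rewrite le_eqVlt => /orP[/eqP <-|x0].
    by rewrite mul0r powR0 // gt_eqF // (lt_le_trans _ p1).
  by rewrite -{2}(powRr1 (ltW x0)) -powRD ?[1 + (p - 1)]addrC ?subrK // (gt_eqF x0) implybT.
rewrite !powS ?addr_ge0 // mulrDl; apply: lerD; apply: ler_wpM2l => //;
  apply: ge0_ler_powR; rewrite ?nnegrE ?subr_ge0 ?addr_ge0 //.
  by rewrite lerDl.
by rewrite lerDr.
Qed.

(** If [a - b] exceeds [2^-e], then its power with exponent [p - 1] is at least [2^-(eP)], so
    [a - b] is at most [2^(eP)] times its p-th power, and superadditivity bounds the latter by the
    difference of p-th powers. The integer [P] keeps the constant dyadic. *)
Lemma sub_le_powR p (P e : nat) a b : 1 <= p -> p <= P%:R -> 0 <= b -> b <= a ->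
  a - b <= 2 ^- e + 2 ^+ (e * P) * (a `^ p - b `^ p).
Proof.
move=> p1 pP b0 ba.
have p0 : 0 < p by apply: lt_le_trans p1.
have bE : b + (a - b) = a by rewrite addrC subrK.
have d0 : 0 <= a - b by rewrite subr_ge0.
have h : (a - b) `^ p <= a `^ p - b `^ p.
  by have := powR_superadditive p1 b0 d0; rewrite bE; lra.
have e0 : 0 < 2 ^- e :> R by rewrite invr_gt0 exprn_gt0.
have E0 : 0 < 2 ^+ (e * P) :> R by rewrite exprn_gt0.
have [ab|ab] := leP (a - b) (2 ^- e).
  apply: (le_trans ab); rewrite lerDl; apply: mulr_ge0; first exact: ltW.
  by apply: (le_trans _ h); exact: powR_ge0.
have {}d0 : 0 < a - b := lt_trans e0 ab.
suff : a - b <= 2 ^+ (e * P) * (a - b) `^ p.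
  have : 2 ^+ (e * P) * (a - b) `^ p <= 2 ^+ (e * P) * (a `^ p - b `^ p) by rewrite ler_wpM2l // ltW.
  lra.
rewrite -ler_pdivrMl //.
have -> : (a - b) `^ p = (a - b) * (a - b) `^ (p - 1).
  by rewrite -{2}(powRr1 (ltW d0)) -powRD ?[1 + (p - 1)]addrC ?subrK // (gt_eqF d0) implybT.
rewrite mulrC ler_wpM2l // ?(ltW d0) //.
apply: (@le_trans _ _ ((2 ^- e) `^ (p - 1))); last first.
  by apply: ge0_ler_powR; rewrite ?nnegrE ?subr_ge0 // ltW.
apply: (@le_trans _ _ ((2 ^- e) `^ P%:R)).
  by rewrite powR_mulrn ?(ltW e0) // exprVn -exprM.
apply: ger_powR; last by lra.
by rewrite e0 invf_le1 ?exprn_gt0 // exprn_ege1 // ler1n.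
Qed.

End RealPowers.

(** * Convergence *)

Lemma relsc_powR (R : realType) (X : completeMetricType R) (s : nat -> X) (K : set X)
    (a : nat -> X -> R) p : computable_real p -> 0 < p -> (forall n x, 0 <= a n x) ->
  relsc s K a -> relsc s K (fun n x => a n x `^ p).
Proof.
move=> hp p0 a0 ha.
have h1 : crat (fun m => ratn (nsnd m)) by computability.
have h2 : crat (fun m => ratn (nfst m)) by computability.
pose big m : Prop := 0 < ratn (nsnd m) /\ ratr (ratn (nfst m)) < ratr (ratn (nsnd m)) `^ p.
have hbig : ce big := ce_powR_gt hp p0 h1 h2.
apply: (@eq_eopen _ _ _ _ (fun m x => ratn (nsnd m) < 0 \/ exists k,
    big (npair (nsnd m) k) /\ ratr (ratn k) < a (nfst m) x)); last by effective_open.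
move=> m x _; split=> [[q0|[k [[k0 kp] ka]]]|h].
- by apply: lt_le_trans (powR_ge0 _ _); rewrite ltrq0.
- rewrite !(nfstK, nsndK) in k0 kp; apply: (lt_le_trans kp).
  have k0' : 0 <= ratr (ratn k) :> R by rewrite ler0q ltW.
  by apply: ge0_ler_powR; rewrite ?nnegrE ?a0 ?(ltW p0) ?(ltW ka).
have [q0|q0] := ltP (ratn (nsnd m)) 0; [by left|right].
pose y := ratr (ratn (nsnd m)) `^ p^-1 : R.
have yp : y `^ p = ratr (ratn (nsnd m)).
  by rewrite /y -powRrM mulVf ?gt_eqF // powRr1 // ler0q.
have ya : y < a (nfst m) x.
  rewrite ltNge; apply/negP => ay; move: h; apply/negP; rewrite -leNgt -yp.
  by apply: ge0_ler_powR; rewrite ?nnegrE ?powR_ge0 ?a0 ?(ltW p0).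
have [k /andP[yk ka]] := ratn_between ya.
have k0 : 0 < ratr (ratn k) :> R by apply: le_lt_trans yk; exact: powR_ge0.
exists k; rewrite /big !(nfstK, nsndK) -(ltr0q R); split=> //; split=> //.
by rewrite -yp; apply: gt0_ltr_powR; rewrite ?nnegrE ?powR_ge0 ?(ltW k0).
Qed.

Section Convergence.
Variables (R : realType) (X : completeMetricType R) (s : nat -> X).
Variables (nu : probability (borel X) R) (F : nat -> set (set X)).
Variable rho : nat -> X -> {finite_measure set (borel X) -> \bar R}.
Hypothesis polish : computable_polish s.
Hypothesis cnu : computable_measure s nu.
Hypothesis Frho : uniform_kurtz_disintegrations s nu F rho.
Hypothesis matom : forall n x, measurable (atom_class (F n) x : set (borel X)).
Hypothesis F_sigma : forall n, sigma_algebra setT (F n).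
Hypothesis F_measurable : forall n S, F n S -> measurable (S : set (borel X)).
Hypothesis F_mono : forall n, F n `<=` F n.+1.
Local Notation K := (KR s nu).
Let mK : measurable (K : set (borel X)) := measurable_KR s nu.
Let K0 : nu (~` K) = 0%E := measure_setC_KR s nu.

Variables (D : nat -> set X) (q : nat -> rat) (idx bd : nat -> nat).
Hypothesis hD : eopen s K D.
Hypothesis hDC : eopen s K (fun i x => ~ D i x).
Hypothesis hq : crat q.
Hypothesis hidx : computable idx.
Hypothesis hbd : computable bd.
Hypothesis q_le : forall i, q i <= (bd i)%:R.
Hypothesis D_idx : forall i, F (idx i) (D i).

Let step_max : nat -> X -> R := step_max D q.
Let step_level := step_level idx.
Let cond_step := cond_step s nu rho D q.

Variables (p c : R) (f : X -> \bar R).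
Hypothesis hp : computable_real p.
Hypothesis p1 : 1 <= p.
Hypothesis hc : computable_real c.
Hypothesis f0 : forall x, (0 <= f x)%E.
Hypothesis mf : measurable_fun setT (f : borel X -> \bar R).
Hypothesis fc : ('N[nu]_(p%:E)[f] = c%:E)%E.
Hypothesis step_max_le_f : forall t x, K x -> ((step_max t x)%:E <= f x)%E.
Hypothesis step_max_sup : forall x a, K x -> 0 <= a -> (a%:E < f x)%E ->
  exists t, a < step_max t x.

Let p0 : 0 < p. Proof. by apply: lt_le_trans p1. Qed.

Let mphi (A : set (borel X)) t : measurable_fun A (step_max t : borel X -> R).
Proof.
by apply: measurable_funTS; exact (@measurable_step_max _ _ _ F_measurable _ q _ D_idx t).
Qed.

Let mphip (A : set (borel X)) t : measurable_fun A (fun x : borel X => (step_max t x `^ p)%:E).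
Proof.
apply/measurable_EFinP; apply: (measurableT_comp (measurable_powR p)); exact: mphi.
Qed.

Let phi0 t x : 0 <= step_max t x. Proof. exact: step_max_ge0. Qed.

Let c0 : 0 <= c.
Proof. by rewrite -lee_fin -fc Lnorm_ge0. Qed.

Let integral_powf : (\int[nu]_(x in K) (f x `^ p) = (c `^ p)%:E)%E.
Proof.
rewrite -(ge0_integral_full mK K0); last 2 first.
- by apply: (measurableT_comp (measurable_poweR p)); exact: mf.
- by move=> x; exact: poweR_ge0.
have pn0 : p != 0 by rewrite gt_eqF.
have := poweR_Lnorm nu f pn0; rewrite fc poweR_EFin => ->.
by apply: eq_integral => x _; rewrite gee0_abs.
Qed.

Let phip_le t x : K x -> ((step_max t x `^ p)%:E <= f x `^ p)%E.
Proof.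
move=> Kx; rewrite -poweR_EFin; apply: gt0_ler_poweR; rewrite ?(ltW p0) //.
- by rewrite in_itv /= lee_fin phi0 leey.
- by rewrite in_itv /= f0 leey.
- exact: step_max_le_f.
Qed.

Let mfp (A : set (borel X)) : measurable_fun A (fun x : borel X => f x `^ p)%E.
Proof.
by apply: measurable_funTS; apply: (measurableT_comp (measurable_poweR p)); exact: mf.
Qed.

Let Ip t := fine (\int[nu]_(x in K) (step_max t x `^ p)%:E)%E.

Let IpE t : (\int[nu]_(x in K) (step_max t x `^ p)%:E = (Ip t)%:E)%E.
Proof.
rewrite fineK // ge0_fin_numE; last first.
  by apply: integral_ge0 => x _; rewrite lee_fin powR_ge0.
apply: (@le_lt_trans _ _ (c `^ p)%:E); last exact: ltry.
rewrite -integral_powf; apply: ge0_le_integral => //.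
- by move=> x _; rewrite lee_fin powR_ge0.
- by move=> x Kx; exact: phip_le.
Qed.

Let Ip_le t : Ip t <= c `^ p.
Proof.
rewrite -lee_fin -IpE -integral_powf; apply: ge0_le_integral => //.
- by move=> x _; rewrite lee_fin powR_ge0.
- by move=> x Kx; exact: phip_le.
Qed.

(** Monotone convergence in the guise of Fatou's lemma: the p-th powers of the steps rise to that of
    [f] on [K]. *)
Let Ip_sup e : 0 < e -> exists t, c `^ p - e < Ip t.
Proof.
move=> e0; apply: contrapT => /forallNP h.
have g0 t x : K x -> (0 <= (step_max t x `^ p)%:E)%E by rewrite lee_fin powR_ge0.
have := fatou nu mK (fun t => @mphip K t) g0.
rewrite (eq_integral (fun x : borel X => f x `^ p)%E) => [|x /[!inE] Kx].
  rewrite integral_powf; apply/negP; rewrite -ltNge.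
  apply: (@le_lt_trans _ _ (c `^ p - e)%:E); last by rewrite lte_fin; lra.
  by apply: limn_einf_le => t; rewrite IpE lee_fin leNgt; apply/negP/h.
apply/eqP; rewrite eq_le; apply/andP; split.
  by apply: limn_einf_le => t; exact: phip_le.
rewrite leNgt; apply/negP => /ratn_lte[k [h1 h2]].
move: h1; apply/negP; rewrite -leNgt; set a := ratr (ratn k) in h2 *.
have [a0|a0] := ltP a 0.
  apply: (@le_limn_einf _ _ _ 0) => t _; rewrite lee_fin (le_trans (ltW a0)) //.
  exact: powR_ge0.
pose y := a `^ p^-1.
have yp : y `^ p = a by rewrite /y -powRrM mulVf ?gt_eqF // powRr1.
have y0 : 0 <= y by exact: powR_ge0.
have [|t yt] := @step_max_sup x y Kx y0.
  rewrite ltNge; apply/negP => fy; move: h2; apply/negP; rewrite -leNgt -yp -poweR_EFin.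
  by apply: gt0_ler_poweR; rewrite ?(ltW p0) // in_itv /= ?lee_fin ?f0 ?y0 leey.
apply: (@le_limn_einf _ _ _ t) => m tm; rewrite lee_fin -yp.
apply: ge0_ler_powR; rewrite ?nnegrE ?(ltW p0) ?phi0 //.
by apply: (le_trans (ltW yt)); exact: step_max_mono.
Qed.

(** [P] is an integer above [p]. By [sub_le_powR] with [e = 3i], a gap of [2^-(dl i)] in the
    integrals of p-th powers leaves an L_1 gap of at most [2^-3i + 2^(3iP) 2^-(dl i)], which is
    [2 * 2^-3i]. *)
Let P := (Num.truncn p).+1.
Let dl i := (i * 3 + i * 3 * P)%N.

(** [Ip t] can be approximated from below and [c^p] from above, so the search looks for a rational
    [k] with [c^p - 2^-(dl i) < k < Ip t]. *)
Let approximation_levels : exists2 t0, computable t0 &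
  forall i, c `^ p - 2 ^- dl i < Ip (t0 i).
Proof.
have hdl : computable dl by rewrite /dl; computability.
have [p1' _] := ecomp_step_max hD hDC hq.
have hphi : relsc s K (fun t x => step_max t x `^ p) := relsc_powR hp p0 phi0 p1'.
have helsc : elsc s K (fun t x => (step_max t x `^ p)%:E) by apply: (proj2 (elscEFin _ _ _)).
have g0 t x : K x -> (0 <= (step_max t x `^ p)%:E)%E by rewrite lee_fin powR_ge0.
pose S1 m : Prop := ((ratr (ratn (nsnd m)))%:E < \int[nu]_(x in K) (step_max (nfst m) x `^ p)%:E)%E.
have hS1 : ce S1 := ce_integral_gt polish cnu mK K0 g0 helsc
  (computable_fst computable_id) (crat_ratn (computable_snd computable_id)).
have hQ2 : crat (fun m => ratn (nsnd m) + 2 ^- dl (nfst m)) by computability.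
pose S2 m : Prop := c `^ p < ratr (ratn (nsnd m) + 2 ^- dl (nfst m)).
have hS2 : ce S2 := ce_powR_lt hp p0 hc c0 hQ2.
have hS : ce (fun m => exists k, S1 (npair (nsnd m) k) /\ S2 (npair (nfst m) k)) by computability.
have [i|t0 ht0 t0P] := @ce_select (fun i t => exists k, S1 (npair t k) /\ S2 (npair i k)) hS.
  have e0 : 0 < 2 ^- dl i :> R by rewrite invr_gt0 exprn_gt0.
  have [t ct] := Ip_sup e0; have [k /andP[h1 h2]] := ratn_between ct.
  exists t, k; rewrite /S1 /S2 !(nfstK, nsndK) IpE lte_fin; split=> //.
  by rewrite rmorphD /= ratr_exp2V -ltrBlDr.
exists t0 => // i; have [k [h1 h2]] := t0P i; move: h1 h2.
rewrite /S1 /S2 !(nfstK, nsndK) IpE lte_fin rmorphD /= ratr_exp2V => h1 h2.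
by rewrite (lt_trans _ h1) // ltrBlDr.
Qed.

(** Stated for any measure carried by [K] so as to apply to a single [rho n x], about which
    statements holding [nu]-almost everywhere give no information. *)
Lemma fatou_step_max (mu : {measure set (borel X) -> \bar R}) (t : nat -> nat) (L : \bar R) :
  (forall i, (i <= t i)%N) -> mu (~` K) = 0%E ->
  (forall i, (\int[mu]_(x in K) (step_max (t i) x)%:E <= L)%E) -> (\int[mu]_x f x <= L)%E.
Proof.
move=> it muK hL; rewrite (ge0_integral_full mK muK) //.
have g0 i x : K x -> (0 <= (step_max (t i) x)%:E)%E by rewrite lee_fin.
have mg i : measurable_fun (K : set (borel X)) (fun x : borel X => (step_max (t i) x)%:E).
  by apply/measurable_EFinP; exact: mphi.
have := fatou mu mK mg g0; rewrite (eq_integral (f : borel X -> \bar R)) => [|x /[!inE] Kx].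
  by move=> /le_trans; apply; exact: limn_einf_le.
apply/eqP; rewrite eq_le; apply/andP; split.
  by apply: limn_einf_le => i; exact: step_max_le_f.
rewrite leNgt; apply/negP => /ratn_lte[k [h1 h2]].
move: h1; apply/negP; rewrite -leNgt; set a := ratr (ratn k) in h2 *.
have [a0|a0] := ltP a 0.
  apply: (@le_limn_einf _ _ _ 0) => i _; rewrite lee_fin (le_trans (ltW a0)) //.
have [m am] := step_max_sup Kx a0 h2.
apply: (@le_limn_einf _ _ _ m) => i mi; rewrite lee_fin (le_trans (ltW am)) //.
by apply: step_max_mono; exact: leq_trans (it i).
Qed.

Let levels : exists2 t, computable t &
  [/\ forall i, (i <= t i)%N, forall i, (t i <= t i.+1)%N &
      forall i, c `^ p - 2 ^- dl i < Ip (t i)].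
Proof.
have [t0 ht0 t0P] := approximation_levels.
(* Partial sums of successors make the levels monotone and at least [i]; raising a level only
   increases [Ip]. *)
have ht : computable (fun i => \sum_(l < i.+1) (t0 l).+1)%N.
  have h1 : computable (fun i => i.+1) by computability.
  have h2 : computable (fun m => (t0 (nsnd m)).+1) by computability.
  exact: (computable_sum (f := fun _ l => (t0 l).+1) h1 h2).
exists (fun i => \sum_(l < i.+1) (t0 l).+1)%N => //; split=> [i|i|i].
- elim: i => [|i IH]; first by [].
  by rewrite big_ord_recr /= addnS ltnS (leq_trans IH) // leq_addr.
- by rewrite [leqRHS]big_ord_recr leq_addr.
apply: lt_le_trans (t0P i) _; rewrite -lee_fin -!IpE.
apply: ge0_le_integral => //; first by move=> x _; rewrite lee_fin powR_ge0.
move=> x _; rewrite lee_fin; apply: ge0_ler_powR; rewrite ?nnegrE ?(ltW p0) ?phi0 //.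
by apply: step_max_mono; rewrite big_ord_recr /= (leq_trans (leqnSn _)) // leq_addl.
Qed.

Let diff_bound i t t' : (t <= t')%N -> c `^ p - 2 ^- dl i < Ip t ->
  (\int[nu]_x (step_max t' x - step_max t x)%:E <= (2 * 2 ^- (i * 3))%:E)%E.
Proof.
move=> tt' ht.
have md (A : set (borel X)) :
    measurable_fun A (fun y : borel X => (step_max t' y - step_max t y)%:E).
  by apply/measurable_EFinP/measurable_funB; exact: mphi.
have d0 x : (0 <= (step_max t' x - step_max t x)%:E)%E by rewrite lee_fin subr_ge0 step_max_mono.
rewrite (ge0_integral_full mK K0) //.
pose E := 2 ^+ (i * 3 * P) : R.
have E0 : 0 <= E by rewrite exprn_ge0.
have mE t1 (A : set (borel X)) :
    measurable_fun A (fun x : borel X => E%:E * (step_max t1 x `^ p)%:E)%E.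
  by apply: measurable_funeM; exact (@mphip A t1).
have pE0 t1 x : (0 <= E%:E * (step_max t1 x `^ p)%:E)%E by rewrite mule_ge0 // lee_fin // powR_ge0.
have IE t1 : (\int[nu]_(x in K) (E%:E * (step_max t1 x `^ p)%:E) = (E * Ip t1)%:E)%E.
  rewrite ge0_integralZl // ?IpE ?EFinM //.
  by move=> x _; rewrite lee_fin powR_ge0.
have pP : p <= P%:R by exact/ltW/truncnS_gt.
have : (\int[nu]_(x in K) ((step_max t' x - step_max t x)%:E + E%:E * (step_max t x `^ p)%:E) <=
    \int[nu]_(x in K) ((2 ^- (i * 3))%:E + E%:E * (step_max t' x `^ p)%:E))%E.
  apply: ge0_le_integral => //.
  - by move=> x _; rewrite adde_ge0.
  - by apply: emeasurable_funD.
  - by apply: emeasurable_funD.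
  move=> x _; rewrite -!EFinM -!EFinD lee_fin.
  have := @sub_le_powR _ p P (i * 3) (step_max t' x) (step_max t x) p1 pP (phi0 _ _)
    (step_max_mono _ _ _ tt').
  by rewrite -/E; lra.
rewrite ge0_integralD // ge0_integralD //.
rewrite !IE (integral_cst nu mK) [X in (_ <= _ * X + _)%E](_ : _ = 1%E); last first.
  exact: probability_full mK K0.
rewrite mule1 -EFinD.
have I0 : (0 <= \int[nu]_(x in K) (step_max t' x - step_max t x)%:E)%E by apply: integral_ge0.
case: (\int[nu]_(x in K) (step_max t' x - step_max t x)%:E)%E I0 => [z| |] // _.
rewrite -EFinD !lee_fin => h.
have h3 : E * (Ip t' - Ip t) <= E * 2 ^- dl i.
  by apply: ler_wpM2l => //; have := Ip_le t'; lra.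
have h4 : E * 2 ^- dl i = 2 ^- (i * 3).
  rewrite /E /dl exprD invfM mulrCA mulfV ?mulr1 //.
lra.
Qed.

Let small_differences (t : nat -> nat) : computable t ->
  (forall i, (t i <= t i.+1)%N) -> (forall i, c `^ p - 2 ^- dl i < Ip (t i)) ->
  forall x, SR s nu x -> exists I, forall i, (I <= i)%N ->
    forall n, (n <= step_level (t i.+1))%N ->
    cond_step n (t i.+1) x - cond_step n (t i) x < 2 ^- i.
Proof.
move=> ht tS tI x SRx.
have Kx : K x := SR_sub_KR polish cnu SRx.
have hlev : computable step_level := computable_step_level hidx.
have hcexp : ecomp s K (fun m => cond_step (nfst m) (nsnd m)).
  exact: (ecomp_cond_step polish Frho matom F_measurable hD hDC hq hbd q_le D_idx).
pose dif i n y := cond_step n (t i.+1) y - cond_step n (t i) y.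
pose a i y :=
  Num.min (ratr 1) (bmax (fun n => dif i n y) (step_level (t i.+1)).+1 / ratr (2 ^- i)).
have ha : ecomp s K a.
  apply: ecomp_min; first by apply: ecomp_ratr; computability.
  apply: ecomp_div; [by computability|by move=> i; rewrite invr_gt0 exprn_gt0|].
  apply: (@ecomp_bmax _ _ _ _ dif); last by computability.
  have h0 : computable (fun m => nsnd m) by computability.
  have h1 : computable (fun m => t (nfst m).+1) by computability.
  have h2 : computable (fun m => t (nfst m)) by computability.
  exact: (ecomp_sub (ecomp_app2 hcexp h0 h1) (ecomp_app2 hcexp h0 h2)).
have cE i : ratr (2 ^- i) = 2 ^- i :> R by exact: ratr_exp2V.
have aE i y : a i y = Num.min 1 (2 ^+ i * bmax (fun n => dif i n y) (step_level (t i.+1)).+1).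
  by rewrite /a rmorph1 cE invrK mulrC.
have p20 i : 0 < 2 ^+ i :> R by rewrite exprn_gt0.
have a01 i y : K y -> 0 <= a i y <= 1.
  move=> _; rewrite aE le_min ler01 ge_min lexx andbT.
  by apply: mulr_ge0; [exact/ltW/p20|exact: bmax_ge0].
have aC i : (\int[nu]_(y in K) (a i y)%:E <= (3%:R * 2 ^- i)%:E)%E.
  rewrite (eq_integral (fun y : borel X => (Num.min 1 (2 ^+ i *
    bmax (fun n => dif i n y) (step_level (t i.+1)).+1))%:E)) => [|y _]; last by rewrite aE.
  have d0 : 0 < 2 ^- (i * 2) :> R by rewrite invr_gt0.
  have := @cond_step_maximal _ _ _ _ _ _ polish Frho matom F_sigma F_measurable F_mono _ _ _ _
    hD hDC hq hbd q_le D_idx (t i) (t i.+1) (step_level (t i.+1)).+1 _ _ (tS i) (ltW (p20 i)) d0.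
  move=> /le_trans; apply.
  have := diff_bound (tS i) (tI i); rewrite invrK => h.
  (* The two terms equal [2^-i] and [2 * 2^-i], whence the constant 3. *)
  apply: (@le_trans _ _ ((2 ^+ i * 2 ^- (i * 2))%:E +
      (2 ^+ (i * 2))%:E * (2 * 2 ^- (i * 3))%:E)%E).
    by apply: leeD => //; apply: lee_wpmul2l => //; rewrite lee_fin ltW.
  have i0 : 2 ^+ i != 0 :> R by rewrite gt_eqF.
  rewrite -EFinM -EFinD lee_fin !exprM le_eqVlt; apply/orP; left; apply/eqP.
  by field.
have [I hI] := borel_cantelli polish cnu mK K0 ha a01 aC SRx Kx.
exists I => i Ii n nl; have := hI i Ii; rewrite aE gt_min ltxx /= => h.
have h1 : dif i n x <= bmax (fun n => dif i n x) (step_level (t i.+1)).+1.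
  by apply: (@le_bmax _ (fun n => dif i n x)); rewrite ltnS.
by apply: (le_lt_trans h1); move: h; rewrite mulrC -ltr_pdivlMr ?div1r.
Qed.

Lemma convergence_levels : exists2 N, computable N & forall x, SR s nu x ->
  [/\ forall n, (\int[rho n x]_y f y)%E \is a fin_num, f x \is a fin_num &
    exists I, forall k, (I <= k)%N -> forall n, (N k <= n)%N ->
      (`|\int[rho n x]_y f y - f x| <= (2 * 2 ^- k)%:E)%E].
Proof.
have [t ht [it tS tI]] := levels.
have hlev : computable step_level := computable_step_level hidx.
exists (fun k => step_level (t k)) => [|x SRx]; first by computability.
have Kx : K x := SR_sub_KR polish cnu SRx.
have [I hI] := small_differences ht tS tI SRx.
have lv n i : (step_level (t i) <= n)%N -> cond_step n (t i) x = step_max (t i) x.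
  by move=> h; exact: (cond_step_level Frho matom F_measurable F_mono q_le D_idx Kx h).
have lvS i : (step_level (t i) <= step_level (t i.+1))%N by exact: step_level_mono.
have phid i : (I <= i)%N -> step_max (t i.+1) x - step_max (t i) x < 2 ^- i.
  by move=> Ii; have := hI i Ii (step_level (t i.+1)) (leqnn _); rewrite !lv.
have cexpd n i : (I <= i)%N -> cond_step n (t i.+1) x - cond_step n (t i) x < 2 ^- i.
  (* The test covers finitely many [n]. Beyond them both conditional expectations equal the step
     functions, whose difference was bounded in [phid] by the test at [n = step_level (t i.+1)]. *)
  move=> Ii; have [nl|nl] := leqP n (step_level (t i.+1)); first exact: hI.
  by rewrite !lv ?phid // ltnW // (leq_ltn_trans _ nl).
have tele (y : nat -> R) k j : (forall i, (k <= i)%N -> y i.+1 - y i < 2 ^- i) ->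
    y (k + j)%N <= y k + 2 * (2 ^- k - 2 ^- (k + j)).
  move=> hy; elim: j => [|j IH]; first by rewrite addn0 subrr mulr0 addr0.
  rewrite addnS; have := hy (k + j)%N (leq_addr _ _).
  by rewrite [in X in _ -> X]exprS invfM; lra.
have t_mono i j : (i <= j)%N -> (t i <= t j)%N.
  by move=> /subnKC <-; elim: (j - i)%N => [|l IH]; rewrite ?addn0 // addnS (leq_trans IH).
have cmono n i j : (i <= j)%N -> cond_step n (t i) x <= cond_step n (t j) x.
  by move=> ij; exact: (cond_step_mono Frho matom F_measurable q_le D_idx n Kx (t_mono _ _ ij)).
have upper (y : nat -> R) k i : (forall i j, (i <= j)%N -> y i <= y j) ->
    (forall i, (k <= i)%N -> y i.+1 - y i < 2 ^- i) -> y i <= y k + 2 * 2 ^- k.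
  move=> ym yd; have p0' j : 0 < 2 ^- j :> R by rewrite invr_gt0 exprn_gt0.
  have [ik|ki] := leqP i k; first by have := ym _ _ ik; have := p0' k; lra.
  have := tele y k (i - k)%N yd; rewrite subnKC ?(ltnW ki) //.
  by have := p0' i; lra.
have intf_le n k : (I <= k)%N -> (\int[rho n x]_y f y <= (cond_step n (t k) x + 2 * 2 ^- k)%:E)%E.
  move=> Ik; apply: (@fatou_step_max (rho n x) t) => //.
    exact: (kurtz_setC Frho matom n Kx).
  move=> i; rewrite (cond_stepE Frho matom F_measurable q_le D_idx n (t i) Kx) lee_fin.
  apply: (upper (fun i => cond_step n (t i) x)) => [a b|a ka]; first exact: cmono.
  by apply: cexpd; exact: leq_trans ka.
have intf_ge n k : ((cond_step n (t k) x)%:E <= \int[rho n x]_y f y)%E.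
  rewrite -(cond_stepE Frho matom F_measurable q_le D_idx n (t k) Kx).
  rewrite [leRHS](ge0_integral_full mK (kurtz_setC Frho matom n Kx)) //.
  apply: ge0_le_integral => //.
  - by move=> y _; rewrite lee_fin.
  - by apply/measurable_EFinP; exact: mphi.
  - exact: measurable_funTS.
  - by move=> y Ky; exact: step_max_le_f.
have f_le k : (I <= k)%N -> (f x <= (step_max (t k) x + 2 * 2 ^- k)%:E)%E.
  move=> Ik; rewrite leNgt; apply/negP => h.
  have [|m hm] := step_max_sup Kx _ h.
    by rewrite addr_ge0 // mulr_ge0 // invr_ge0 exprn_ge0.
  have h1 : step_max m x <= step_max (t m) x by exact: step_max_mono.
  have := upper (fun i => step_max (t i) x) k m
    (fun a b ab => step_max_mono D q x (t_mono _ _ ab)) (fun a ka => phid a (leq_trans Ik ka)).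
  by lra.
have f_ge k : ((step_max (t k) x)%:E <= f x)%E by exact: step_max_le_f.
have intf_fin n : (\int[rho n x]_y f y)%E \is a fin_num.
  rewrite ge0_fin_numE; last by apply: integral_ge0.
  by apply: le_lt_trans (intf_le n I (leqnn _)) _; exact: ltry.
have f_fin : f x \is a fin_num.
  by rewrite ge0_fin_numE // (le_lt_trans (f_le I (leqnn _))) // ltry.
split=> //; exists I => k Ik n nk.
have := intf_le n k Ik; have := intf_ge n k; have := f_le k Ik; have := f_ge k.
rewrite lv // -(fineK (intf_fin n)) -(fineK f_fin).
rewrite -EFinB abse_EFin !lee_fin => h1 h2 h3 h4.
by rewrite ler_norml; apply/andP; split; lra.
Qed.

End Convergence.

(** * From a Schnorr test to steps of the filtration *)

Section EffectiveFiltration.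
Variables (R : realType) (X : completeMetricType R) (s : nat -> X).
Variable nu : probability (borel X) R.
Hypothesis polish : computable_polish s.
Local Notation K := (KR s nu).

(** [B j] together with the complement of [C j] is c.e. open of measure 1, hence contains every
    Kurtz random point. So on [K] the complement of [B j] coincides with the open complement of
    [C j]. *)
Lemma eopen_basis (B : nat -> set X) : computable_basis s nu B ->
  [/\ forall j, open (B j), eopen s K B & eopen s K (fun j x => ~ B j x)].
Proof.
move=> [hB _ _ [C [hC BC nuC]]].
have hB' : eopen s setT B by exact: computable_seq_eopen hB.
have hC' : eopen s setT (fun j => ~` C j) by exact: computable_seq_eopen hC.
have oB j : open (B j) by have [g _ gB] := hB; rewrite (gB j); exact: open_listed.
have oC j : open (~` C j) by have [g _ gC] := hC; rewrite (gC j); exact: open_listed.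
split=> //; first exact: computable_seq_eopen hB.
apply: (@eq_eopen _ _ _ _ (fun j => ~` C j)); last exact: computable_seq_eopen hC.
move=> j x Kx; split=> [nC Bx|nB Cx]; first exact/nC/BC.
have mB : measurable (B j : set (borel X)) by exact: measurable_open.
have mC : measurable (~` C j : set (borel X)) by exact: measurable_open.
have BC0 : B j `&` ~` C j = set0 by apply/seteqP; split=> // y [/BC].
have : nu (B j `|` ~` C j) = 1%E.
  have e : (nu (B j `|` ~` C j) = nu (B j) + nu (~` C j))%E by exact: measureU.
  have e' := probability_setC nu mC; rewrite setCK in e'.
  by rewrite e -nuC e' subeK // fin_num_measure.
by move=> /(Kx _ (eopen_ce_open polish (eopen_or hB' hC') j))[].
Qed.

Variables (F : nat -> set (set X)).
Variable rho : nat -> X -> {finite_measure set (borel X) -> \bar R}.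
Hypothesis cnu : computable_measure s nu.
Hypothesis hF : effective_filtration s nu F.
Hypothesis Frho : uniform_kurtz_disintegrations s nu F rho.

(** Step [i] codes a pair: a threshold [k] and a position [l] in the list of algebra members that
    make up the set [f > ratn k] on [K]. Its height is [ratn k]. On [K] every step lies below [f],
    and every rational below [f x] is the height of some step containing [x]. *)
Lemma schnorr_levels p f : computable_real p -> 1 <= p -> schnorr_test s nu p f ->
  exists2 N, computable N & forall x, SR s nu x ->
  [/\ forall n, (\int[rho n x]_y f y)%E \is a fin_num, f x \is a fin_num &
    exists I, forall k, (I <= k)%N -> forall n, (N k <= n)%N ->
      (`|\int[rho n x]_y f y - f x| <= (2 * 2 ^- k)%:E)%E].
Proof.
move=> hp p1 [[gf hgf [_ fU]] f0 [c hc fc]].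
have [F_mono [B [t [hB ht FE hU]]]] := hF.
pose A n m := alg_set B (t n m).
have [oB eB eBC] := eopen_basis hB.
have mA n m : measurable (A n m : set (borel X)) by exact: measurable_alg_set.
have F_sigma n : sigma_algebra setT (F n) by rewrite FE; exact: smallest_sigma_algebra.
have F_measurable n S : F n S -> measurable (S : set (borel X)).
  by rewrite FE; apply: generated_sub_borel => m; exact: mA.
have matom n x : measurable (atom_class (F n) x : set (borel X)).
  by rewrite FE; apply: measurable_atom_class => m; exact: mA.
pose e k := t (nfst k) (nsnd k).
have eA : eopen s K (fun k => A (nfst k) (nsnd k)).
  exact: (eopen_alg_set (e := e) eB eBC ht).
have eAC : eopen s K (fun k x => ~ A (nfst k) (nsnd k) x).
  have ht' : computable (fun k => alg_code (ACompl (e k))).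
    exact: (computable_pair (computable_const 1) ht).
  exact: (eopen_alg_set (e := fun k => ACompl (e k)) eB eBC ht').
pose U k : set X := [set x | ((ratr (ratn k))%:E < f x)%E].
have hUk : computable_seq (open_name s) U by exists gf.
have eU : eopen s setT U by exact: computable_seq_eopen hUk.
have [g hg gU] := uniform_eopen polish hU eU.
have gP k x : K x -> (U k x <-> exists l a, g (npair k l) = a.+1 /\ A (nfst a) (nsnd a) x).
  move=> Kx; have /seteqP[h1 h2] := gU k; split=> [Ux|h].
    by have [/listedP[l [a [ga Aa]]] _] := h1 x (conj Ux Kx); exists l, a.
  have : listed (fun k => alg_set B (t (nfst k) (nsnd k))) (slice g k) x.
    by apply/listedP; have [l [a ?]] := h; exists l, a.
  by move=> hl; have [] := h2 x (conj hl Kx).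
(* Where the list has the entry 0, the step is empty. *)
pose D i : set X := [set x | (g i != 0)%N /\ A (nfst (g i).-1) (nsnd (g i).-1) x].
pose q i := ratn (nfst i).
pose idx i := nfst (g i).-1.
pose bd i := rpos (nfst i).
have hD : eopen s K D.
  have h1 : computable (fun i => (g i).-1) by computability.
  by apply: eopen_and; [effective_open|exact: (eopen_comp eA h1)].
have hDC : eopen s K (fun i x => ~ D i x).
  have h1 : computable (fun i => (g i).-1) by computability.
  apply: (@eq_eopen _ _ _ _ (fun i x => (g i == 0)%N \/
     ~ A (nfst (g i).-1) (nsnd (g i).-1) x)).
    move=> i x _; rewrite /D /=; case: eqP => gi; split=> //.
    - by move=> _ [].
    - by left.
    - by case=> // nA [].
    - by move=> h; right=> Ax; apply: h.
  by apply: eopen_or; [effective_open|exact: (eopen_comp eAC h1)].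
have hq : crat q by rewrite /q; computability.
have hidx : computable idx by rewrite /idx; computability.
have hbd : computable bd by rewrite /bd /rpos; computability.
have q_le i : q i <= (bd i)%:R.
  rewrite /q /bd ratnE ler_pdivrMr ?ltr0n //.
  apply: (@le_trans _ _ (rpos (nfst i))%:R); first by rewrite lerBlDr lerDl.
  by rewrite -natrM ler_nat leq_pmulr.
have D_idx i : F (idx i) (D i).
  rewrite /D /idx; case E: (g i) => [|a] /=.
    have -> : [set x | (0 != 0)%N /\ A (nfst 0) (nsnd 0) x] = set0.
      by apply/seteqP; split=> // x [].
    by case: (F_sigma (nfst 0)).
  have -> : [set x | (a.+1 != 0)%N /\ A (nfst a) (nsnd a) x] = A (nfst a) (nsnd a).
    by apply/seteqP; split=> x // [].
  by rewrite FE; apply: sub_sigma_algebra; exists (nsnd a).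
have Df i x : K x -> D i x -> ((ratr (q i))%:E < f x)%E.
  move=> Kx [gi Ax]; apply/(gP _ _ Kx); exists (nsnd i), (g i).-1.
  by rewrite npairK prednK ?lt0n.
have mf : measurable_fun setT (f : borel X -> \bar R).
  have h : elsc s setT (fun _ : nat => f) by exact: (eopen_comp eU (computable_snd computable_id)).
  exact (@elsc_measurable _ _ _ polish [set: borel X] (fun _ => f) 0%N measurableT h).
apply: (convergence_levels polish cnu Frho matom F_sigma F_measurable F_mono hD hDC hq
  hidx hbd q_le D_idx hp p1 hc f0 mf fc).
- move=> k x Kx; have := f0 x; have := Df ^~ x.
  case: (f x) => [r| |] h r0; [|by rewrite leey|by []].
  rewrite lee_fin; apply: bmax_le => // i _; case: asboolP => // Dx.
  by have := h i Kx Dx; rewrite lte_fin; exact: ltW.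
- move=> x a Kx a0 /ratn_lte[k [ak kf]].
  have [l [b [gb Ab]]] := (gP k x Kx).1 kf.
  (* The successor is there because [step_max t] uses the steps with index below [t]. *)
  exists (npair k l).+1; apply/lt_bmax; right; exists (npair k l); split=> //.
  have Dx : D (npair k l) x by rewrite /D /= gb.
  by rewrite asboolT // /q nfstK -lte_fin.
Qed.

End EffectiveFiltration.

Lemma computable_convergence_rate (R : realType) (y_ : nat -> \bar R) (y : \bar R)
    (N : nat -> nat) (I : nat) : computable N ->
  (forall n, y_ n \is a fin_num) -> y \is a fin_num ->
  (forall k, (I <= k)%N -> forall n, (N k <= n)%N -> (`|y_ n - y| <= (2 * 2 ^- k)%:E)%E) ->
  exists2 m, convergence_rate y_ y m & computable (m \o posratn).
Proof.
move=> hN y_fin yfin h.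
(* The first disjunct makes the search total on all rationals, as [m] has to be defined at
   nonpositive ones too. *)
have H (eps : rat) : exists b, (eps <= 0) || (2 * 2 ^- b < eps).
  have [e0|e0] := leP eps 0; first by exists 0%N.
  have e1 : 0 < ratr eps / 2 :> R by rewrite divr_gt0 // ltr0q.
  have [b _ hb] := near_infty_natSinv_expn_lt (PosNum e1).
  exists b; rewrite -(ltr_rat R) rmorphM /= ratr_exp2V ratr_nat.
  by have := hb b (leqnn b); rewrite /= div1r; lra.
exists (fun eps => N (I + ex_minn (H eps))%N).
  split=> // eps e0 n; case: ex_minnP => b.
  rewrite leNgt e0 /= => hb _ Nn.
  apply: le_lt_trans (h _ (leq_addr _ _) _ Nn) _; rewrite lte_fin.
  move: hb; rewrite -(ltr_rat R) rmorphM /= ratr_exp2V ratr_nat.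
  apply: le_lt_trans; rewrite ler_pM2l // lef_pV2 ?posrE ?exprn_gt0 //.
  by rewrite ler_eXn2l ?ltr1n // leq_addl.
apply: (computable_comp hN); apply: computable_add; first exact: computable_const.
apply: (computable_ex_minn (P := fun k b => (posratn k <= 0) || (2 * 2 ^- b < posratn k))
  (fun k => H (posratn k))).
by computability.
Qed.

Theorem theorem1p6 (R : realType) (X : completeMetricType R) (s : nat -> X)
    (nu : probability (borel X) R) (F : nat -> set (set X))
    (rho : nat -> X -> {finite_measure set (borel X) -> \bar R}) :
  computable_polish s ->
  computable_measure s nu ->
  effective_filtration s nu F ->
  uniform_kurtz_disintegrations s nu F rho ->
  (forall x, SR s nu x ->
   forall p : R, computable_real p -> 1 <= p ->
   forall f : X -> \bar R, schnorr_test s nu p f ->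
   weakly_computes s x
     (convergence_rate (fun n => \int[rho n x]_y f y)%E (f x))) /\
  (forall x, SR s nu x -> computably_dominated_degree s x ->
   forall p : R, computable_real p -> 1 <= p ->
   forall f : X -> \bar R, schnorr_test s nu p f ->
   exists2 m : rat -> nat,
     convergence_rate (fun n => \int[rho n x]_y f y)%E (f x) m &
     computable (m \o posratn)).
Proof.
move=> polish cnu hF Frho.
have rate x : SR s nu x -> forall p : R, computable_real p -> 1 <= p ->
   forall f : X -> \bar R, schnorr_test s nu p f ->
   exists2 m : rat -> nat,
     convergence_rate (fun n => \int[rho n x]_y f y)%E (f x) m &
     computable (m \o posratn).
  move=> SRx p hp p1 f hf.
  have [N hN NP] := schnorr_levels polish cnu hF Frho hp p1 hf.
  have [fin1 fin2 [I hI]] := NP x SRx.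
  exact: computable_convergence_rate hN fin1 fin2 hI.
split=> x SRx => [p hp p1 f hf nm _|_]; last exact: rate.
have [m hm cm] := rate x SRx p hp p1 f hf.
by exists m => //; exact: computable_turing_le.
Qed.
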